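(* (1) For $j\in\mathbb{N}_0$ and $\mu,\nu\in\mathbb{C}$ with $\Re\mu,\Re\nu>-1$, and $x>0$, $$\Lambda_{1,j}^{\mu,\nu}(x)=\frac{1}{\pi\Gamma(\frac{\mu+1}{2})\Gamma(\frac{\nu+1}{2})}\int_0^\pi\!\!\int_0^\pi e^{-x\cos\phi}L_j^{\frac{\mu+\nu}{2}}\big(x(\cos\vartheta+\cos\phi)\big)\sin^\mu\vartheta\,\sin^\nu\phi\,d\phi\,d\vartheta,$$ $$\Lambda_{2,j}^{\mu,\nu}(x)=\frac{1}{\Gamma(\frac{\mu+1}{2})\Gamma(\frac{\nu+1}{2})}\int_0^\pi\!\!\int_0^\infty e^{-x\cosh\phi}L_j^{\frac{\mu+\nu}{2}}\big(x(\cos\vartheta+\cosh\phi)\big)\sin^\mu\vartheta\,\sinh^\nu\phi\,d\phi\,d\vartheta.$$ (2) For $\nu=-1$, $\Re\mu>-1$, $j\in\mathbb{N}_0$, $x>0$: $$\Lambda_{1,j}^{\mu,-1}(x)=\frac{1}{2\pi\Gamma(\frac{\mu+1}{2})}\sum_{i=0}^1\int_0^\pi e^{-(-1)^ix}L_j^{\frac{\mu-1}{2}}\big(x(\cos\vartheta+(-1)^i)\big)\sin^\mu\vartheta\,d\vartheta,$$ $$\Lambda_{2,j}^{\mu,-1}(x)=\frac{1}{2\Gamma(\frac{\mu+1}{2})}\int_0^\pi e^{-x}L_j^{\frac{\mu-1}{2}}\big(x(\cos\vartheta+1)\big)\sin^\mu\vartheta\,d\vartheta.$$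
   Context: $L_n^\alpha(x)=\sum_{k=0}^n\frac{(-1)^k}{k!}\binom{n+\alpha}{n-k}x^k$ are the Laguerre polynomials. Normalized modified Bessel functions: $\widetilde I_\alpha(z)=(z/2)^{-\alpha}I_\alpha(z)$, $\widetilde K_\alpha(z)=(z/2)^{-\alpha}K_\alpha(z)$. For $x>0$ and $t$ near $0$ (principal branch): $G_1^{\mu,\nu}(t,x)=(1-t)^{-\frac{\mu+\nu+2}{2}}\widetilde I_{\mu/2}(\tfrac{tx}{1-t})\widetilde I_{\nu/2}(\tfrac{x}{1-t})$, $G_2^{\mu,\nu}(t,x)=(1-t)^{-\frac{\mu+\nu+2}{2}}\widetilde I_{\mu/2}(\tfrac{tx}{1-t})\widetilde K_{\nu/2}(\tfrac{x}{1-t})$, and $\Lambda_{i,j}^{\mu,\nu}(x)$ ($i=1,2$) are the Taylor coefficients: $G_i^{\mu,\nu}(t,x)=\sum_{j\ge0}t^j\Lambda_{i,j}^{\mu,\nu}(x)$. *)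

(* Defs.v *)
From Stdlib Require Import Reals ClassicalEpsilon Factorial.
Open Scope R_scope.

Definition Cx : Type := (R * R)%type.
Definition RtoC (r : R) : Cx := (r, 0).
Definition Czero : Cx := (0, 0).
Definition Cone : Cx := (1, 0).
Definition Cre (z : Cx) : R := fst z.
Definition Cadd (z w : Cx) : Cx := (fst z + fst w, snd z + snd w).
Definition Copp (z : Cx) : Cx := (- fst z, - snd z).
Definition Csub (z w : Cx) : Cx := Cadd z (Copp w).
Definition Cmul (z w : Cx) : Cx :=
  (fst z * fst w - snd z * snd w, fst z * snd w + snd z * fst w).
Definition Cinv (z : Cx) : Cx :=
  let d := fst z ^ 2 + snd z ^ 2 in (fst z / d, - snd z / d).
Definition Cdiv (z w : Cx) : Cx := Cmul z (Cinv w).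
Definition Chalf (z : Cx) : Cx := Cmul z (RtoC (1 / 2)).
Definition Cexp (z : Cx) : Cx :=
  (exp (fst z) * cos (snd z), exp (fst z) * sin (snd z)).
Definition Cpow (r : R) (z : Cx) : Cx := Cexp (Cmul z (RtoC (ln r))).
Definition Ccosh (z : Cx) : Cx := Chalf (Cadd (Cexp z) (Cexp (Copp z))).

Lemma C_inhabited : inhabited Cx. Proof. exact (inhabits Czero). Qed.

Fixpoint Csum_upto (n : nat) (f : nat -> Cx) : Cx :=
  match n with
  | O => f O
  | S m => Cadd (Csum_upto m f) (f (S m))
  end.

Definition C_series (a : nat -> Cx) (l : Cx) : Prop :=
  infinite_sum (fun n => fst (a n)) (fst l) /\
  infinite_sum (fun n => snd (a n)) (snd l).
Definition Csum_inf (a : nat -> Cx) : Cx := epsilon C_inhabited (C_series a).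

Definition is_RInt_oo (f : R -> R) (a b v : R) : Prop :=
  (forall c d, a < c -> c <= d -> d < b -> inhabited (Riemann_integrable f c d)) /\
  forall eps, 0 < eps -> exists delta, 0 < delta /\
    forall c d (H : Riemann_integrable f c d),
      a < c -> c < a + delta -> b - delta < d -> d < b ->
      Rabs (RiemannInt H - v) < eps.
Definition is_RInt_oinf (f : R -> R) (a v : R) : Prop :=
  (forall c d, a < c -> c <= d -> inhabited (Riemann_integrable f c d)) /\
  forall eps, 0 < eps -> exists delta M, 0 < delta /\
    forall c d (H : Riemann_integrable f c d),
      a < c -> c < a + delta -> M < d ->
      Rabs (RiemannInt H - v) < eps.

Definition is_CInt_oo (f : R -> Cx) (a b : R) (v : Cx) : Prop :=
  is_RInt_oo (fun t => fst (f t)) a b (fst v) /\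
  is_RInt_oo (fun t => snd (f t)) a b (snd v).
Definition is_CInt_oinf (f : R -> Cx) (a : R) (v : Cx) : Prop :=
  is_RInt_oinf (fun t => fst (f t)) a (fst v) /\
  is_RInt_oinf (fun t => snd (f t)) a (snd v).

Definition CInt_oo (f : R -> Cx) (a b : R) : Cx :=
  epsilon C_inhabited (is_CInt_oo f a b).
Definition CInt_oinf (f : R -> Cx) (a : R) : Cx :=
  epsilon C_inhabited (is_CInt_oinf f a).

Definition CGamma (s : Cx) : Cx :=
  CInt_oinf (fun t => Cmul (Cpow t (Csub s Cone)) (RtoC (exp (- t)))) 0.

Fixpoint Cbinom (w : Cx) (m : nat) : Cx :=
  match m with
  | O => Cone
  | S k => Cmul (Cbinom w k) (Cdiv (Csub w (RtoC (INR k))) (RtoC (INR (S k))))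
  end.

Definition Laguerre (n : nat) (alpha : Cx) (y : R) : Cx :=
  Csum_upto n (fun k =>
    Cmul (RtoC ((-1) ^ k / INR (fact k) * y ^ k))
         (Cbinom (Cadd (RtoC (INR n)) alpha) (n - k))).

(* I_alpha(z) = sum_k (z/2)^(2k+alpha) / (k! Gamma(k+alpha+1)), hence
   Itilde_alpha(z) = (z/2)^(-alpha) I_alpha(z) = sum_k (z/2)^(2k)/(k! Gamma(k+alpha+1)) *)
Definition Itilde (alpha : Cx) (z : R) : Cx :=
  Csum_inf (fun k =>
    Cmul (RtoC ((z / 2) ^ (2 * k) / INR (fact k)))
         (Cinv (CGamma (Cadd (RtoC (INR k + 1)) alpha)))).

Definition BesselK (alpha : Cx) (z : R) : Cx :=
  CInt_oinf (fun t => Cmul (RtoC (exp (- (z * cosh t)))) (Ccosh (Cmul alpha (RtoC t)))) 0.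
Definition Ktilde (alpha : Cx) (z : R) : Cx :=
  Cmul (Cpow (z / 2) (Copp alpha)) (BesselK alpha z).

Definition G1 (mu nu : Cx) (t x : R) : Cx :=
  Cmul (Cpow (1 - t) (Copp (Chalf (Cadd (Cadd mu nu) (RtoC 2)))))
       (Cmul (Itilde (Chalf mu) (t * x / (1 - t))) (Itilde (Chalf nu) (x / (1 - t)))).
Definition G2 (mu nu : Cx) (t x : R) : Cx :=
  Cmul (Cpow (1 - t) (Copp (Chalf (Cadd (Cadd mu nu) (RtoC 2)))))
       (Cmul (Itilde (Chalf mu) (t * x / (1 - t))) (Ktilde (Chalf nu) (x / (1 - t)))).

Lemma seq_inhabited : inhabited (nat -> Cx). Proof. exact (inhabits (fun _ => Czero)). Qed.

Definition taylor_coefs (f : R -> Cx) : nat -> Cx :=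
  epsilon seq_inhabited (fun c => exists eps, 0 < eps /\
    forall t, Rabs t < eps -> C_series (fun j => Cmul (c j) (RtoC (t ^ j))) (f t)).

Definition Lambda1 (mu nu : Cx) (j : nat) (x : R) : Cx := taylor_coefs (fun t => G1 mu nu t x) j.
Definition Lambda2 (mu nu : Cx) (j : nat) (x : R) : Cx := taylor_coefs (fun t => G2 mu nu t x) j.

(* Main.v *)
Require Import Defs.
From Stdlib Require Import Reals.
From Stdlib Require Import Factorial Lra Lia ClassicalEpsilon.
From Coquelicot Require Import Coquelicot.
(* Again, so that [Cmul], [Cinv], [RtoC], [Cpow] are not those of Coquelicot. *)
Import Defs.
Open Scope R_scope.

(** Poisson's integral for [I] and Basset's integral for [K] write both Bessel
    factors of the generating function as integrals of [e^(-z cos)] and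
    [e^(-z cosh)].  With [s = tx/(1-t)] one has [x/(1-t) = x + s], so the product
    is [(1-t)^(-al-1)] times a power series in [s] whose coefficients are the
    moments of [cos theta + cos phi] (or [cos theta + cosh phi]); expanding
    [(1-t)^(-al-1-n)] binomially turns the coefficient of [t^j] into the integral
    of the Laguerre polynomial of [x (cos theta + cos phi)].  Moments factor, so
    the double integrals are finite sums of products of single integrals.

    Poisson's integral follows from its moments, i.e. from the Beta integral, and
    Basset's from inverse Gaussian integrals; both come from exchanging the
    integrals in [int int v^(a-1) h(t) e^(-tv)].  Binomial series with complex
    exponent are Gamma integrals of [e^(t tau)] expanded termwise. *)

(** * Improper integrals as differences of limits of a primitive *)

(** The integrals, infinite sums and Taylor coefficients of the statement are picked by [epsilon],
    so each of them must be shown to exist before its value can be used. Integrals exist by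
    domination, mostly by functions with an explicit primitive; series converge by geometric bounds,
    valid for small [t], which is all that Taylor coefficients see.

    Poisson's integral is matched with the Bessel series coefficient by coefficient. This divides by
    Gamma values, hence the proof that Gamma has no zero in the right half-plane. The Beta integral
    is computed for one moment only; a recursion gives the others.

    The constant 1/pi of the first formula is a product of two factors 1/Gamma(1/2); in the second
    one Basset's integral brings Gamma(1/2) to the numerator and it cancels.

    At nu = -1 the weight sin^nu is no longer integrable, while 1/Gamma((nu+1)/2) tends to 0:
    formally the phi-integral degenerates to point masses at cos phi = 1 and -1, or cosh phi = 1.
    This is checked on the closed forms of I and K of index -1/2, without passing to a limit. *)

Definition inI (a b : Rbar) (x : R) : Prop := Rbar_lt a x /\ Rbar_lt x b.
Definition endL (a : Rbar) : (R -> Prop) -> Prop :=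
  within (fun x : R => Rbar_lt a x) (Rbar_locally a).
Definition endR (b : Rbar) : (R -> Prop) -> Prop :=
  within (fun x : R => Rbar_lt x b) (Rbar_locally b).

(** Carrying a primitive with its two end limits turns linearity, substitution and integration by
    parts into plain calculus on the primitive. Endpoints in [Rbar] treat a singular finite end and
    an infinite end alike; continuity inside gives Riemann integrability on compact pieces. *)
Definition nint (a b : Rbar) (f : R -> R) (l : R) : Prop :=
  (forall x, inI a b x -> continuous f x) /\
  exists (F : R -> R) (la lb : R),
    (forall x, inI a b x -> is_derive F x (f x)) /\
    filterlim F (endL a) (locally la) /\
    filterlim F (endR b) (locally lb) /\ l = lb - la.

Instance endL_filter a : Filter (endL a).
Proof. apply within_filter. destruct a; apply _. Qed.

Instance endR_filter a : Filter (endR a).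
Proof. apply within_filter. destruct a; apply _. Qed.

Tactic Notation "unfold_ball" :=
  unfold ball; simpl; unfold AbsRing_ball, abs, minus, plus, opp; simpl.
Tactic Notation "unfold_ball" "in" hyp(H) :=
  unfold ball in H; simpl in H; unfold AbsRing_ball, abs, minus, plus, opp in H; simpl in H.
Tactic Notation "unfold_ball" "in" "*" :=
  unfold ball in *; simpl in *; unfold AbsRing_ball, abs, minus, plus, opp in *; simpl in *.

Lemma filterlim_endL {T} (a : R) (f : R -> T) (G : (T -> Prop) -> Prop) :
  filterlim f (locally a) G -> filterlim f (endL a) G.
Proof. intros H P HP. exact (filter_le_within (F := locally a) (fun x => Rbar_lt a x) _ (H P HP)). Qed.

Lemma endL_proper (a b : Rbar) : Rbar_lt a b -> ProperFilter (endL a).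
Proof.
  intros Hab. constructor; [|apply _].
  intros P HP. destruct a as [a| |]; simpl in Hab; try easy.
  - destruct HP as [e He]. exists (a + e / 2). destruct e as [e e0]; simpl in *.
    apply He; [|simpl; lra].
    unfold_ball.
    rewrite Rabs_right; lra.
  - destruct HP as [M HM]. exists (M - 1). apply HM; simpl; [lra|easy].
Qed.

Lemma endR_proper (a b : Rbar) : Rbar_lt a b -> ProperFilter (endR b).
Proof.
  intros Hab. constructor; [|apply _].
  intros P HP. destruct b as [b| |]; try (destruct a; easy).
  - destruct HP as [e He]. exists (b - e / 2). destruct e as [e e0]; simpl in *.
    apply He; [|simpl; lra].
    unfold_ball.
    rewrite Rabs_left; lra.
  - destruct HP as [M HM]. exists (M + 1). apply HM; simpl; [lra|easy].
Qed.

Lemma endL_below (a : Rbar) (x : R) : Rbar_lt a x ->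
  endL a (fun p => Rbar_lt a p /\ p < x).
Proof.
  intros H. destruct a as [a| |]; simpl in H; try easy; unfold endL, within; simpl.
  - assert (He : 0 < x - a) by lra. exists (mkposreal _ He). intros y Hy Hay.
    split; [easy|].
    unfold_ball in Hy.
    apply Rabs_def2 in Hy. lra.
  - exists x. easy.
Qed.

Lemma endR_above (b : Rbar) (x : R) : Rbar_lt x b ->
  endR b (fun q => Rbar_lt q b /\ x < q).
Proof.
  intros H. destruct b as [b| |]; simpl in H; try easy; unfold endR, within; simpl.
  - assert (He : 0 < b - x) by lra. exists (mkposreal _ He). intros y Hy Hay.
    split; [easy|].
    unfold_ball in Hy.
    apply Rabs_def2 in Hy. lra.
  - exists x. easy.
Qed.

Lemma inI_between a b p q x : inI a b p -> inI a b q -> p <= x <= q -> inI a b x.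
Proof.
  intros [H1 H2] [H3 H4] [H5 H6]. split.
  - apply Rbar_lt_le_trans with p; easy.
  - apply Rbar_le_lt_trans with q; easy.
Qed.

Lemma inI_minmax a b p q x : inI a b p -> inI a b q ->
  Rmin p q <= x <= Rmax p q -> inI a b x.
Proof.
  intros Hp Hq. unfold Rmin, Rmax. destruct (Rle_dec p q); intros Hx.
  - now apply inI_between with p q.
  - now apply inI_between with q p.
Qed.

Lemma inI_inhabited a b : Rbar_lt a b -> exists x, inI a b x.
Proof.
  intros H. destruct (endL_proper a b H) as [H1 _].
  destruct a as [a| |], b as [b| |]; simpl in H; try easy; unfold inI; simpl.
  - exists ((a + b) / 2). lra.
  - exists (a + 1). lra.
  - exists (b - 1). lra.
  - exists 0. easy.
Qed.

Lemma inI_locally a b x : inI a b x -> locally x (inI a b).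
Proof.
  intros [H1 H2]. apply filter_and.
  - now apply (open_Rbar_gt a x).
  - now apply (open_Rbar_lt b x).
Qed.

Lemma endL_inI a b : Rbar_lt a b -> endL a (inI a b).
Proof.
  intros H. destruct (inI_inhabited a b H) as [x [H1 H2]].
  generalize (endL_below a x H1). apply filter_imp. intros p [Hp Hpx].
  split; [easy|]. apply Rbar_lt_trans with x; easy.
Qed.

Lemma endR_inI a b : Rbar_lt a b -> endR b (inI a b).
Proof.
  intros H. destruct (inI_inhabited a b H) as [x [H1 H2]].
  generalize (endR_above b x H2). apply filter_imp. intros p [Hp Hpx].
  split; [|easy]. apply Rbar_lt_trans with x; easy.
Qed.

Lemma derive_continuity_pt (F : R -> R) x l : is_derive F x l -> continuity_pt F x.
Proof.
  intros H. apply continuity_pt_filterlim.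
  apply (ex_derive_continuous F). now exists l.
Qed.

Lemma incr_between a b F f p q :
  (forall x, inI a b x -> is_derive F x (f x)) ->
  (forall x, inI a b x -> 0 <= f x) ->
  inI a b p -> inI a b q -> p <= q -> F p <= F q.
Proof.
  intros HF Hf Hp Hq Hpq.
  destruct (MVT_gen F p q f) as [c [Hc Hd]].
  - intros x Hx. apply HF. apply inI_minmax with p q; try easy; lra.
  - intros x Hx. apply derive_continuity_pt with (f x). apply HF.
    now apply inI_minmax with p q.
  - assert (0 <= f c) by (apply Hf; now apply inI_minmax with p q). nra.
Qed.

Lemma limR_ge a b (F : R -> R) l c : Rbar_lt a b ->
  filterlim F (endR b) (locally l) -> endR b (fun q => c <= F q) -> c <= l.
Proof.
  intros Hab HF H. pose proof (endR_proper a b Hab).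
  apply (filterlim_le (F := endR b) (fun _ => c) F c l); try easy.
  apply filterlim_const.
Qed.

Lemma limL_le a b (F : R -> R) l c : Rbar_lt a b ->
  filterlim F (endL a) (locally l) -> endL a (fun q => F q <= c) -> l <= c.
Proof.
  intros Hab HF H. pose proof (endL_proper a b Hab).
  apply (filterlim_le (F := endL a) F (fun _ => c) l c); try easy.
  apply filterlim_const.
Qed.

Lemma incr_limits a b F f la lb x :
  (forall x, inI a b x -> is_derive F x (f x)) ->
  (forall x, inI a b x -> 0 <= f x) ->
  filterlim F (endL a) (locally la) -> filterlim F (endR b) (locally lb) ->
  inI a b x -> la <= F x <= lb.
Proof.
  intros HF Hf Ha Hb Hx.
  assert (Hab : Rbar_lt a b) by (apply Rbar_lt_trans with x; apply Hx).
  split.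
  - apply limL_le with a b F; try easy.
    apply filter_imp with (2 := endL_below a x (proj1 Hx)).
    intros p [Hp Hpx]. apply incr_between with a b f; try easy; try lra.
    split; [easy|]. apply Rbar_lt_trans with x; [easy|apply Hx].
  - apply limR_ge with a b F; try easy.
    apply filter_imp with (2 := endR_above b x (proj2 Hx)).
    intros p [Hp Hpx]. apply incr_between with a b f; try easy; try lra.
    split; [|easy]. apply Rbar_lt_trans with x; [apply Hx|easy].
Qed.

Lemma nint_ge0 a b f l : Rbar_lt a b ->
  (forall x, inI a b x -> 0 <= f x) -> nint a b f l -> 0 <= l.
Proof.
  intros Hab Hf [_ [F [la [lb [HF [Ha [Hb ->]]]]]]].
  destruct (inI_inhabited a b Hab) as [x Hx].
  assert (la <= F x <= lb) by (apply incr_limits with a b f; easy). lra.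
Qed.

Lemma filterlim_Rplus {T} (F : (T -> Prop) -> Prop) {FF : Filter F} (f g : T -> R) lf lg :
  filterlim f F (locally lf) -> filterlim g F (locally lg) ->
  filterlim (fun x => f x + g x) F (locally (lf + lg)).
Proof.
  intros Hf Hg. eapply filterlim_comp_2; [exact Hf|exact Hg|].
  apply (filterlim_plus (V := R_NormedModule) lf lg).
Qed.

Lemma filterlim_Rscal {T} (F : (T -> Prop) -> Prop) {FF : Filter F} (c : R) (f : T -> R) lf :
  filterlim f F (locally lf) ->
  filterlim (fun x => c * f x) F (locally (c * lf)).
Proof.
  intros Hf. eapply filterlim_comp; [exact Hf|].
  apply (filterlim_scal_r (V := R_NormedModule) c lf).
Qed.

Lemma nint_plus a b f g l m : nint a b f l -> nint a b g m ->
  nint a b (fun x => f x + g x) (l + m).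
Proof.
  intros [Cf [F [la [lb [HF [Ha [Hb ->]]]]]]] [Cg [G [ma [mb [HG [Ga [Gb ->]]]]]]].
  split.
  - intros x Hx. apply (continuous_plus f g); auto.
  - exists (fun x => F x + G x), (la + ma), (lb + mb). split; [|split; [|split]].
    + intros x Hx. apply (is_derive_plus F G); auto.
    + apply filterlim_Rplus; auto; apply _.
    + apply filterlim_Rplus; auto; apply _.
    + ring.
Qed.

Lemma nint_scal a b c f l : nint a b f l -> nint a b (fun x => c * f x) (c * l).
Proof.
  intros [Cf [F [la [lb [HF [Ha [Hb ->]]]]]]].
  split.
  - intros x Hx. apply (continuous_scal_r c f); auto.
  - exists (fun x => c * F x), (c * la), (c * lb). split; [|split; [|split]].
    + intros x Hx. apply (is_derive_scal F x c (f x)); auto.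
    + apply filterlim_Rscal; auto; apply _.
    + apply filterlim_Rscal; auto; apply _.
    + ring.
Qed.

Lemma nint_ext a b f g l : (forall x, inI a b x -> f x = g x) ->
  nint a b f l -> nint a b g l.
Proof.
  intros E [Cf [F [la [lb [HF H]]]]]. split.
  - intros x Hx. apply continuous_ext_loc with f; auto.
    apply filter_imp with (2 := inI_locally a b x Hx). auto.
  - exists F, la, lb. split; [|easy]. intros x Hx. rewrite <- E by easy. auto.
Qed.

Lemma nint_eq a b f l m : l = m -> nint a b f l -> nint a b f m.
Proof. now intros ->. Qed.

Lemma nint_minus a b f g l m : nint a b f l -> nint a b g m ->
  nint a b (fun x => f x - g x) (l - m).
Proof.
  intros Hf Hg.
  apply nint_eq with (l + (-1) * m); [ring|].
  apply nint_ext with (fun x => f x + (-1) * g x); [intros; ring|].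
  apply nint_plus; [easy|]. now apply nint_scal.
Qed.

Lemma nint_zero a b : nint a b (fun _ => 0) 0.
Proof.
  split.
  - intros y _. apply continuous_const.
  - exists (fun _ => 0), 0, 0. split; [|split; [|split]]; try apply filterlim_const; try ring.
    intros x _. apply (is_derive_const (V := R_NormedModule) 0).
Qed.

Lemma nint_le a b f g l m : Rbar_lt a b ->
  (forall x, inI a b x -> f x <= g x) -> nint a b f l -> nint a b g m -> l <= m.
Proof.
  intros Hab Hfg Hf Hg. pose proof (nint_minus _ _ _ _ _ _ Hg Hf) as H.
  apply nint_ge0 in H; [lra|easy|]. intros x Hx. specialize (Hfg x Hx). lra.
Qed.

Lemma nint_unique a b f l m : Rbar_lt a b -> nint a b f l -> nint a b f m -> l = m.
Proof.
  intros Hab Hl Hm. apply Rle_antisym; apply nint_le with a b f f; auto; intros; lra.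
Qed.

Lemma nint_abs_le a b f g l m : Rbar_lt a b ->
  (forall x, inI a b x -> Rabs (f x) <= g x) -> nint a b f l -> nint a b g m ->
  Rabs l <= m.
Proof.
  intros Hab Hfg Hf Hg. apply Rabs_le. split.
  - pose proof (nint_scal _ _ (-1) _ _ Hg) as Hg'.
    replace (- m) with (-1 * m) by ring.
    apply nint_le with a b (fun x => -1 * g x) f; auto.
    intros x Hx. specialize (Hfg x Hx). apply Rabs_le_between in Hfg. lra.
  - apply nint_le with a b f g; auto.
    intros x Hx. specialize (Hfg x Hx). apply Rabs_le_between in Hfg. lra.
Qed.

Lemma inI_ex_RInt a b (f : R -> R) p q : (forall x, inI a b x -> continuous f x) ->
  inI a b p -> inI a b q -> ex_RInt f p q.
Proof.
  intros H Hp Hq. apply (ex_RInt_continuous (V := R_CompleteNormedModule)).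
  intros z Hz. apply H. now apply inI_minmax with p q.
Qed.

Lemma inI_derive_RInt a b (f : R -> R) c x : (forall x, inI a b x -> continuous f x) ->
  inI a b c -> inI a b x -> is_derive (fun y => RInt f c y) x (f x).
Proof.
  intros H Hc Hx. apply is_derive_RInt with c; [|now apply H].
  apply filter_imp with (2 := inI_locally a b x Hx). intros y Hy.
  apply (RInt_correct (V := R_CompleteNormedModule)).
  now apply inI_ex_RInt with a b.
Qed.

Lemma RInt_primitive a b (f F : R -> R) p q :
  (forall x, inI a b x -> continuous f x) ->
  (forall x, inI a b x -> is_derive F x (f x)) ->
  inI a b p -> inI a b q -> RInt f p q = F q - F p.
Proof.
  intros Hc Hd Hp Hq. apply is_RInt_unique.
  apply (is_RInt_derive (V := R_CompleteNormedModule) F f); intros x Hx;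
    (apply Hd || apply Hc); now apply inI_minmax with p q.
Qed.

(** Both [G + F] and [G - F] are nondecreasing. The absolute value on the right frees the conclusion
    from the order of [p] and [q]. *)
Lemma dominated_increment a b F f G g p q :
  (forall x, inI a b x -> is_derive F x (f x)) ->
  (forall x, inI a b x -> is_derive G x (g x)) ->
  (forall x, inI a b x -> Rabs (f x) <= g x) ->
  inI a b p -> inI a b q -> Rabs (F q - F p) <= Rabs (G q - G p).
Proof.
  intros HF HG Hfg.
  assert (W : forall p q, inI a b p -> inI a b q -> p <= q ->
              Rabs (F q - F p) <= G q - G p).
  { intros u v Hu Hv Huv. apply Rabs_le. split.
    - assert (H : F u + G u <= F v + G v); [|lra].
      apply (incr_between a b (fun x => F x + G x) (fun x => f x + g x)); auto.
      + intros x Hx. apply (is_derive_plus F G); auto.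
      + intros x Hx. specialize (Hfg x Hx). apply Rabs_le_between in Hfg. lra.
    - assert (H : G u - F u <= G v - F v); [|lra].
      apply (incr_between a b (fun x => G x - F x) (fun x => g x - f x)); auto.
      + intros x Hx. apply (is_derive_minus G F); auto.
      + intros x Hx. specialize (Hfg x Hx). apply Rabs_le_between in Hfg. lra. }
  intros Hp Hq. destruct (Rle_dec p q) as [H|H].
  - eapply Rle_trans; [apply W; easy|]. apply Rle_abs.
  - rewrite Rabs_minus_sym, (Rabs_minus_sym (G q)).
    eapply Rle_trans; [apply W; try easy; lra|]. apply Rle_abs.
Qed.

(** Cauchy's criterion passes from [G] to [F]. *)
Lemma filterlim_dominated_increment (E : (R -> Prop) -> Prop) (S : R -> Prop) (F G : R -> R) m :
  ProperFilter E -> E S ->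
  (forall p q, S p -> S q -> Rabs (F q - F p) <= Rabs (G q - G p)) ->
  filterlim G E (locally m) -> exists l, filterlim F E (locally l).
Proof.
  intros PE HS HFG HG.
  apply (proj1 (filterlim_locally_cauchy (U := R_CompleteSpace) (F := E) F)).
  pose proof (proj2 (filterlim_locally_cauchy (U := R_CompleteSpace) (F := E) G)
    (ex_intro _ m HG)) as HG'.
  intros eps. destruct (HG' eps) as [P [HP HPuv]].
  exists (fun x => P x /\ S x). split; [now apply filter_and|].
  intros u v [Pu Su] [Pv Sv]. specialize (HPuv u v Pu Pv).
  unfold_ball in *.
  eapply Rle_lt_trans; [apply HFG; easy|exact HPuv].
Qed.

(** Comparison test: a primitive taken from an interior base point has increments dominated by those
    of the primitive of [g], hence limits at both ends. *)
Lemma nint_dominated a b f g m : Rbar_lt a b ->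
  (forall x, inI a b x -> continuous f x) ->
  (forall x, inI a b x -> Rabs (f x) <= g x) -> nint a b g m ->
  exists l, nint a b f l.
Proof.
  intros Hab Hc Hfg [Cg [G [ma [mb [HG [Ga [Gb _]]]]]]].
  destruct (inI_inhabited a b Hab) as [c Hcc].
  set (F := fun y => RInt f c y).
  assert (HF : forall x, inI a b x -> is_derive F x (f x)).
  { intros x Hx. now apply inI_derive_RInt with a b. }
  assert (HFG : forall p q, inI a b p -> inI a b q -> Rabs (F q - F p) <= Rabs (G q - G p)).
  { intros p q. now apply dominated_increment with f g. }
  destruct (filterlim_dominated_increment (endL a) (inI a b) F G ma) as [la Hla]; auto.
  { now apply endL_proper with b. }
  { now apply endL_inI. }
  destruct (filterlim_dominated_increment (endR b) (inI a b) F G mb) as [lb Hlb]; auto.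
  { now apply endR_proper with a. }
  { now apply endR_inI. }
  exists (lb - la). split; [easy|]. exists F, la, lb. tauto.
Qed.

(** The primitives of [D + f] and [D - f] are monotone, so what [f] loses by truncation to [[p, q]]
    is at most what [D] loses. The bound depends on [D] only, which gives the uniformity used when
    integrals are exchanged. *)
Lemma nint_tail a b f D l d p q :
  nint a b f l -> nint a b D d -> (forall x, inI a b x -> Rabs (f x) <= D x) ->
  inI a b p -> inI a b q -> p <= q ->
  Rabs (l - RInt f p q) <= d - RInt D p q.
Proof.
  intros [Cf [F [la [lb [HF [Ha [Hb ->]]]]]]] [Cg [G [ma [mb [HG [Ga [Gb ->]]]]]]] H Hp Hq Hpq.
  rewrite (RInt_primitive a b f F), (RInt_primitive a b D G); auto.
  assert (W1 : forall x, inI a b x -> la + ma <= F x + G x <= lb + mb).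
  { intros x Hx. apply (incr_limits a b (fun x => F x + G x) (fun x => f x + D x)); auto.
    - intros y Hy. apply (is_derive_plus F G); auto.
    - intros y Hy. specialize (H y Hy). apply Rabs_le_between in H. lra.
    - apply filterlim_Rplus; auto; apply _.
    - apply filterlim_Rplus; auto; apply _. }
  assert (W2 : forall x, inI a b x -> ma + (-1) * la <= G x + (-1) * F x <= mb + (-1) * lb).
  { intros x Hx. apply (incr_limits a b (fun x => G x + (-1) * F x) (fun x => D x + (-1) * f x)); auto.
    - intros y Hy. apply (is_derive_plus G (fun x => (-1) * F x)); auto.
      apply (is_derive_scal F y (-1) (f y)); auto.
    - intros y Hy. specialize (H y Hy). apply Rabs_le_between in H. lra.
    - apply filterlim_Rplus; auto; try apply _. apply filterlim_Rscal; auto; apply _.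
    - apply filterlim_Rplus; auto; try apply _. apply filterlim_Rscal; auto; apply _. }
  pose proof (W1 p Hp). pose proof (W1 q Hq). pose proof (W2 p Hp). pose proof (W2 q Hq).
  apply Rabs_le. lra.
Qed.

(** Restates the two end limits as a property of all large compact subintervals, the form in which
    the integrals of the statement and the truncation arguments consume them. *)
Lemma nint_exhaust a b f l : Rbar_lt a b -> nint a b f l ->
  forall eps, 0 < eps ->
  exists u v, inI a b u /\ inI a b v /\ u <= v /\
    forall p q, inI a b p -> inI a b q -> p <= u -> v <= q -> Rabs (l - RInt f p q) < eps.
Proof.
  intros Hab [Cf [F [la [lb [HF [Ha [Hb ->]]]]]]] eps He.
  destruct (inI_inhabited a b Hab) as [c Hc].
  pose proof (endL_proper a b Hab) as PL. pose proof (endR_proper a b Hab) as PR.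
  assert (He2 : 0 < eps / 2) by lra.
  pose proof (proj1 (filterlim_locally F la) Ha (mkposreal _ He2)) as HL.
  pose proof (proj1 (filterlim_locally F lb) Hb (mkposreal _ He2)) as HR.
  unfold_ball in *.
  assert (L : exists u, inI a b u /\ u <= c /\ forall p, inI a b p -> p <= u -> Rabs (F p + - la) < eps / 2).
  { destruct a as [a| |]; simpl in Hab; try easy.
    - destruct HL as [d Hd]. destruct d as [d d0]; simpl in *.
      assert (a < c) by apply Hc.
      exists (Rmin c (a + d / 2)).
      assert (Hu : a < Rmin c (a + d / 2) <= c) by (split; [apply Rmin_glb_lt; lra|apply Rmin_l]).
      pose proof (Rmin_r c (a + d / 2)).
      split; [|split; [lra|]].
      + split; [simpl; lra|]. apply Rbar_le_lt_trans with c; [simpl; lra|apply Hc].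
      + intros p [Hp1 Hp2] Hpu. simpl in Hp1. apply Hd; [|easy].
        unfold_ball.
        rewrite Rabs_right; lra.
    - destruct HL as [M HM]. exists (Rmin c (M - 1)).
      pose proof (Rmin_l c (M - 1)). pose proof (Rmin_r c (M - 1)).
      split; [|split; [lra|]].
      + split; [easy|]. apply Rbar_le_lt_trans with c; [simpl; lra|apply Hc].
      + intros p Hp Hpu. apply HM; [lra|easy]. }
  assert (R : exists u, inI a b u /\ c <= u /\ forall p, inI a b p -> u <= p -> Rabs (F p + - lb) < eps / 2).
  { destruct b as [b| |]; try (destruct a; easy).
    - destruct HR as [d Hd]. destruct d as [d d0]; simpl in *.
      assert (c < b) by apply Hc.
      exists (Rmax c (b - d / 2)).
      assert (Hu : c <= Rmax c (b - d / 2) < b) by (split; [apply Rmax_l|apply Rmax_lub_lt; lra]).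
      pose proof (Rmax_r c (b - d / 2)).
      split; [|split; [lra|]].
      + split; [|simpl; lra]. apply Rbar_lt_le_trans with c; [apply Hc|simpl; lra].
      + intros p [Hp1 Hp2] Hpu. simpl in Hp2. apply Hd; [|easy].
        unfold_ball.
        rewrite Rabs_left; lra.
    - destruct HR as [M HM]. exists (Rmax c (M + 1)).
      pose proof (Rmax_l c (M + 1)). pose proof (Rmax_r c (M + 1)).
      split; [|split; [lra|]].
      + split; [|easy]. apply Rbar_lt_le_trans with c; [apply Hc|simpl; lra].
      + intros p Hp Hpu. apply HM; [lra|easy]. }
  destruct L as [u [Hu [Huc HuF]]]. destruct R as [v [Hv [Hvc HvF]]].
  exists u, v. repeat split; try apply Hu; try apply Hv; try lra.
  intros p q Hp Hq Hpu Hvq.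
  rewrite (RInt_primitive a b f F); auto.
  specialize (HuF p Hp Hpu). specialize (HvF q Hq Hvq).
  apply Rabs_def2 in HuF. apply Rabs_def2 in HvF. apply Rabs_def1; lra.
Qed.

Lemma nint_subst a b A B (phi dphi f : R -> R) l : Rbar_lt a b -> Rbar_lt A B ->
  (forall x, inI a b x -> inI A B (phi x)) ->
  (forall x, inI a b x -> is_derive phi x (dphi x)) ->
  (forall x, inI a b x -> continuous dphi x) ->
  filterlim phi (endL a) (Rbar_locally A) ->
  filterlim phi (endR b) (Rbar_locally B) ->
  nint A B f l -> nint a b (fun x => f (phi x) * dphi x) l.
Proof.
  intros Hab HAB Hin Hd Hcd HA HB [Cf [F [la [lb [HF [Ha [Hb ->]]]]]]].
  (* Convergence of [phi] to the endpoint becomes one-sided because [phi] stays inside the target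
     interval; only then do the limits of [F] compose. *)
  assert (HA' : filterlim phi (endL a) (endL A)).
  { intros P HP. specialize (HA _ HP). pose proof (endL_inI a b Hab) as Hi.
    apply filter_imp with (2 := filter_and (F := endL a) (fun x => Rbar_lt A (phi x) -> P (phi x)) _ HA Hi). intros x [H1 H2]. apply H1.
    now apply Hin. }
  assert (HB' : filterlim phi (endR b) (endR B)).
  { intros P HP. specialize (HB _ HP). pose proof (endR_inI a b Hab) as Hi.
    apply filter_imp with (2 := filter_and (F := endR b) (fun x => Rbar_lt (phi x) B -> P (phi x)) _ HB Hi). intros x [H1 H2]. apply H1.
    now apply Hin. }
  split.
  - intros x Hx. apply (continuous_mult (K := R_AbsRing) (fun x => f (phi x)) dphi); auto.
    apply (continuous_comp phi f).
    + apply (ex_derive_continuous phi). exists (dphi x). auto.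
    + auto.
  - exists (fun x => F (phi x)), la, lb. split; [|split; [|split]].
    + intros x Hx. rewrite Rmult_comm.
      apply (is_derive_comp F phi x (f (phi x)) (dphi x)); auto.
    + eapply filterlim_comp; eauto.
    + eapply filterlim_comp; eauto.
    + easy.
Qed.

Lemma is_derive_neg_comp (F : R -> R) x c l : is_derive F (c - x) l ->
  is_derive (fun y => F (c - y)) x (- l).
Proof.
  intros H. replace (- l) with (scal (-1) l) by (unfold scal; simpl; unfold mult; simpl; ring).
  apply (is_derive_comp F (fun y => c - y)); [easy|]. auto_derive; [easy|ring].
Qed.

(** The primitive is [F t - F (- t)]. Serves to turn an exponential integrated over the line into
    the hyperbolic cosine of [BesselK]. *)
Lemma nint_fold_R f L : nint m_infty p_infty f L ->
  nint 0 p_infty (fun t => f t + f (- t)) L.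
Proof.
  intros [Cf [F [la [lb [HF [Ha [Hb ->]]]]]]].
  assert (I : forall x, inI m_infty p_infty x) by (intros x; split; easy).
  split.
  - intros x _. apply (continuous_plus f (fun t => f (- t))); auto.
    apply (continuous_comp Ropp f); auto. 
    apply (ex_derive_continuous Ropp). auto_derive. easy.
  - exists (fun x => F x + (-1) * F (0 - x)), (F 0 + (-1) * F (0 - 0)), (lb + (-1) * la).
    split; [|split; [|split]].
    + intros x _. replace (f x + f (- x)) with (f x + (-1) * - f (0 - x)).
      2: { replace (0 - x) with (- x) by ring. ring. }
      apply (is_derive_plus F (fun x => -1 * F (0 - x))); auto.
      apply (is_derive_scal (fun x => F (0 - x)) x (-1) (- f (0 - x))).
      apply is_derive_neg_comp. auto.
    + apply (filterlim_endL 0).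
      apply filterlim_Rplus; try apply _.
      * apply (ex_derive_continuous F). exists (f 0). auto.
      * apply filterlim_Rscal; try apply _.
        apply (ex_derive_continuous (fun y => F (0 - y))). eexists. apply is_derive_neg_comp. auto.
    + apply filterlim_Rplus; try apply _; auto.
      apply filterlim_Rscal; try apply _.
      eapply filterlim_comp; [|exact Ha].
      intros P [M HM]. exists (- M). intros x Hx _. apply HM; [lra|easy].
    + ring_simplify. replace (0 - 0) with 0 by ring. ring.
Qed.

Lemma nint_fold_half c f L : 0 < c -> nint 0 c f L ->
  nint 0 (c / 2) (fun t => f t + f (c - t)) L.
Proof.
  intros Hc [Cf [F [la [lb [HF [Ha [Hb ->]]]]]]].
  assert (I1 : forall x, inI 0 (c / 2) x -> inI 0 c x) by (unfold inI; simpl; intros; lra).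
  assert (I2 : forall x, inI 0 (c / 2) x -> inI 0 c (c - x)) by (unfold inI; simpl; intros; lra).
  split.
  - intros x Hx. apply (continuous_plus f (fun t => f (c - t))); auto.
    apply (continuous_comp (fun t => c - t) f); auto.
    apply (ex_derive_continuous (fun t => c - t)). auto_derive. easy.
  - exists (fun x => F x + (-1) * F (c - x)), (la + (-1) * lb), (F (c/2) + (-1) * F (c - c / 2)).
    split; [|split; [|split]].
    + intros x Hx. replace (f x + f (c - x)) with (f x + (-1) * - f (c - x)) by ring.
      apply (is_derive_plus F (fun x => -1 * F (c - x))); auto.
      apply (is_derive_scal (fun x => F (c - x)) x (-1) (- f (c - x))).
      apply is_derive_neg_comp. auto.
    + apply filterlim_Rplus; try apply _; auto.
      apply filterlim_Rscal; try apply _.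
      eapply filterlim_comp; [|exact Hb].
      intros P [M HM]. exists M. intros x Hx Hx2. simpl in Hx2. apply HM; simpl; [|lra].
      unfold_ball in *.
      replace (c - x + - c) with (- (x + - 0)) by ring. now rewrite Rabs_Ropp.
    + apply (filterlim_filter_le_1 (F := locally (c / 2))).
      { intros P HP. now apply filter_imp with (2 := HP). }
      apply filterlim_Rplus; try apply _.
      * apply (ex_derive_continuous F). exists (f (c/2)). apply HF. unfold inI; simpl; lra.
      * apply filterlim_Rscal; try apply _.
        apply (ex_derive_continuous (fun y => F (c - y))). eexists. apply is_derive_neg_comp.
        apply HF. unfold inI; simpl; lra.
    + replace (c - c / 2) with (c / 2) by field. ring.
Qed.

(** * Complex numbers *)

(** [Cx] and its operations are convertible to the complex numbers of Coquelicot, so the field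
    axioms carry over unchanged. *)
Definition Cx_field_theory :
  field_theory Czero Cone Cadd Cmul Csub Copp Cdiv Cinv eq := Complex.C_field_theory.
Add Field Cx_field : Cx_field_theory.

Lemma Cx_ext (z w : Cx) : fst z = fst w -> snd z = snd w -> z = w.
Proof. destruct z, w; simpl; congruence. Qed.

Lemma RtoC_add a b : RtoC (a + b) = Cadd (RtoC a) (RtoC b).
Proof. apply Cx_ext; simpl; ring. Qed.
Lemma RtoC_mul a b : RtoC (a * b) = Cmul (RtoC a) (RtoC b).
Proof. apply Cx_ext; simpl; ring. Qed.
Lemma RtoC_opp a : RtoC (- a) = Copp (RtoC a).
Proof. apply Cx_ext; simpl; ring. Qed.
Lemma RtoC_sub a b : RtoC (a - b) = Csub (RtoC a) (RtoC b).
Proof. apply Cx_ext; simpl; ring. Qed.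
Lemma RtoC_inv a : a <> 0 -> RtoC (/ a) = Cinv (RtoC a).
Proof. intros. apply Cx_ext; simpl; field; easy. Qed.
Lemma RtoC_neq0 a : a <> 0 -> RtoC a <> Czero.
Proof. intros H E. apply H. now inversion E. Qed.
Lemma Cone_neq0 : Cone <> Czero.
Proof. apply RtoC_neq0. lra. Qed.
Lemma Cre_neq0 z : fst z <> 0 -> z <> Czero.
Proof. intros H ->. now apply H. Qed.

Lemma Cmod_mul z w : Cmod (Cmul z w) = Cmod z * Cmod w.
Proof. apply Complex.Cmod_mult. Qed.
Lemma Cmod_add z w : Cmod (Cadd z w) <= Cmod z + Cmod w.
Proof. apply Complex.Cmod_triangle. Qed.
Lemma Cmod_RtoC r : Cmod (RtoC r) = Rabs r.
Proof. apply Complex.Cmod_R. Qed.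
Lemma Cmod_ge0 z : 0 <= Cmod z.
Proof. apply Complex.Cmod_ge_0. Qed.
Lemma Cmod_fst z : Rabs (fst z) <= Cmod z.
Proof. eapply Rle_trans; [apply Rmax_l|apply Rmax_Cmod]. Qed.
Lemma Cmod_snd z : Rabs (snd z) <= Cmod z.
Proof. eapply Rle_trans; [apply Rmax_r|apply Rmax_Cmod]. Qed.
Lemma Cmod_le_sum z : Cmod z <= Rabs (fst z) + Rabs (snd z).
Proof.
  replace z with (Cadd (RtoC (fst z)) (Cmul (0, 1) (RtoC (snd z)))) at 1
    by (apply Cx_ext; simpl; ring).
  eapply Rle_trans; [apply Cmod_add|]. rewrite Cmod_mul, !Cmod_RtoC.
  replace (Cmod (0, 1)) with 1; [lra|]. unfold Cmod; simpl.
  replace (0 * (0 * 1) + 1 * (1 * 1)) with 1 by ring. now rewrite sqrt_1.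
Qed.

Lemma Cpow_eq r z :
  Cpow r z = (exp (fst z * ln r) * cos (snd z * ln r), exp (fst z * ln r) * sin (snd z * ln r)).
Proof.
  unfold Cpow, Cexp, Cmul, RtoC; simpl.
  replace (fst z * ln r - snd z * 0) with (fst z * ln r) by ring.
  now replace (fst z * 0 + snd z * ln r) with (snd z * ln r) by ring.
Qed.

Lemma Cexp_add z w : Cexp (Cadd z w) = Cmul (Cexp z) (Cexp w).
Proof.
  unfold Cexp, Cadd, Cmul; simpl. rewrite exp_plus, cos_plus, sin_plus.
  apply Cx_ext; simpl; ring.
Qed.
Lemma Cexp_0 : Cexp Czero = Cone.
Proof. unfold Cexp; simpl. rewrite exp_0, cos_0, sin_0. apply Cx_ext; simpl; ring. Qed.
Lemma Cexp_neq0 z : Cexp z <> Czero.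
Proof.
  intros E. apply Cone_neq0. rewrite <- Cexp_0.
  replace Czero with (Cadd z (Copp z)) by ring. rewrite Cexp_add, E. ring.
Qed.
Lemma Cexp_RtoC r : Cexp (RtoC r) = RtoC (exp r).
Proof. unfold Cexp; simpl. rewrite cos_0, sin_0. apply Cx_ext; simpl; ring. Qed.
Lemma Cmod_Cexp z : Cmod (Cexp z) = exp (fst z).
Proof.
  unfold Cmod, Cexp; simpl.
  replace (_ + _) with (exp (fst z) * exp (fst z) * ((sin (snd z))² + (cos (snd z))²)).
  - rewrite sin2_cos2, Rmult_1_r. apply sqrt_square. apply Rlt_le, exp_pos.
  - unfold Rsqr. ring.
Qed.

Lemma Cpow_add r z w : Cpow r (Cadd z w) = Cmul (Cpow r z) (Cpow r w).
Proof. unfold Cpow. rewrite <- Cexp_add. f_equal. ring. Qed.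
Lemma Cpow_mul r s z : 0 < r -> 0 < s -> Cpow (r * s) z = Cmul (Cpow r z) (Cpow s z).
Proof.
  intros. unfold Cpow. rewrite <- Cexp_add, ln_mult, RtoC_add by easy. f_equal. ring.
Qed.
Lemma Cpow_RtoC r y : Cpow r (RtoC y) = RtoC (exp (y * ln r)).
Proof. unfold Cpow. now rewrite <- RtoC_mul, Cexp_RtoC. Qed.
Lemma Cpow_0 r : Cpow r Czero = Cone.
Proof. change Czero with (RtoC 0). rewrite Cpow_RtoC, Rmult_0_l, exp_0. easy. Qed.
Lemma Cpow_1 r : 0 < r -> Cpow r Cone = RtoC r.
Proof.
  intros. change Cone with (RtoC 1). now rewrite Cpow_RtoC, Rmult_1_l, exp_ln.
Qed.
Lemma Cpow_neq0 r z : Cpow r z <> Czero.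
Proof. apply Cexp_neq0. Qed.
Lemma Cpow_opp r z : Cpow r (Copp z) = Cinv (Cpow r z).
Proof.
  pose proof (Cpow_neq0 r z).
  replace (Cpow r (Copp z)) with (Cmul (Cmul (Cpow r (Copp z)) (Cpow r z)) (Cinv (Cpow r z)))
    by now field.
  rewrite <- Cpow_add. replace (Cadd (Copp z) z) with Czero by ring. rewrite Cpow_0. ring.
Qed.
Lemma Cpow_exp y z : Cpow (exp y) z = Cexp (Cmul z (RtoC y)).
Proof. unfold Cpow. now rewrite ln_exp. Qed.
Lemma Cmod_Cpow r z : Cmod (Cpow r z) = exp (fst z * ln r).
Proof. unfold Cpow. rewrite Cmod_Cexp. f_equal. simpl. ring. Qed.
Lemma Cpow_nat r n : 0 < r -> Cpow r (RtoC (INR n)) = RtoC (r ^ n).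
Proof. intros. rewrite Cpow_RtoC. f_equal. fold (Rpower r (INR n)). now apply Rpower_pow. Qed.
Lemma Cpow_inv r z : 0 < r -> Cpow (/ r) z = Cinv (Cpow r z).
Proof.
  intros H. rewrite <- Cpow_opp. unfold Cpow. rewrite ln_Rinv by easy. f_equal.
  rewrite RtoC_opp. ring.
Qed.

(** * Calculus of complex-valued functions of a real variable *)

Definition ccont (f : R -> Cx) (x : R) : Prop :=
  continuous (fun t => fst (f t)) x /\ continuous (fun t => snd (f t)) x.
Definition cderiv (f : R -> Cx) (x : R) (l : Cx) : Prop :=
  is_derive (fun t => fst (f t)) x (fst l) /\ is_derive (fun t => snd (f t)) x (snd l).
Definition clim (E : (R -> Prop) -> Prop) (f : R -> Cx) (l : Cx) : Prop :=
  filterlim (fun t => fst (f t)) E (locally (fst l)) /\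
  filterlim (fun t => snd (f t)) E (locally (snd l)).
Definition cint (a b : Rbar) (f : R -> Cx) (l : Cx) : Prop :=
  nint a b (fun t => fst (f t)) (fst l) /\ nint a b (fun t => snd (f t)) (snd l).

Lemma cont_plus (f g : R -> R) x : continuous f x -> continuous g x ->
  continuous (fun t => f t + g t) x.
Proof. apply (continuous_plus f g). Qed.
Lemma cont_mult (f g : R -> R) x : continuous f x -> continuous g x ->
  continuous (fun t => f t * g t) x.
Proof. apply (continuous_mult (K := R_AbsRing) f g). Qed.
Lemma cont_minus (f g : R -> R) x : continuous f x -> continuous g x ->
  continuous (fun t => f t - g t) x.
Proof. apply (continuous_minus f g). Qed.
Lemma cont_derive (f : R -> R) x : ex_derive f x -> continuous f x.
Proof. apply (ex_derive_continuous f). Qed.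

Lemma ccont_RtoC (f : R -> R) x : continuous f x -> ccont (fun t => RtoC (f t)) x.
Proof. intros H. split; simpl; [easy|apply continuous_const]. Qed.
Lemma ccont_const c x : ccont (fun _ => c) x.
Proof. split; apply continuous_const. Qed.
Lemma ccont_mul f g x : ccont f x -> ccont g x -> ccont (fun t => Cmul (f t) (g t)) x.
Proof.
  intros [H1 H2] [H3 H4]. split; simpl.
  - apply cont_minus; now apply cont_mult.
  - apply cont_plus; now apply cont_mult.
Qed.
Lemma ccont_sub f g x : ccont f x -> ccont g x -> ccont (fun t => Csub (f t) (g t)) x.
Proof. intros [H1 H2] [H3 H4]. split; simpl; now apply cont_minus. Qed.
Lemma ccont_comp (f : R -> Cx) (phi : R -> R) x : continuous phi x -> ccont f (phi x) ->
  ccont (fun t => f (phi t)) x.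
Proof.
  intros H [H1 H2]. split.
  - apply (continuous_comp phi (fun t => fst (f t))); easy.
  - apply (continuous_comp phi (fun t => snd (f t))); easy.
Qed.
Lemma ccont_Cpow z x : 0 < x -> ccont (fun t => Cpow t z) x.
Proof.
  intros Hx. destruct z as [a b]. split; apply cont_derive.
  - apply ex_derive_ext with (fun t => exp (a * ln t) * cos (b * ln t)).
    { intros t. now rewrite Cpow_eq. }
    auto_derive. tauto.
  - apply ex_derive_ext with (fun t => exp (a * ln t) * sin (b * ln t)).
    { intros t. now rewrite Cpow_eq. }
    auto_derive. tauto.
Qed.

Lemma cderiv_RtoC (f : R -> R) x l : is_derive f x l -> cderiv (fun t => RtoC (f t)) x (RtoC l).
Proof. intros H. split; simpl; [easy|]. apply (is_derive_const (V := R_NormedModule) 0). Qed.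
Lemma der_mult (f g : R -> R) x l m : is_derive f x l -> is_derive g x m ->
  is_derive (fun t => f t * g t) x (l * g x + f x * m).
Proof. intros Hf Hg. apply (is_derive_mult f g x l m); try easy. apply Rmult_comm. Qed.
Lemma der_plus (f g : R -> R) x l m : is_derive f x l -> is_derive g x m ->
  is_derive (fun t => f t + g t) x (l + m).
Proof. apply (is_derive_plus f g). Qed.
Lemma der_minus (f g : R -> R) x l m : is_derive f x l -> is_derive g x m ->
  is_derive (fun t => f t - g t) x (l - m).
Proof. apply (is_derive_minus f g). Qed.
Lemma der_eq (f : R -> R) x l m : l = m -> is_derive f x l -> is_derive f x m.
Proof. now intros ->. Qed.
Lemma cderiv_mul f g x l m : cderiv f x l -> cderiv g x m ->
  cderiv (fun t => Cmul (f t) (g t)) x (Cadd (Cmul l (g x)) (Cmul (f x) m)).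
Proof.
  intros [H1 H2] [H3 H4]. split; simpl.
  - eapply der_eq; [|apply der_minus; apply der_mult; eassumption]. simpl. ring.
  - eapply der_eq; [|apply der_plus; apply der_mult; eassumption]. simpl. ring.
Qed.
Lemma cderiv_eq f x l m : l = m -> cderiv f x l -> cderiv f x m.
Proof. now intros ->. Qed.
Lemma cderiv_Cpow (phi : R -> R) x d z : is_derive phi x d -> 0 < phi x ->
  cderiv (fun t => Cpow (phi t) z) x (Cmul (RtoC (d / phi x)) (Cmul z (Cpow (phi x) z))).
Proof.
  intros H H0. destruct z as [a b].
  assert (W : forall F : R -> R, forall D, is_derive F (phi x) D ->
    is_derive (fun t => F (phi t)) x (d * D)).
  { intros F D HD. apply (is_derive_comp F phi); easy. }
  rewrite (Cpow_eq (phi x)). split.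
  - apply is_derive_ext with (fun t => exp (a * ln (phi t)) * cos (b * ln (phi t))).
    { intros t. now rewrite Cpow_eq. }
    eapply der_eq; [|apply (W (fun y => exp (a * ln y) * cos (b * ln y)))];
      [|auto_derive; [tauto|reflexivity]]. simpl. field. lra.
  - apply is_derive_ext with (fun t => exp (a * ln (phi t)) * sin (b * ln (phi t))).
    { intros t. now rewrite Cpow_eq. }
    eapply der_eq; [|apply (W (fun y => exp (a * ln y) * sin (b * ln y)))];
      [|auto_derive; [tauto|reflexivity]]. simpl. field. lra.
Qed.

Lemma cint_ext a b f g l : (forall x, inI a b x -> f x = g x) -> cint a b f l -> cint a b g l.
Proof.
  intros E [H1 H2]. split; eapply nint_ext; eauto; intros x Hx; simpl; now rewrite E.
Qed.
Lemma cint_eq a b f l m : l = m -> cint a b f l -> cint a b f m.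
Proof. now intros ->. Qed.
Lemma cint_unique a b f l m : Rbar_lt a b -> cint a b f l -> cint a b f m -> l = m.
Proof. intros H [H1 H2] [H3 H4]. apply Cx_ext; eapply nint_unique; eauto. Qed.
Lemma cint_add a b f g l m : cint a b f l -> cint a b g m ->
  cint a b (fun t => Cadd (f t) (g t)) (Cadd l m).
Proof. intros [H1 H2] [H3 H4]. split; simpl; now apply nint_plus. Qed.
Lemma cint_scal a b c f l : cint a b f l -> cint a b (fun t => Cmul c (f t)) (Cmul c l).
Proof.
  intros [H1 H2]. split; simpl.
  - apply nint_minus; now apply nint_scal.
  - apply nint_plus; now apply nint_scal.
Qed.
Lemma cint_sub a b f g l m : cint a b f l -> cint a b g m ->
  cint a b (fun t => Csub (f t) (g t)) (Csub l m).
Proof.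
  intros H1 H2. apply cint_eq with (Cadd l (Cmul (RtoC (-1)) m)).
  { apply Cx_ext; simpl; ring. }
  apply cint_ext with (fun t => Cadd (f t) (Cmul (RtoC (-1)) (g t))).
  { intros. apply Cx_ext; simpl; ring. }
  apply cint_add; [easy|]. now apply cint_scal.
Qed.
Lemma cint_RtoC a b f l : nint a b f l -> cint a b (fun t => RtoC (f t)) (RtoC l).
Proof. intros H. split; simpl; [easy|apply nint_zero]. Qed.
Lemma cint_sum a b n (f : nat -> R -> Cx) l : (forall k, (k <= n)%nat -> cint a b (f k) (l k)) ->
  cint a b (fun t => Csum_upto n (fun k => f k t)) (Csum_upto n l).
Proof.
  intros H. induction n as [|n IH]; simpl; [apply H; lia|].
  apply cint_add; [apply IH; auto|apply H; lia].
Qed.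
Lemma cint_dominated a b f g m : Rbar_lt a b ->
  (forall x, inI a b x -> ccont f x) ->
  (forall x, inI a b x -> Cmod (f x) <= g x) -> nint a b g m ->
  exists l, cint a b f l.
Proof.
  intros Hab Hc Hd Hg.
  destruct (nint_dominated a b (fun t => fst (f t)) g m) as [l1 H1]; auto.
  { intros; now apply Hc. }
  { intros. eapply Rle_trans; [apply Cmod_fst|auto]. }
  destruct (nint_dominated a b (fun t => snd (f t)) g m) as [l2 H2]; auto.
  { intros; now apply Hc. }
  { intros. eapply Rle_trans; [apply Cmod_snd|auto]. }
  now exists (l1, l2).
Qed.
(** The factor 2 comes from bounding real and imaginary parts separately; it is harmless, since the
    lemma only feeds convergence estimates. *)
Lemma cint_bound a b f g l m : Rbar_lt a b ->
  (forall x, inI a b x -> Cmod (f x) <= g x) -> cint a b f l -> nint a b g m ->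
  Cmod l <= 2 * m.
Proof.
  intros Hab Hd [H1 H2] Hg.
  eapply Rle_trans; [apply Cmod_le_sum|].
  assert (Rabs (fst l) <= m).
  { eapply nint_abs_le; try eassumption. intros. eapply Rle_trans; [apply Cmod_fst|auto]. }
  assert (Rabs (snd l) <= m).
  { eapply nint_abs_le; try eassumption. intros. eapply Rle_trans; [apply Cmod_snd|auto]. }
  lra.
Qed.
Lemma cint_primitive a b F f la lb :
  (forall x, inI a b x -> cderiv F x (f x)) -> (forall x, inI a b x -> ccont f x) ->
  clim (endL a) F la -> clim (endR b) F lb -> cint a b f (Csub lb la).
Proof.
  intros HF Hf [A1 A2] [B1 B2]. split.
  - split; [intros; now apply Hf|]. exists (fun t => fst (F t)), (fst la), (fst lb).
    split; [intros; now apply HF|]. repeat split; auto.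
  - split; [intros; now apply Hf|]. exists (fun t => snd (F t)), (snd la), (snd lb).
    split; [intros; now apply HF|]. repeat split; auto.
Qed.
Lemma cint_subst a b A B (phi dphi : R -> R) (f : R -> Cx) l : Rbar_lt a b -> Rbar_lt A B ->
  (forall x, inI a b x -> inI A B (phi x)) ->
  (forall x, inI a b x -> is_derive phi x (dphi x)) ->
  (forall x, inI a b x -> continuous dphi x) ->
  filterlim phi (endL a) (Rbar_locally A) ->
  filterlim phi (endR b) (Rbar_locally B) ->
  cint A B f l -> cint a b (fun x => Cmul (RtoC (dphi x)) (f (phi x))) l.
Proof.
  intros H1 H2 H3 H4 H5 H6 H7 [H8 H9]. split.
  - eapply nint_ext; [|eapply (nint_subst a b A B phi dphi); eassumption].
    intros; simpl. ring.
  - eapply nint_ext; [|eapply (nint_subst a b A B phi dphi); eassumption].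
    intros; simpl. ring.
Qed.

Lemma filterlim_squeeze0 (E : (R -> Prop) -> Prop) {FE : Filter E} (f g : R -> R) :
  E (fun x => Rabs (f x) <= g x) -> filterlim g E (locally 0) -> filterlim f E (locally 0).
Proof.
  intros H Hg. apply filterlim_locally. intros eps.
  pose proof (proj1 (filterlim_locally g 0) Hg eps) as H2.
  apply filter_imp with (2 := filter_and _ _ H H2). intros x [A B].
  unfold_ball in *.
  replace (f x + - 0) with (f x) by ring. replace (g x + - 0) with (g x) in B by ring.
  eapply Rle_lt_trans; [exact A|]. eapply Rle_lt_trans; [apply Rle_abs|exact B].
Qed.
Lemma clim_squeeze0 (E : (R -> Prop) -> Prop) {FE : Filter E} (f : R -> Cx) (g : R -> R) :
  E (fun x => Cmod (f x) <= g x) -> filterlim g E (locally 0) -> clim E f Czero.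
Proof.
  intros H Hg. split.
  - apply filterlim_squeeze0 with g; auto. apply filter_imp with (2 := H). intros x Hx.
    eapply Rle_trans; [apply Cmod_fst|auto].
  - apply filterlim_squeeze0 with g; auto. apply filter_imp with (2 := H). intros x Hx.
    eapply Rle_trans; [apply Cmod_snd|auto].
Qed.

(** * From primitives to the improper integrals of the statement *)

Lemma nint_is_RInt_oo (a b : R) f l : a < b -> nint a b f l -> is_RInt_oo f a b l.
Proof.
  intros Hab H. split.
  - intros c d H1 H2 H3. constructor. apply ex_RInt_Reals_0.
    apply inI_ex_RInt with a b; [apply H|split; simpl; lra|split; simpl; lra].
  - intros eps He. destruct (nint_exhaust a b f l Hab H eps He) as [u [v [[U1 U2] [[V1 V2] [_ W]]]]].
    simpl in U1, U2, V1, V2. exists (Rmin (u - a) (b - v)).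
    pose proof (Rmin_l (u - a) (b - v)). pose proof (Rmin_r (u - a) (b - v)).
    split; [apply Rmin_glb_lt; lra|]. intros c d HR Hc1 Hc2 Hd1 Hd2.
    rewrite <- RInt_Reals, Rabs_minus_sym.
    apply W; try lra; split; simpl; lra.
Qed.

Lemma nint_is_RInt_oinf (a : R) f l : nint a p_infty f l -> is_RInt_oinf f a l.
Proof.
  intros H. split.
  - intros c d H1 H2. constructor. apply ex_RInt_Reals_0.
    apply inI_ex_RInt with a p_infty; [apply H|split; simpl; lra|split; simpl; lra].
  - intros eps He. destruct (nint_exhaust a p_infty f l I H eps He) as [u [v [[U1 _] [[V1 _] [_ W]]]]].
    simpl in U1, V1. exists (u - a), v. split; [lra|]. intros c d HR Hc1 Hc2 Hd.
    rewrite <- RInt_Reals, Rabs_minus_sym. apply W; try lra; split; simpl; lra.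
Qed.

Lemma is_RInt_oo_unique f (a b l m : R) : a < b ->
  is_RInt_oo f a b l -> is_RInt_oo f a b m -> l = m.
Proof.
  intros Hab [H1 H2] [_ H3]. apply cond_eq. intros eps He.
  assert (He2 : 0 < eps / 2) by lra.
  destruct (H2 _ He2) as [d1 [p1 K1]]. destruct (H3 _ He2) as [d2 [p2 K2]].
  set (e := Rmin ((b - a) / 2) (Rmin d1 d2)).
  pose proof (Rmin_l ((b - a) / 2) (Rmin d1 d2)).
  pose proof (Rmin_r ((b - a) / 2) (Rmin d1 d2)).
  pose proof (Rmin_l d1 d2). pose proof (Rmin_r d1 d2).
  assert (0 < e) by (repeat apply Rmin_glb_lt; lra). fold e in H, H0.
  destruct (H1 (a + e / 2) (b - e / 2)) as [HR]; try lra.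
  pose proof (K1 _ _ HR ltac:(lra) ltac:(lra) ltac:(lra) ltac:(lra)) as A.
  pose proof (K2 _ _ HR ltac:(lra) ltac:(lra) ltac:(lra) ltac:(lra)) as B.
  apply Rabs_def2 in A. apply Rabs_def2 in B. apply Rabs_def1; lra.
Qed.

Lemma is_RInt_oinf_unique f (a l m : R) :
  is_RInt_oinf f a l -> is_RInt_oinf f a m -> l = m.
Proof.
  intros [H1 H2] [_ H3]. apply cond_eq. intros eps He.
  assert (He2 : 0 < eps / 2) by lra.
  destruct (H2 _ He2) as [d1 [M1 [p1 K1]]]. destruct (H3 _ He2) as [d2 [M2 [p2 K2]]].
  pose proof (Rmin_l d1 d2). pose proof (Rmin_r d1 d2).
  assert (0 < Rmin d1 d2) by (repeat apply Rmin_glb_lt; lra).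
  set (c := a + Rmin d1 d2 / 2). set (d := Rmax c (Rmax M1 M2) + 1).
  assert (c < d) by (pose proof (Rmax_l c (Rmax M1 M2)); unfold d; lra).
  assert (M1 < d) by (pose proof (Rmax_r c (Rmax M1 M2)); pose proof (Rmax_l M1 M2); unfold d; lra).
  assert (M2 < d) by (pose proof (Rmax_r c (Rmax M1 M2)); pose proof (Rmax_r M1 M2); unfold d; lra).
  assert (a < c < a + Rmin d1 d2) by (unfold c; lra).
  destruct (H1 c d) as [HR]; try lra.
  pose proof (K1 _ _ HR ltac:(lra) ltac:(lra) ltac:(lra)) as A.
  pose proof (K2 _ _ HR ltac:(lra) ltac:(lra) ltac:(lra)) as B.
  apply Rabs_def2 in A. apply Rabs_def2 in B. apply Rabs_def1; lra.
Qed.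

(** [epsilon] is determined only once some value is known to qualify; uniqueness, tested on a common
    truncation, then identifies the chosen value. *)
Lemma CInt_oo_eq (a b : R) f l : a < b -> cint a b f l -> CInt_oo f a b = l.
Proof.
  intros Hab [H1 H2].
  assert (W : is_CInt_oo f a b l) by (split; now apply nint_is_RInt_oo).
  pose proof (epsilon_spec C_inhabited (is_CInt_oo f a b) (ex_intro _ l W)) as [E1 E2].
  apply Cx_ext.
  - eapply is_RInt_oo_unique; [exact Hab|apply E1|apply W].
  - eapply is_RInt_oo_unique; [exact Hab|apply E2|apply W].
Qed.

Lemma CInt_oinf_eq (a : R) f l : cint a p_infty f l -> CInt_oinf f a = l.
Proof.
  intros [H1 H2].
  assert (W : is_CInt_oinf f a l) by (split; now apply nint_is_RInt_oinf).
  pose proof (epsilon_spec C_inhabited (is_CInt_oinf f a) (ex_intro _ l W)) as [E1 E2].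
  apply Cx_ext.
  - eapply is_RInt_oinf_unique; [apply E1|apply W].
  - eapply is_RInt_oinf_unique; [apply E2|apply W].
Qed.

(** * The Gamma function *)

Lemma ln_le_pred x : 0 < x -> ln x <= x - 1.
Proof.
  intros H. pose proof (exp_ineq1_le (ln x)) as E. rewrite exp_ln in E by easy. lra.
Qed.

Lemma Rabs_exp x : Rabs (exp x) = exp x.
Proof. apply Rabs_right. left. apply exp_pos. Qed.

Lemma exp_le_exp x y : x <= y -> exp x <= exp y.
Proof. intros [H| ->]; [left; now apply exp_increasing|right; easy]. Qed.

(** With [P = max p 1 > 0], the function P ln(1+y) - d y is largest at 1 + y = P/d, where it equals
    d - P + P ln(P/d). The inequality ln u <= u - 1 at u = (1+y)/(P/d) proves it. *)
Lemma poly_exp_bound p d : 0 < d ->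
  exists C, 0 < C /\ forall y, 0 <= y -> exp (p * ln (1 + y)) * exp (- (d * y)) <= C.
Proof.
  intros Hd. set (P := Rmax p 1).
  assert (HP : p <= P /\ 1 <= P) by (split; [apply Rmax_l|apply Rmax_r]).
  exists (exp (d - P + P * ln (P / d))). split; [apply exp_pos|].
  intros y Hy. rewrite <- exp_plus. apply exp_le_exp.
  assert (0 <= ln (1 + y)) by (rewrite <- ln_1; apply ln_le; lra).
  assert (p * ln (1 + y) <= P * ln (1 + y)) by (apply Rmult_le_compat_r; lra).
  assert (Hq : 0 < P / d) by (apply Rdiv_lt_0_compat; lra).
  assert (Hq2 : 0 < (1 + y) / (P / d)) by (apply Rdiv_lt_0_compat; lra).
  pose proof (ln_le_pred _ Hq2) as E.
  rewrite ln_div in E by lra.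
  assert (P * (ln (1 + y) - ln (P / d)) <= P * ((1 + y) / (P / d) - 1))
    by (apply Rmult_le_compat_l; lra).
  replace (P * ((1 + y) / (P / d) - 1)) with ((1 + y) * d - P) in H1 by (field; lra).
  nra.
Qed.

Lemma rpow_lim0 s : 0 < s -> filterlim (fun v => exp (s * ln v)) (endL 0) (locally 0).
Proof.
  intros Hs. apply filterlim_locally. intros [e He].
  assert (Hd : 0 < exp (ln e / s)) by apply exp_pos.
  exists (mkposreal _ Hd). intros v Hv H0. simpl in H0.
  unfold_ball in *.
  replace (v + - 0) with v in Hv by ring. rewrite Rabs_right in Hv by lra.
  replace (exp (s * ln v) + - 0) with (exp (s * ln v)) by ring.
  rewrite Rabs_exp.
  rewrite <- (exp_ln e) by easy. apply exp_increasing.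
  apply ln_increasing in Hv; [|easy]. rewrite ln_exp in Hv.
  apply (Rmult_lt_compat_l s) in Hv; [|easy].
  replace (s * (ln e / s)) with (ln e) in Hv by (field; lra). easy.
Qed.

Lemma lim_inv_infty C : filterlim (fun v => C * / (1 + v)) (endR p_infty) (locally 0).
Proof.
  replace 0 with (C * 0) by ring. apply filterlim_Rscal; [apply _|].
  apply filterlim_locally. intros [e He].
  exists (/ e). intros v Hv _.
  assert (0 < / e) by now apply Rinv_0_lt_compat.
  unfold_ball in *.
  replace (/ (1 + v) + - 0) with (/ (1 + v)) by ring.
  assert (0 < / (1 + v)) by (apply Rinv_0_lt_compat; lra).
  rewrite Rabs_right by lra. rewrite <- (Rinv_inv e). apply Rinv_lt_contravar; [|lra].
  apply Rmult_lt_0_compat; lra.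
Qed.

Lemma inI_0_infty x : inI 0 p_infty x <-> 0 < x.
Proof. unfold inI; simpl; tauto. Qed.

Lemma inI_pos x : 0 < x -> inI 0 p_infty x.
Proof. intros H. now split. Qed.

Lemma pos_inI x : inI 0 p_infty x -> 0 < x.
Proof. now intros [H _]. Qed.

(** The weight v^(s-1) (1+v)^(-s-1) behaves like v^(s-1) at 0 and v^(-2) at infinity, and has the
    explicit primitive (v/(1+v))^s / s. It is the standard dominator on the half-line. *)
Lemma mellin_dominator s : 0 < s ->
  nint 0 p_infty (fun v => exp ((s - 1) * ln v) * exp (- ((s + 1) * ln (1 + v)))) (/ s).
Proof.
  intros Hs. split.
  { intros x Hx. apply inI_0_infty in Hx. apply cont_derive. auto_derive. lra. }
  exists (fun v => / s * exp (s * ln (v / (1 + v)))), (/ s * 0), (/ s * exp (s * ln 1)).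
  split; [|split; [|split]].
  - intros x Hx. apply inI_0_infty in Hx. auto_derive.
    { split; [lra|]. split; [|easy]. apply Rdiv_lt_0_compat; lra. }
    change (x * / (1 + x)) with (x / (1 + x)).
    replace (s * ln (x / (1 + x))) with ((s - 1) * ln x + (- ((s + 1) * ln (1 + x))) + ln x + ln (1 + x)).
    2: { rewrite ln_div by lra. ring. }
    rewrite !exp_plus, !exp_ln by lra. field. lra.
  - apply filterlim_Rscal; [apply _|].
    apply filterlim_squeeze0 with (fun v => exp (s * ln v)); [apply _| |now apply rpow_lim0].
    apply filter_imp with (2 := endL_inI 0 p_infty I). intros x Hx. apply inI_0_infty in Hx.
    rewrite Rabs_exp. apply exp_le_exp.
    apply Rmult_le_compat_l; [lra|]. apply ln_le.
    + apply Rdiv_lt_0_compat; lra.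
    + apply Rle_div_l; nra.
  - apply filterlim_Rscal; [apply _|].
    apply (filterlim_comp _ _ _ (fun v => v / (1 + v)) (fun u => exp (s * ln u)) _ (locally 1)).
    2: { apply (cont_derive (fun u => exp (s * ln u)) 1). auto_derive. lra. }
    replace 1 with (1 + -1 * 0) at 1 by ring.
    apply (filterlim_ext_loc (F := endR p_infty) (fun v => 1 + -1 * (1 * / (1 + v)))).
    { apply filter_imp with (2 := endR_inI 0 p_infty I). intros x Hx. apply inI_0_infty in Hx.
      field. lra. }
    apply filterlim_Rplus; [apply _|apply filterlim_const|].
    apply filterlim_Rscal; [apply _|]. apply lim_inv_infty.
  - rewrite ln_1, Rmult_0_r, exp_0. ring.
Qed.

Lemma mellin_exists (a : Cx) (r : R -> Cx) C : 0 < fst a ->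
  (forall v, 0 < v -> ccont r v) ->
  (forall v, 0 < v -> Cmod (r v) <= C * exp (- ((fst a + 1) * ln (1 + v)))) ->
  exists l, cint 0 p_infty (fun v => Cmul (Cpow v (Csub a Cone)) (r v)) l.
Proof.
  intros Ha Hc Hr.
  apply cint_dominated with
    (fun v => C * (exp ((fst a - 1) * ln v) * exp (- ((fst a + 1) * ln (1 + v))))) (C * / fst a).
  - easy.
  - intros x Hx. apply inI_0_infty in Hx. apply ccont_mul; [now apply ccont_Cpow|auto].
  - intros x Hx. apply inI_0_infty in Hx. rewrite Cmod_mul, Cmod_Cpow. simpl.
    replace (fst a + - (1)) with (fst a - 1) by ring.
    specialize (Hr x Hx). pose proof (exp_pos ((fst a - 1) * ln x)). nra.
  - apply nint_scal. now apply mellin_dominator.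
Qed.

Lemma CGamma_cint (s : Cx) : 0 < fst s ->
  cint 0 p_infty (fun t => Cmul (Cpow t (Csub s Cone)) (RtoC (exp (- t)))) (CGamma s).
Proof.
  intros Hs. destruct (poly_exp_bound (fst s + 1) 1) as [C [_ HC]]; [lra|].
  destruct (mellin_exists s (fun t => RtoC (exp (- t))) C) as [l Hl]; auto.
  - intros v Hv. apply ccont_RtoC. apply cont_derive. auto_derive. easy.
  - intros v Hv. rewrite Cmod_RtoC, Rabs_exp.
    specialize (HC v ltac:(lra)). rewrite Rmult_1_l in HC.
    rewrite (exp_Ropp ((fst s + 1) * _)). apply Rle_div_r; [apply exp_pos|]. lra.
  - unfold CGamma. now rewrite (CInt_oinf_eq _ _ l).
Qed.

Lemma Cpow_pred t s : 0 < t -> Cpow t s = Cmul (RtoC t) (Cpow t (Csub s Cone)).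
Proof.
  intros H. rewrite <- (Cpow_1 t) by easy. rewrite <- Cpow_add. f_equal. ring.
Qed.

(** Integration by parts in one piece: s t^(s-1) e^(-t) - t^s e^(-t) is the derivative of t^s
    e^(-t), which vanishes at both ends. *)
Lemma CGamma_S (s : Cx) : 0 < fst s -> CGamma (Cadd s Cone) = Cmul s (CGamma s).
Proof.
  intros Hs.
  assert (H1 := cint_scal _ _ s _ _ (CGamma_cint s Hs)).
  assert (Hs1 : 0 < fst (Cadd s Cone)) by (simpl; lra).
  assert (H2 := cint_sub _ _ _ _ _ _ H1 (CGamma_cint _ Hs1)).
  assert (H3 : cint 0 p_infty (fun t => Csub (Cmul s (Cmul (Cpow t (Csub s Cone)) (RtoC (exp (- t)))))
     (Cmul (Cpow t (Csub (Cadd s Cone) Cone)) (RtoC (exp (- t))))) (Csub Czero Czero)).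
  { apply cint_primitive with (fun t => Cmul (Cpow t s) (RtoC (exp (- t)))).
    - intros x Hx. apply inI_0_infty in Hx.
      eapply cderiv_eq; [|apply cderiv_mul; [apply (cderiv_Cpow (fun t => t) x 1);
        [apply (is_derive_id (K := R_AbsRing))|easy]|
        apply (cderiv_RtoC (fun t => exp (- t)) x (- exp (- x))); auto_derive; [easy|ring]]].
      replace (Csub (Cadd s Cone) Cone) with s by ring.
      rewrite (Cpow_pred x s) by easy.
      cbv beta. unfold Rdiv. rewrite Rmult_1_l, RtoC_inv by lra. rewrite RtoC_opp. field.
      apply RtoC_neq0; lra.
    - intros x Hx. apply inI_0_infty in Hx.
      assert (ccont (fun t => RtoC (exp (- t))) x).
      { apply ccont_RtoC. apply cont_derive. auto_derive. easy. }
      apply ccont_sub; repeat apply ccont_mul; auto; try apply ccont_const; now apply ccont_Cpow.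
    - apply clim_squeeze0 with (fun v => exp (fst s * ln v)); [apply _| |now apply rpow_lim0].
      apply filter_imp with (2 := endL_inI 0 p_infty I). intros x Hx. apply inI_0_infty in Hx.
      rewrite Cmod_mul, Cmod_Cpow, Cmod_RtoC, Rabs_exp.
      pose proof (exp_pos (fst s * ln x)).
      assert (exp (- x) <= 1) by (rewrite <- exp_0; apply exp_le_exp; lra). nra.
    (* One power more than needed for boundedness leaves decay like 1/(1+x). *)
    - destruct (poly_exp_bound (fst s + 1) 1) as [C [C0 HC]]; [lra|].
      apply clim_squeeze0 with (fun v => C * / (1 + v)); [apply _| |apply lim_inv_infty].
      apply filter_imp with (2 := endR_inI 0 p_infty I). intros x Hx. apply inI_0_infty in Hx.
      rewrite Cmod_mul, Cmod_Cpow, Cmod_RtoC, Rabs_exp.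
      specialize (HC x ltac:(lra)).
      replace ((fst s + 1) * ln (1 + x)) with (fst s * ln (1 + x) + ln (1 + x)) in HC by ring.
      rewrite exp_plus, exp_ln in HC by lra. rewrite Rmult_1_l in HC.
      change (C * / (1 + x)) with (C / (1 + x)). apply -> Rle_div_r; [|lra].
      assert (exp (fst s * ln x) <= exp (fst s * ln (1 + x))).
      { apply exp_le_exp. apply Rmult_le_compat_l; [lra|]. apply ln_le; lra. }
      pose proof (exp_pos (- x)). pose proof (exp_pos (fst s * ln x)). nra. }
  pose proof (cint_unique _ _ _ _ _ (I : Rbar_lt 0 p_infty) H2 H3) as E.
  replace (CGamma (Cadd s Cone)) with
    (Csub (Cmul s (CGamma s)) (Csub (Cmul s (CGamma s)) (CGamma (Cadd s Cone)))) by ring.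
  rewrite E. ring.
Qed.

Lemma gamma_scaled (s : Cx) c : 0 < fst s -> 0 < c ->
  cint 0 p_infty (fun t => Cmul (Cpow t (Csub s Cone)) (RtoC (exp (- (c * t)))))
    (Cmul (CGamma s) (Cpow c (Copp s))).
Proof.
  intros Hs Hc.
  assert (H := cint_subst 0 p_infty 0 p_infty (fun t => c * t) (fun _ => c)
    (fun t => Cmul (Cpow t (Csub s Cone)) (RtoC (exp (- t)))) (CGamma s) I I
    ltac:(intros x; rewrite !inI_0_infty; intros; nra)
    ltac:(intros; auto_derive; [easy|ring]) ltac:(intros; apply continuous_const)).
  assert (L0 : filterlim (fun t => c * t) (endL 0) (Rbar_locally 0)).
  { simpl. apply (filterlim_endL 0).
    replace 0 with (c * 0) at 2 by ring.
    apply (cont_derive (fun t => c * t) 0). auto_derive. easy. }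
  assert (L1 : filterlim (fun t => c * t) (endR p_infty) (Rbar_locally p_infty)).
  { intros P [M HM]. exists (M / c). intros x Hx _. apply HM. apply Rlt_div_l in Hx; lra. }
  specialize (H L0 L1 (CGamma_cint s Hs)).
  apply (cint_scal _ _ (Cpow c (Copp s))) in H.
  apply cint_eq with (Cmul (Cpow c (Copp s)) (CGamma s)); [ring|].
  apply cint_ext with (2 := H). intros x Hx. apply inI_0_infty in Hx.
  rewrite Cpow_mul by lra. rewrite Cpow_opp. rewrite (Cpow_pred c s) by easy. field.
  split; [apply Cpow_neq0|apply RtoC_neq0; lra].
Qed.

Lemma CGamma_1 : CGamma Cone = Cone.
Proof.
  assert (H1 : 0 < fst Cone) by (simpl; lra).
  apply (cint_unique 0 p_infty (fun t => RtoC (exp (- t)))); [easy| |].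
  - apply cint_ext with (2 := CGamma_cint Cone H1). intros x _.
    replace (Csub Cone Cone) with Czero by ring. rewrite Cpow_0. ring.
  - apply (cint_RtoC _ _ (fun t => exp (- t)) 1). split.
    { intros. apply cont_derive. auto_derive. easy. }
    exists (fun t => -1 * exp (- t)), (-1 * 1), (-1 * 0). split; [|split; [|split]].
    + intros. auto_derive; [easy|ring].
    + apply filterlim_Rscal; [apply _|].
      apply (filterlim_endL 0).
      replace 1 with (exp (- 0)) by (rewrite Ropp_0; apply exp_0).
      apply (cont_derive (fun t => exp (- t)) 0). auto_derive. easy.
    + apply filterlim_Rscal; [apply _|].
      apply filterlim_squeeze0 with (fun v => 1 * / (1 + v)); [apply _| |apply lim_inv_infty].
      apply filter_imp with (2 := endR_inI 0 p_infty I). intros x Hx. apply inI_0_infty in Hx.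
      rewrite Rabs_exp. rewrite exp_Ropp, Rmult_1_l.
      apply Rinv_le_contravar; [lra|]. apply exp_ineq1_le.
    + ring.
Qed.

(** * Non-vanishing of Gamma on the right half-plane *)

(** cos y = 1 - 2 sin^2(y/2), together with |sin u| <= |u|. *)
Lemma cos_ge_quadratic y : 1 - y ^ 2 / 2 <= cos y.
Proof.
  assert (W : forall u, 0 <= u -> sin u <= u).
  { intros u [Hu| <-]; [left; now apply sin_lt_x|rewrite sin_0; lra]. }
  assert (W2 : forall u, 0 <= u -> Rabs (sin u) <= u).
  { intros u Hu. apply Rabs_le. split; [|auto].
    destruct (Rle_dec u PI) as [H|H].
    - pose proof (sin_ge_0 u Hu H). lra.
    - pose proof (SIN_bound u). pose proof PI_4. pose proof PI2_3_2. unfold PI2 in *. lra. }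
  assert (W3 : forall u, (sin u) ^ 2 <= u ^ 2).
  { intros u. rewrite <- !Rsqr_pow2. apply Rsqr_le_abs_1.
    destruct (Rle_dec 0 u) as [H|H].
    - rewrite (Rabs_right u) by lra. auto.
    - rewrite (Rabs_left u) by lra. rewrite <- Rabs_Ropp, <- sin_neg. apply W2. lra. }
  replace y with (2 * (y / 2)) at 2 by field. rewrite cos_2a_sin.
  specialize (W3 (y / 2)). nra.
Qed.

(** Both sides are invariant under u -> 1/u, and for u >= 1 one has ln u <= u - 1 <= u - 1/u. The
    right side is a Laurent polynomial in u, so against the Gamma weight it still integrates to
    Gamma values. *)
Lemma ln_sqr_le u : 0 < u -> ln u ^ 2 <= (u - / u) ^ 2.
Proof.
  assert (W : forall u, 1 <= u -> ln u ^ 2 <= (u - / u) ^ 2).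
  { intros v Hv. apply pow_incr. split.
    - rewrite <- ln_1. apply ln_le; lra.
    - pose proof (ln_le_pred v ltac:(lra)).
      assert (/ v <= 1) by (rewrite <- Rinv_1; apply Rinv_le_contravar; lra). lra. }
  intros Hu. destruct (Rle_dec 1 u) as [H|H]; [auto|].
  assert (H' : 1 <= / u) by (rewrite <- Rinv_1; apply Rinv_le_contravar; lra).
  specialize (W _ H'). rewrite ln_Rinv, Rinv_inv in W by easy. nra.
Qed.

Definition Gr (N : R) : R := fst (CGamma (RtoC N)).

Lemma Gr_nint N : 0 < N -> nint 0 p_infty (fun t => exp ((N - 1) * ln t) * exp (- t)) (Gr N).
Proof.
  intros H. assert (H1 : 0 < fst (RtoC N)) by easy.
  destruct (CGamma_cint _ H1) as [H2 _]. apply nint_ext with (2 := H2).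
  intros x _. rewrite Cpow_eq. simpl.
  replace (0 + - 0) with 0 by ring. rewrite Rmult_0_l, cos_0.
  replace (N + - (1)) with (N - 1) by ring. ring.
Qed.

Lemma Gr_S N : 0 < N -> Gr (N + 1) = N * Gr N.
Proof.
  intros H. unfold Gr. rewrite RtoC_add. change (RtoC 1) with Cone.
  rewrite CGamma_S by easy. simpl. ring.
Qed.

(** Positivity of the integrand alone gives only [0 <= Gr N]; strictness comes from the increment of
    the primitive over [[1, 2]]. *)
Lemma Gr_pos N : 0 < N -> 0 < Gr N.
Proof.
  intros H. destruct (Gr_nint N H) as [_ [F [la [lb [HF [Ha [Hb ->]]]]]]].
  assert (W : forall x, inI 0 p_infty x -> la <= F x <= lb).
  { intros x Hx. apply (incr_limits 0 p_infty F _ la lb x HF); auto.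
    intros y _. left. apply Rmult_lt_0_compat; apply exp_pos. }
  pose proof (W 1 ltac:(unfold inI; simpl; lra)).
  pose proof (W 2 ltac:(unfold inI; simpl; lra)).
  destruct (MVT_gen F 1 2 (fun t => exp ((N - 1) * ln t) * exp (- t))) as [c [Hc E]].
  - intros x Hx. apply HF. rewrite Rmin_left, Rmax_right in Hx by lra. unfold inI; simpl; lra.
  - intros x Hx. eapply derive_continuity_pt. apply HF.
    rewrite Rmin_left, Rmax_right in Hx by lra. unfold inI; simpl; lra.
  - assert (0 < exp ((N - 1) * ln c) * exp (- c)) by (apply Rmult_lt_0_compat; apply exp_pos). nra.
Qed.

(* With N = Re s + n large and tau = Im s, the weight t^(N-1) e^(-t) concentrates near
   t = N, so that |Gamma (s + n)| is comparable to Gamma N; cos y >= 1 - y^2/2 and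
   |ln u| <= |u - 1/u| turn this into an identity between Gamma values at N, N + 2, N - 2. *)
Lemma CGamma_neq0 (s : Cx) : 0 < fst s -> CGamma s <> Czero.
Proof.
  intros Hs E.
  (* A zero propagates to the right by the functional equation, so it can be refuted far out. *)
  assert (En : forall n, CGamma (Cadd s (RtoC (INR n))) = Czero).
  { induction n as [|n IH].
    - simpl. change (RtoC 0) with Czero. replace (Cadd s Czero) with s by ring. easy.
    - replace (Cadd s (RtoC (INR (S n)))) with (Cadd (Cadd s (RtoC (INR n))) Cone)
        by (rewrite S_INR, RtoC_add; change (RtoC 1) with Cone; ring).
      rewrite CGamma_S, IH; [ring|]. simpl. pose proof (pos_INR n). lra. }
  set (tau := snd s).
  destruct (INR_unbounded (4 + 5 * tau ^ 2)) as [n Hn].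
  set (N := fst s + INR n). assert (HN : 4 + 5 * tau ^ 2 < N) by (unfold N; lra).
  assert (Ht : 0 <= tau ^ 2) by nra.
  assert (Hsn : 0 < fst (Cadd s (RtoC (INR n)))) by (simpl; fold N; lra).
  pose proof (CGamma_cint _ Hsn) as H. rewrite En in H.
  (* Multiplying by N^(-i tau) centres the phase at t = N: the real part of the integrand becomes
     the positive weight times cos(tau ln(t/N)). *)
  apply (cint_scal _ _ (Cpow N (0, - tau))) in H. destruct H as [H _].
  assert (HL : nint 0 p_infty (fun t => (1 + tau ^ 2) * (exp ((N - 1) * ln t) * exp (- t)) -
     (tau ^ 2 / 2 / N ^ 2 * (exp ((N + 2 - 1) * ln t) * exp (- t)) +
      tau ^ 2 / 2 * N ^ 2 * (exp ((N - 2 - 1) * ln t) * exp (- t))))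
     ((1 + tau ^ 2) * Gr N - (tau ^ 2 / 2 / N ^ 2 * Gr (N + 2) + tau ^ 2 / 2 * N ^ 2 * Gr (N - 2)))).
  { apply nint_minus; [|apply nint_plus]; apply nint_scal; apply Gr_nint; lra. }
  assert (Hfin : (1 + tau ^ 2) * Gr N - (tau ^ 2 / 2 / N ^ 2 * Gr (N + 2) + tau ^ 2 / 2 * N ^ 2 * Gr (N - 2)) <= 0).
  { replace 0 with (fst (Cmul (Cpow N (0, - tau)) Czero)) at 1 by (simpl; ring).
    eapply nint_le; [exact (I : Rbar_lt 0 p_infty)| |exact HL|exact H].
    intros t Ht0. apply inI_0_infty in Ht0.
    rewrite !Cpow_eq. simpl. fold tau N.
    replace (N + - (1)) with (N - 1) by ring.
    replace (tau + 0 + - 0) with tau by ring.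
    rewrite Rmult_0_l, exp_0. ring_simplify (- tau * ln N).
    set (w := exp ((N - 1) * ln t) * exp (- t)).
    assert (Hw : 0 < w) by (apply Rmult_lt_0_compat; apply exp_pos).
    match goal with |- _ <= ?X => replace X with (w * cos (tau * ln (t / N))) end.
    2: { rewrite ln_div by lra. replace (tau * (ln t - ln N)) with (tau * ln t - tau * ln N) by ring.
         rewrite cos_minus. unfold w. replace (- tau * ln N) with (- (tau * ln N)) by ring.
         rewrite cos_neg, sin_neg. ring. }
    replace (exp ((N + 2 - 1) * ln t) * exp (- t)) with (w * t ^ 2).
    2: { unfold w. replace ((N + 2 - 1) * ln t) with ((N - 1) * ln t + ln t + ln t) by ring.
         rewrite !exp_plus, !exp_ln by easy. ring. }
    replace (exp ((N - 2 - 1) * ln t) * exp (- t)) with (w / t ^ 2).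
    2: { unfold w. replace ((N - 1) * ln t) with ((N - 2 - 1) * ln t + ln t + ln t) by ring.
         rewrite !exp_plus, !exp_ln by easy. field. lra. }
    pose proof (cos_ge_quadratic (tau * ln (t / N))) as Q.
    assert (Htn : 0 < t / N) by (apply Rdiv_lt_0_compat; lra).
    pose proof (ln_sqr_le (t / N) Htn) as Q2.
    replace ((t / N - / (t / N)) ^ 2) with (t ^ 2 / N ^ 2 - 2 + N ^ 2 / t ^ 2) in Q2 by (field; lra).
    assert (Q3 : 1 - tau ^ 2 / 2 * (t ^ 2 / N ^ 2 - 2 + N ^ 2 / t ^ 2) <= cos (tau * ln (t / N))).
    { eapply Rle_trans; [|exact Q]. rewrite Rpow_mult_distr. nra. }
    apply (Rmult_le_compat_l w) in Q3; [|lra].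
    eapply Rle_trans; [|exact Q3]. right. field. lra. }
  assert (G1 : Gr (N + 2) = (N + 1) * (N * Gr N)).
  { replace (N + 2) with (N + 1 + 1) by ring. rewrite !Gr_S by lra. ring. }
  assert (G2 : Gr N = (N - 1) * ((N - 2) * Gr (N - 2))).
  { replace N with (N - 2 + 1 + 1) at 1 by ring. rewrite !Gr_S by lra. ring. }
  pose proof (Gr_pos (N - 2) ltac:(lra)) as P. set (g := Gr (N - 2)) in *.
  rewrite G1, G2 in Hfin.
  replace (tau ^ 2 / 2 / N ^ 2 * ((N + 1) * (N * ((N - 1) * ((N - 2) * g))))) with
    (tau ^ 2 / 2 * ((1 + / N) * ((N - 1) * (N - 2) * g))) in Hfin by (field; lra).
  assert (Hfin2 : ((1 + tau ^ 2) * ((N - 1) * (N - 2)) -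
    (tau ^ 2 / 2 * ((1 + / N) * ((N - 1) * (N - 2))) + tau ^ 2 / 2 * N ^ 2)) * g <= 0) by lra.
  assert (Hinv : / N * ((N - 1) * (N - 2)) <= N).
  { apply Rmult_le_reg_l with N; [lra|].
    replace (N * (/ N * ((N - 1) * (N - 2)))) with ((N - 1) * (N - 2)) by (field; lra). nra. }
  (* In the coefficient of tau^2 the terms in N^2 cancel, so the loss is at most 2 tau^2 N; the
     choice N > 4 + 5 tau^2 keeps it below (N-1)(N-2). *)
  assert (0 < (1 + tau ^ 2) * ((N - 1) * (N - 2)) -
    (tau ^ 2 / 2 * ((1 + / N) * ((N - 1) * (N - 2))) + tau ^ 2 / 2 * N ^ 2)); [|nra].
  assert (K : tau ^ 2 / 2 * (/ N * ((N - 1) * (N - 2))) <= tau ^ 2 / 2 * N)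
    by (apply Rmult_le_compat_l; lra).
  assert (K2 : tau ^ 2 * N <= N * (N - 4) / 5) by nra.
  replace ((1 + / N) * ((N - 1) * (N - 2))) with ((N - 1) * (N - 2) + / N * ((N - 1) * (N - 2))) by ring.
  nra.
Qed.

(** * Trigonometric moments *)

Lemma nint_one (c : R) : nint 0 c (fun _ => 1) c.
Proof.
  split; [intros; apply continuous_const|]. exists (fun t => t), 0, c.
  split; [|split; [|split]]; [|intros P HP|intros P HP|ring].
  - intros. auto_derive; easy.
  - now apply filter_imp with (2 := HP).
  - now apply filter_imp with (2 := HP).
Qed.

Definition trig_int (mu : Cx) (n : nat) (th : R) : Cx :=
  Cmul (RtoC (cos th ^ n)) (Cpow (sin th) mu).

Lemma sin_pos_inI x : inI 0 PI x -> 0 < sin x.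
Proof. intros [H1 H2]. now apply sin_gt_0. Qed.

Lemma cos_le1 x : Rabs (cos x) <= 1.
Proof. apply Rabs_le. pose proof (COS_bound x). lra. Qed.

Lemma cos_pow_le1 x n : Rabs (cos x ^ n) <= 1.
Proof.
  rewrite <- RPow_abs. rewrite <- (pow1 n). apply pow_incr. split; [apply Rabs_pos|apply cos_le1].
Qed.

Lemma trig_int_cont mu n x : inI 0 PI x -> ccont (trig_int mu n) x.
Proof.
  intros Hx. apply ccont_mul.
  - apply ccont_RtoC. apply cont_derive. auto_derive. easy.
  - apply (ccont_comp (fun r => Cpow r mu) sin).
    + apply cont_derive. auto_derive. easy.
    + apply ccont_Cpow. now apply sin_pos_inI.
Qed.

Lemma sin_rpow_lim (s : R) : 0 < s ->
  filterlim (fun t => exp (s * ln (sin t))) (endL 0) (locally 0) /\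
  filterlim (fun t => exp (s * ln (sin t))) (endR PI) (locally 0).
Proof.
  assert (S : forall c, sin c = 0 -> filterlim sin (locally c) (locally 0)).
  { intros c Hc. pattern 0 at 1. rewrite <- Hc.
    apply (cont_derive sin c). auto_derive. easy. }
  assert (HP : Rbar_lt 0 PI) by (simpl; apply PI_RGT_0).
  intros Hs. pose proof (rpow_lim0 s Hs) as H. split.
  - apply (filterlim_comp _ _ _ sin (fun v => exp (s * ln v)) _ (endL 0)); [|easy].
    intros P Q.
    pose proof (filter_le_within (F := locally 0) (fun x => Rbar_lt 0 x) _ (S 0 sin_0 _ Q)) as W.
    apply filter_imp with (2 := filter_and (F := endL 0) _ _ W (endL_inI 0 PI HP)).
    intros x [H1 H2]. apply H1. now apply sin_pos_inI.
  - apply (filterlim_comp _ _ _ sin (fun v => exp (s * ln v)) _ (endL 0)); [|easy].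
    intros P Q.
    pose proof (filter_le_within (F := locally PI) (fun x => Rbar_lt x PI) _ (S PI sin_PI _ Q)) as W.
    apply filter_imp with (2 := filter_and (F := endR PI) _ _ W (endR_inI 0 PI HP)).
    intros x [H1 H2]. apply H1. now apply sin_pos_inI.
Qed.

(* d/dt (cos^n sin^(mu+1)) *)
Lemma trig_by_parts (mu : Cx) n : -1 < fst mu ->
  cint 0 PI (fun t => Csub (Cmul (Cadd mu Cone) (trig_int mu (S n) t))
    (Cmul (RtoC (INR n * cos t ^ pred n * sin t ^ 2)) (Cpow (sin t) mu))) Czero.
Proof.
  intros Hm. assert (Hs : 0 < fst mu + 1) by lra.
  destruct (sin_rpow_lim _ Hs) as [L1 L2].
  assert (B : forall x, inI 0 PI x -> Cmod (Cmul (RtoC (cos x ^ n)) (Cpow (sin x) (Cadd mu Cone)))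
     <= exp ((fst mu + 1) * ln (sin x))).
  { intros x Hx. rewrite Cmod_mul, Cmod_RtoC, Cmod_Cpow. simpl.
    pose proof (cos_pow_le1 x n). pose proof (exp_pos ((fst mu + 1) * ln (sin x))). nra. }
  assert (HP : Rbar_lt 0 PI) by (simpl; apply PI_RGT_0).
  apply cint_eq with (Csub Czero Czero); [ring|].
  apply cint_primitive with (fun t => Cmul (RtoC (cos t ^ n)) (Cpow (sin t) (Cadd mu Cone))).
  - intros x Hx. pose proof (sin_pos_inI x Hx).
    eapply cderiv_eq; [|apply cderiv_mul; [
       apply (cderiv_RtoC (fun t => cos t ^ n) x (INR n * (- sin x) * cos x ^ pred n));
         auto_derive; [easy|ring]|
       apply (cderiv_Cpow sin x (cos x)); [auto_derive; [easy|ring]|easy]]].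
    cbv beta. rewrite Cpow_add, Cpow_1 by easy. unfold trig_int, Rdiv.
    rewrite <- tech_pow_Rmult.
    apply Cx_ext; simpl; field; lra.
  - intros x Hx. pose proof (sin_pos_inI x Hx).
    apply ccont_sub; [apply ccont_mul; [apply ccont_const|]|].
    + now apply trig_int_cont.
    + apply ccont_mul.
      * apply ccont_RtoC. apply cont_derive. auto_derive. easy.
      * apply (ccont_comp (fun r => Cpow r mu) sin).
        -- apply cont_derive. auto_derive. easy.
        -- now apply ccont_Cpow.
  - eapply clim_squeeze0; [apply _| |exact L1].
    now apply filter_imp with (2 := endL_inI 0 PI HP).
  - eapply clim_squeeze0; [apply _| |exact L2].
    now apply filter_imp with (2 := endR_inI 0 PI HP).
Qed.

Lemma sin2_cos2_pow t : sin t ^ 2 = 1 - cos t ^ 2.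
Proof. pose proof (sin2_cos2 t) as H. unfold Rsqr in H. simpl. lra. Qed.

(** For Re mu < 0 the integrand is unbounded at both ends. Integration by parts with n = 1 lifts the
    exponent: (mu+1) sin^mu is an exact derivative plus (mu+2) sin^(mu+2), and the last power is
    bounded by 1 in modulus. *)
Lemma trig_int0_ex (mu : Cx) : -1 < fst mu -> exists l, cint 0 PI (trig_int mu 0) l.
Proof.
  intros Hm. assert (HP : Rbar_lt 0 PI) by (simpl; apply PI_RGT_0).
  destruct (cint_dominated 0 PI (trig_int (Cadd mu (RtoC 2)) 0) (fun _ => 1) PI) as [l Hl]; auto.
  { intros. now apply trig_int_cont. }
  { intros x Hx. unfold trig_int. rewrite Cmod_mul, Cmod_RtoC, Cmod_Cpow. simpl.
    rewrite Rabs_R1, Rmult_1_l. rewrite <- exp_0. apply exp_le_exp.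
    pose proof (sin_pos_inI x Hx). pose proof (SIN_bound x).
    pose proof (ln_le_pred (sin x) H). nra. }
  { apply nint_one. }
  pose proof (trig_by_parts mu 1 Hm) as H1.
  pose proof (cint_add _ _ _ _ _ _ H1 (cint_scal _ _ (Cadd mu (RtoC 2)) _ _ Hl)) as H2.
  pose proof (cint_scal _ _ (Cinv (Cadd mu Cone)) _ _ H2) as H3.
  eexists. apply cint_ext with (2 := H3).
  intros x Hx. cbv beta. pose proof (sin_pos_inI x Hx).
  unfold trig_int. rewrite Cpow_add.
  replace (Cpow (sin x) (RtoC 2)) with (RtoC (sin x ^ 2)) by (rewrite <- Cpow_nat; easy).
  rewrite sin2_cos2_pow. simpl pred. simpl INR. rewrite !pow_O.
  replace (1 * 1 * (1 - cos x ^ 2)) with (1 - cos x ^ 2) by ring.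
  rewrite !RtoC_sub. replace (RtoC 2) with (Cadd Cone Cone) by (apply Cx_ext; simpl; ring).
  change (RtoC 1) with Cone. field. apply Cre_neq0. simpl. lra.
Qed.

Lemma sin_rpow_ex m : -1 < m -> exists l, nint 0 PI (fun t => exp (m * ln (sin t))) l.
Proof.
  intros H. destruct (trig_int0_ex (RtoC m)) as [l [Hl _]]; [easy|]. exists (fst l).
  apply nint_ext with (2 := Hl). intros x _. unfold trig_int. rewrite Cpow_RtoC. simpl. ring.
Qed.

Definition trig_moment (mu : Cx) (n : nat) : Cx := CInt_oo (trig_int mu n) 0 PI.

Lemma trig_moment_cint (mu : Cx) n : -1 < fst mu -> cint 0 PI (trig_int mu n) (trig_moment mu n).
Proof.
  intros Hm. assert (HP : Rbar_lt 0 PI) by (simpl; apply PI_RGT_0).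
  destruct (sin_rpow_ex _ Hm) as [m Hm'].
  destruct (cint_dominated 0 PI (trig_int mu n) (fun t => exp (fst mu * ln (sin t))) m HP) as [l Hl]; auto.
  { intros. now apply trig_int_cont. }
  { intros x Hx. unfold trig_int. rewrite Cmod_mul, Cmod_RtoC, Cmod_Cpow.
    pose proof (cos_pow_le1 x n). pose proof (exp_pos (fst mu * ln (sin x))). nra. }
  unfold trig_moment. rewrite (CInt_oo_eq _ _ _ l); [easy|apply PI_RGT_0|easy].
Qed.

Lemma trig_moment_1 (mu : Cx) : -1 < fst mu -> trig_moment mu 1 = Czero.
Proof.
  intros Hm. assert (HP : Rbar_lt 0 PI) by (simpl; apply PI_RGT_0).
  pose proof (trig_by_parts mu 0 Hm) as H1.
  pose proof (cint_scal _ _ (Cadd mu Cone) _ _ (trig_moment_cint mu 1 Hm)) as H2.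
  assert (H3 : Cmul (Cadd mu Cone) (trig_moment mu 1) = Czero).
  { apply cint_unique with (1 := HP) (2 := H2). apply cint_ext with (2 := H1).
    intros x _. cbv beta. simpl INR. rewrite !Rmult_0_l. change (RtoC 0) with Czero. ring. }
  assert (Cadd mu Cone <> Czero) by (apply Cre_neq0; simpl; lra).
  replace (trig_moment mu 1) with (Cmul (Cinv (Cadd mu Cone)) (Cmul (Cadd mu Cone) (trig_moment mu 1)))
    by now field.
  rewrite H3. ring.
Qed.

Lemma trig_moment_SS (mu : Cx) n : -1 < fst mu ->
  Cmul (Cadd mu (RtoC (INR n + 2))) (trig_moment mu (S (S n))) =
  Cmul (RtoC (INR n + 1)) (trig_moment mu n).
Proof.
  intros Hm. assert (HP : Rbar_lt 0 PI) by (simpl; apply PI_RGT_0).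
  pose proof (trig_by_parts mu (S n) Hm) as H1.
  pose proof (cint_scal _ _ (Cadd mu (RtoC (INR n + 2))) _ _ (trig_moment_cint mu (S (S n)) Hm)) as H2.
  pose proof (cint_scal _ _ (RtoC (INR n + 1)) _ _ (trig_moment_cint mu n Hm)) as H3.
  pose proof (cint_sub _ _ _ _ _ _ H2 H3) as H4.
  assert (E : Csub (Cmul (Cadd mu (RtoC (INR n + 2))) (trig_moment mu (S (S n))))
     (Cmul (RtoC (INR n + 1)) (trig_moment mu n)) = Czero).
  { apply cint_unique with (1 := HP) (2 := H4). apply cint_ext with (2 := H1).
    intros x _. cbv beta. simpl pred. unfold trig_int. rewrite S_INR, sin2_cos2_pow, <- !tech_pow_Rmult.
    apply Cx_ext; simpl; ring. }
  match type of E with Csub ?a ?b = _ => replace a with (Cadd (Csub a b) b) by ring end.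
  rewrite E. ring.
Qed.

(** Obtained from the vanishing first moment and the two-step recursion, whose leading factor mu + n
    + 2 is nonzero. *)
Lemma trig_moment_odd (mu : Cx) k : -1 < fst mu -> trig_moment mu (S (2 * k)) = Czero.
Proof.
  intros Hm. induction k as [|k IH]; [now apply trig_moment_1|].
  replace (S (2 * S k)) with (S (S (S (2 * k)))) by lia.
  pose proof (trig_moment_SS mu (S (2 * k)) Hm) as H. rewrite IH in H.
  assert (H2 : Cadd mu (RtoC (INR (S (2 * k)) + 2)) <> Czero).
  { apply Cre_neq0. cbn [fst snd Cadd RtoC]. pose proof (pos_INR (S (2 * k))). lra. }
  set (c := Cadd mu (RtoC (INR (S (2 * k)) + 2))) in *.
  match goal with |- ?a = _ => replace a with (Cmul (Cinv c) (Cmul c a)) by now field end.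
  rewrite H. ring.
Qed.

Lemma trig_moment_0_0 : trig_moment (RtoC 0) 0 = RtoC PI.
Proof.
  apply CInt_oo_eq; [apply PI_RGT_0|].
  apply (cint_ext _ _ (fun _ => RtoC 1)).
  { intros x _. unfold trig_int. change (RtoC 0) with Czero. rewrite Cpow_0. apply Cx_ext; simpl; ring. }
  apply (cint_RtoC _ _ (fun _ => 1)).
  apply nint_one.
Qed.

(** * Exchanging integrals against the Laplace kernel *)

Lemma continuity_2d_laplace (a b : R -> R) u v : continuous a u -> continuous b v ->
  continuity_2d_pt (fun x y => a x * b y * exp (- (x * y))) u v.
Proof.
  intros Ha Hb.
  apply continuity_2d_pt_mult; [apply continuity_2d_pt_mult|].
  - apply (continuity_1d_2d_pt_comp a (fun x y => x)); [|apply continuity_2d_pt_id1].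
    now apply continuity_pt_filterlim.
  - apply (continuity_1d_2d_pt_comp b (fun x y => y)); [|apply continuity_2d_pt_id2].
    now apply continuity_pt_filterlim.
  - apply (continuity_1d_2d_pt_comp (fun z => exp (- z)) (fun x y => x * y)).
    + apply continuity_pt_filterlim. apply (cont_derive (fun z => exp (- z))). auto_derive. easy.
    + apply continuity_2d_pt_mult; [apply continuity_2d_pt_id1|apply continuity_2d_pt_id2].
Qed.

(** Continuity is read off from differentiability under the integral sign, the kernel being smooth
    in the parameter. *)
Lemma laplace_RInt_cont (h : R -> R) p q v : (forall x, 0 < x -> continuous h x) ->
  0 < p -> 0 < q -> continuous (fun v => RInt (fun t => h t * exp (- (t * v))) p q) v.
Proof.
  intros Hh Hp Hq. apply cont_derive.
  assert (M : forall t, Rmin p q <= t -> 0 < t).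
  { intros t. unfold Rmin. destruct (Rle_dec p q); lra. }
  eexists. apply (is_derive_RInt_param (fun v t => h t * exp (- (t * v)))).
  - apply filter_forall. intros x t _. auto_derive. easy.
  - intros t Ht. 
    apply (continuity_2d_pt_ext (fun x y => 1 * (- y * h y) * exp (- (x * y)))).
    { intros x y. symmetry. apply is_derive_unique. auto_derive; [easy|]. rewrite (Rmult_comm y x). ring. }
    apply (continuity_2d_laplace (fun _ => 1) (fun y => - y * h y)); [apply continuous_const|].
    apply cont_mult; [apply (cont_derive (fun y => - y)); auto_derive; easy|].
    apply Hh, M, Ht.
  - apply filter_forall. intros y. apply (ex_RInt_continuous (V := R_CompleteNormedModule)).
    intros z Hz. apply cont_mult; [apply Hh, M, Hz|].
    apply (cont_derive (fun t => exp (- (t * y)))). auto_derive. easy.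
Qed.

(** Fubini by Leibniz' rule: let the upper end of the t-integral move while the v-range stays
    [[p, q]]. The two iterated integrals then have the same derivative in that end and both vanish
    when it equals [p]. *)
Lemma laplace_fubini_compact (g h : R -> R) p q :
  (forall x, 0 < x -> continuous g x) -> (forall x, 0 < x -> continuous h x) ->
  0 < p <= q ->
  RInt (fun v => g v * RInt (fun t => h t * exp (- (t * v))) p q) p q =
  RInt (fun t => h t * RInt (fun v => g v * exp (- (v * t))) p q) p q.
Proof.
  intros Hg Hh Hpq.
  assert (Cg : forall v t, 0 < t -> continuous (fun t => h t * exp (- (t * v))) t).
  { intros v t Ht. apply cont_mult; [auto|].
    apply (cont_derive (fun t => exp (- (t * v)))). auto_derive. easy. }
  assert (Ci : forall t, 0 < t -> continuous (fun t => h t * RInt (fun v => g v * exp (- (v * t))) p q) t).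
  { intros t Ht. apply cont_mult; [auto|]. apply laplace_RInt_cont; auto; lra. }
  assert (I1 : forall x, 0 < x -> inI 0 p_infty x) by exact inI_pos.
  assert (I2 : forall x, inI 0 p_infty x -> 0 < x) by exact pos_inI.
  set (F1 := fun y => RInt (fun v => g v * RInt (fun t => h t * exp (- (t * v))) p y) p q).
  set (F2 := fun y => RInt (fun t => h t * RInt (fun v => g v * exp (- (v * t))) p q) p y).
  assert (D2 : forall y, 0 < y -> is_derive F2 y (h y * RInt (fun v => g v * exp (- (v * y))) p q)).
  { intros y Hy. apply (inI_derive_RInt 0 p_infty (fun t => h t * RInt (fun v => g v * exp (- (v * t))) p q));
      [intros x Hx; apply Ci; now apply I2| |]; apply I1; lra. }
  assert (Din : forall y v, 0 < y ->
    is_derive (fun z => g v * RInt (fun t => h t * exp (- (t * v))) p z) y (g v * (h y * exp (- (y * v))))).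
  { intros y v Hy. apply (is_derive_scal (fun z => RInt (fun t => h t * exp (- (t * v))) p z) y (g v)).
    apply (inI_derive_RInt 0 p_infty (fun t => h t * exp (- (t * v))));
      [intros x Hx; apply Cg; now apply I2| |]; apply I1; lra. }
  assert (Lpos : forall y, 0 < y -> locally y (fun z => 0 < z)).
  { intros y Hy. apply (open_gt 0 y Hy). }
  assert (D1 : forall y, 0 < y -> is_derive F1 y (h y * RInt (fun v => g v * exp (- (v * y))) p q)).
  { intros y Hy. eapply der_eq; [|unfold F1; apply is_derive_RInt_param].
    - rewrite <- (RInt_scal (V := R_CompleteNormedModule)).
      + apply RInt_ext. intros v _. replace (Derive _ y) with (g v * (h y * exp (- (y * v)))) by (symmetry; apply is_derive_unique, Din; easy).
        unfold scal; simpl; unfold mult; simpl. rewrite (Rmult_comm v y). ring.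
      + apply (ex_RInt_continuous (V := R_CompleteNormedModule)). intros z Hz.
        rewrite Rmin_left in Hz by lra. apply cont_mult; [apply Hg; lra|].
        apply (cont_derive (fun t => exp (- (t * y)))). auto_derive. easy.
    - apply filter_imp with (2 := Lpos y Hy). intros z Hz t _. eexists. now apply Din.
    - intros t Ht. rewrite Rmin_left in Ht by lra.
      apply (continuity_2d_pt_ext_loc (fun u v => h u * g v * exp (- (u * v)))).
      + exists (mkposreal _ Hy). intros u v Hu _. simpl in Hu. apply Rabs_def2 in Hu.
        replace (Derive _ u) with (g v * (h u * exp (- (u * v)))) by (symmetry; apply is_derive_unique, Din; lra). ring.
      + apply continuity_2d_laplace; [auto|]. apply Hg. lra.
    - apply filter_imp with (2 := Lpos y Hy). intros z Hz.
      apply (ex_RInt_continuous (V := R_CompleteNormedModule)). intros v Hv.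
      rewrite Rmin_left in Hv by lra. apply cont_mult; [apply Hg; lra|].
      apply laplace_RInt_cont; auto; lra. }
  assert (E : F1 q - F2 q = F1 p - F2 p).
  { destruct Hpq as [H0 [Hlt| <-]]; [|easy].
    symmetry. apply (eq_is_derive (V := R_NormedModule) (fun y => F1 y - F2 y)); [|easy].
    intros t Ht. eapply der_eq; [|apply der_minus; [apply D1|apply D2]; lra]. 
    unfold zero; simpl. ring. }
  assert (F2 p = 0) by apply (RInt_point (V := R_CompleteNormedModule)).
  assert (F1 p = 0).
  { unfold F1. rewrite (RInt_ext _ (fun _ => 0)).
    - rewrite (RInt_const (V := R_CompleteNormedModule)). unfold scal; simpl; unfold mult; simpl. ring.
    - intros v _. rewrite (RInt_point (V := R_CompleteNormedModule)). unfold zero; simpl. ring. }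
  fold (F1 q). fold (F2 q). lra.
Qed.

Lemma nint_pos_ge0 D d : nint 0 p_infty D d -> (forall x, 0 < x -> 0 <= D x) -> 0 <= d.
Proof.
  intros H P. eapply nint_ge0; [exact (I : Rbar_lt 0 p_infty)| |exact H].
  intros x Hx. now apply P, pos_inI.
Qed.

Lemma nint_pos_RInt_le D d p q : nint 0 p_infty D d -> (forall x, 0 < x -> 0 <= D x) ->
  0 < p <= q -> RInt D p q <= d.
Proof.
  intros H P Hpq. assert (0 <= d - RInt D p q); [|lra].
  eapply Rle_trans; [apply Rabs_pos|].
  apply (nint_tail 0 p_infty D D d d p q H H); try apply inI_pos; try lra.
  intros x Hx. rewrite Rabs_right; [lra|]. apply Rle_ge, P, pos_inI, Hx.
Qed.

Lemma laplace_dominated (g h D1 D2 H : R -> R) d2 :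
  nint 0 p_infty D2 d2 ->
  (forall v t, 0 < v -> 0 < t -> Rabs (g v * (h t * exp (- (t * v)))) <= D1 v * D2 t) ->
  (forall v, 0 < v -> nint 0 p_infty (fun t => h t * exp (- (t * v))) (H v)) ->
  forall v, 0 < v -> Rabs (g v * H v) <= d2 * D1 v.
Proof.
  intros I2 Hb HH v Hv. rewrite (Rmult_comm d2).
  eapply nint_abs_le; [exact (I : Rbar_lt 0 p_infty)| |apply nint_scal, HH, Hv|
    apply (nint_scal 0 p_infty (D1 v)) in I2; exact I2].
  intros t Ht. apply Hb; [easy|now apply pos_inI].
Qed.

(** Cutting the double integral down to the square [[p, q]] x [[p, q]] costs at most [e * d2] for
    the outer truncation and [e * d1] for the inner one. *)
Lemma laplace_tail (g h D1 D2 H : R -> R) d1 d2 l p q e :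
  (forall x, 0 < x -> continuous g x) -> (forall x, 0 < x -> continuous h x) ->
  (forall x, 0 < x -> continuous H x) ->
  nint 0 p_infty D1 d1 -> nint 0 p_infty D2 d2 ->
  (forall x, 0 < x -> 0 <= D1 x) -> (forall x, 0 < x -> 0 <= D2 x) ->
  (forall v t, 0 < v -> 0 < t -> Rabs (g v * (h t * exp (- (t * v)))) <= D1 v * D2 t) ->
  (forall v, 0 < v -> nint 0 p_infty (fun t => h t * exp (- (t * v))) (H v)) ->
  nint 0 p_infty (fun v => g v * H v) l ->
  0 < p <= q -> d1 - RInt D1 p q <= e -> d2 - RInt D2 p q <= e ->
  Rabs (l - RInt (fun v => g v * RInt (fun t => h t * exp (- (t * v))) p q) p q) <= e * (d1 + d2).
Proof.
  intros Cg Ch CH I1 I2 P1 P2 Hb HH Hl Hpq He1 He2.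
  assert (Ip : inI 0 p_infty p) by (apply inI_pos; lra).
  assert (Iq : inI 0 p_infty q) by (apply inI_pos; lra).
  pose proof (nint_pos_ge0 D1 d1 I1 P1). pose proof (nint_pos_ge0 D2 d2 I2 P2).
  pose proof (laplace_dominated g h D1 D2 H d2 I2 Hb HH) as B1.
  assert (B2 : forall v, 0 < v -> Rabs (g v * H v - g v * RInt (fun t => h t * exp (- (t * v))) p q)
    <= e * D1 v).
  { intros v Hv.
    assert (Ct : forall t, 0 < t -> continuous (fun t => h t * exp (- (t * v))) t).
    { intros t Ht. apply cont_mult; [auto|].
      apply (cont_derive (fun t => exp (- (t * v)))). auto_derive. easy. }
    assert (X1 : ex_RInt (fun t => h t * exp (- (t * v))) p q).
    { apply inI_ex_RInt with 0 p_infty; auto. intros t Ht. now apply Ct, pos_inI. }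
    assert (X2 : ex_RInt D2 p q).
    { apply inI_ex_RInt with 0 p_infty; auto. apply I2. }
    pose proof (nint_tail 0 p_infty (fun t => g v * (h t * exp (- (t * v)))) (fun t => D1 v * D2 t)
      (g v * H v) (D1 v * d2) p q (nint_scal _ _ _ _ _ (HH v Hv)) (nint_scal _ _ _ _ _ I2)) as T.
    rewrite (RInt_scal (V := R_CompleteNormedModule) (fun t => h t * exp (- (t * v)))) in T by easy.
    rewrite (RInt_scal (V := R_CompleteNormedModule) D2) in T by easy.
    unfold scal in T; simpl in T; unfold mult in T; simpl in T.
    eapply Rle_trans; [apply T; auto; try apply Hpq|].
    - intros t Ht. apply inI_0_infty in Ht. apply Hb; easy.
    - pose proof (P1 v Hv). nra. }
  assert (X1 : ex_RInt D1 p q).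
  { apply inI_ex_RInt with 0 p_infty; auto. apply I1. }
  assert (X2 : ex_RInt (fun v => g v * H v) p q).
  { apply inI_ex_RInt with 0 p_infty; auto. intros x Hx. apply inI_0_infty in Hx. apply cont_mult; auto. }
  assert (X3 : ex_RInt (fun v => g v * RInt (fun t => h t * exp (- (t * v))) p q) p q).
  { apply inI_ex_RInt with 0 p_infty; auto. intros x Hx. apply inI_0_infty in Hx. apply cont_mult; auto.
    apply laplace_RInt_cont; auto; lra. }
  pose proof (nint_tail 0 p_infty (fun v => g v * H v) (fun v => d2 * D1 v) l (d2 * d1) p q
    Hl (nint_scal _ _ _ _ _ I1)) as T1.
  rewrite (RInt_scal (V := R_CompleteNormedModule) D1) in T1 by easy.
  unfold scal in T1; simpl in T1; unfold mult in T1; simpl in T1.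
  specialize (T1 ltac:(intros x Hx; apply inI_0_infty in Hx; auto) Ip Iq (proj2 Hpq)).
  assert (T2 : Rabs (RInt (fun v => g v * H v) p q -
     RInt (fun v => g v * RInt (fun t => h t * exp (- (t * v))) p q) p q) <= e * RInt D1 p q).
  { pose proof (RInt_minus (V := R_CompleteNormedModule) _ _ p q X2 X3) as R1.
    pose proof (RInt_scal (V := R_CompleteNormedModule) D1 p q e X1) as R2.
    unfold minus, plus, opp in R1; simpl in R1. unfold scal in R2; simpl in R2.
    unfold mult in R2; simpl in R2. unfold Rminus at 1. rewrite <- R1, <- R2.
    eapply Rle_trans; [apply abs_RInt_le; [apply Hpq|]|].
    - now apply (ex_RInt_minus (V := R_NormedModule) (fun v => g v * H v)).
    - apply RInt_le; [apply Hpq| | |].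
      + apply (ex_RInt_norm (fun v => g v * H v + - (g v * RInt (fun t => h t * exp (- (t * v))) p q))).
        now apply (ex_RInt_minus (V := R_NormedModule) (fun v => g v * H v)).
      + now apply (ex_RInt_scal (V := R_NormedModule) D1).
      + intros x Hx. apply B2. lra. }
  pose proof (nint_pos_RInt_le D1 d1 p q I1 P1 Hpq).
  assert (E0 : 0 <= e) by lra.
  set (r := RInt (fun v => g v * RInt (fun t => h t * exp (- (t * v))) p q) p q) in *.
  replace (l - r) with ((l - RInt (fun v => g v * H v) p q) + (RInt (fun v => g v * H v) p q - r)) by ring.
  eapply Rle_trans; [apply Rabs_triang|]. nra.
Qed.

(** A product dominator [D1 v * D2 t] treats the two variables symmetrically: each iterated integral
    exists by comparison, and each is close to its own iterated integral over the same large square,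
    where the order may be exchanged. *)
Lemma laplace_fubini_R (g h D1 D2 H G : R -> R) d1 d2 :
  (forall x, 0 < x -> continuous g x) -> (forall x, 0 < x -> continuous h x) ->
  (forall x, 0 < x -> continuous H x) -> (forall x, 0 < x -> continuous G x) ->
  nint 0 p_infty D1 d1 -> nint 0 p_infty D2 d2 ->
  (forall x, 0 < x -> 0 <= D1 x) -> (forall x, 0 < x -> 0 <= D2 x) ->
  (forall v t, 0 < v -> 0 < t -> Rabs (g v * (h t * exp (- (t * v)))) <= D1 v * D2 t) ->
  (forall v, 0 < v -> nint 0 p_infty (fun t => h t * exp (- (t * v))) (H v)) ->
  (forall t, 0 < t -> nint 0 p_infty (fun v => g v * exp (- (v * t))) (G t)) ->
  exists l, nint 0 p_infty (fun v => g v * H v) l /\ nint 0 p_infty (fun t => h t * G t) l.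
Proof.
  intros Cg Ch CH CG I1 I2 P1 P2 Hb HH HG.
  assert (Hb' : forall t v, 0 < t -> 0 < v -> Rabs (h t * (g v * exp (- (v * t)))) <= D2 t * D1 v).
  { intros t v Ht Hv. rewrite (Rmult_comm v t), (Rmult_comm (D2 t)).
    replace (h t * (g v * exp (- (t * v)))) with (g v * (h t * exp (- (t * v)))) by ring. auto. }
  destruct (nint_dominated 0 p_infty (fun v => g v * H v) (fun v => d2 * D1 v) (d2 * d1)) as [l1 L1].
  { easy. } { intros x Hx. apply inI_0_infty in Hx. apply cont_mult; auto. }
  { intros x Hx. apply inI_0_infty in Hx. now apply (laplace_dominated g h D1 D2 H d2). }
  { now apply nint_scal. }
  destruct (nint_dominated 0 p_infty (fun v => h v * G v) (fun v => d1 * D2 v) (d1 * d2)) as [l2 L2].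
  { easy. } { intros x Hx. apply inI_0_infty in Hx. apply cont_mult; auto. }
  { intros x Hx. apply inI_0_infty in Hx. now apply (laplace_dominated h g D2 D1 G d1). }
  { now apply nint_scal. }
  replace l2 with l1 in L2; [now exists l1|].
  pose proof (nint_pos_ge0 D1 d1 I1 P1). pose proof (nint_pos_ge0 D2 d2 I2 P2).
  apply cond_eq. intros e He.
  (* Two errors of size [e' * (d1 + d2)] have to stay below [e]; the 1 keeps the denominator
     positive. *)
  set (e' := e / (2 * (d1 + d2 + 1))).
  assert (He' : 0 < e') by (apply Rdiv_lt_0_compat; lra).
  destruct (nint_exhaust 0 p_infty D1 d1 I I1 e' He') as [u1 [v1 [U1 [V1 [_ T1]]]]].
  destruct (nint_exhaust 0 p_infty D2 d2 I I2 e' He') as [u2 [v2 [U2 [V2 [_ T2]]]]].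
  apply inI_0_infty in U1, U2, V1, V2.
  set (p := Rmin u1 u2). set (q := Rmax p (Rmax v1 v2)).
  assert (p <= u1) by apply Rmin_l. assert (p <= u2) by apply Rmin_r.
  assert (0 < p) by (apply Rmin_glb_lt; lra).
  assert (p <= q) by apply Rmax_l.
  assert (v1 <= q) by (eapply Rle_trans; [apply Rmax_l|apply Rmax_r]).
  assert (v2 <= q) by (eapply Rle_trans; [apply Rmax_r|apply Rmax_r]).
  specialize (T1 p q). specialize (T2 p q). rewrite !inI_0_infty in T1, T2.
  specialize (T1 ltac:(lra) ltac:(lra) ltac:(lra) ltac:(lra)).
  specialize (T2 ltac:(lra) ltac:(lra) ltac:(lra) ltac:(lra)).
  apply Rabs_def2 in T1. apply Rabs_def2 in T2.
  pose proof (laplace_tail g h D1 D2 H d1 d2 l1 p q e' Cg Ch CH I1 I2 P1 P2 Hb HH L1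
    ltac:(lra) ltac:(lra) ltac:(lra)) as A.
  pose proof (laplace_tail h g D2 D1 G d2 d1 l2 p q e' Ch Cg CG I2 I1 P2 P1 Hb' HG L2
    ltac:(lra) ltac:(lra) ltac:(lra)) as B.
  rewrite <- laplace_fubini_compact in B by (auto; lra).
  apply Rabs_le_between in A. apply Rabs_le_between in B.
  assert (2 * (e' * (d1 + d2)) < e).
  { replace e with (2 * (e' * (d1 + d2 + 1))) by (unfold e'; field; lra). nra. }
  apply Rabs_def1; nra.
Qed.

Lemma laplace_fubini (g h H G : R -> Cx) (D1 D2 : R -> R) d1 d2 :
  (forall x, 0 < x -> ccont g x) -> (forall x, 0 < x -> ccont h x) ->
  (forall x, 0 < x -> ccont H x) -> (forall x, 0 < x -> ccont G x) ->
  nint 0 p_infty D1 d1 -> nint 0 p_infty D2 d2 ->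
  (forall x, 0 < x -> 0 <= D1 x) -> (forall x, 0 < x -> 0 <= D2 x) ->
  (forall v t, 0 < v -> 0 < t -> Cmod (g v) * Cmod (h t) * exp (- (t * v)) <= D1 v * D2 t) ->
  (forall v, 0 < v -> cint 0 p_infty (fun t => Cmul (h t) (RtoC (exp (- (t * v))))) (H v)) ->
  (forall t, 0 < t -> cint 0 p_infty (fun v => Cmul (g v) (RtoC (exp (- (v * t))))) (G t)) ->
  exists l, cint 0 p_infty (fun v => Cmul (g v) (H v)) l /\
            cint 0 p_infty (fun t => Cmul (h t) (G t)) l.
Proof.
  intros Cg Ch CH CG I1 I2 P1 P2 Hb HH HG.
  (* What the two coordinate maps have in common. The complex product mixes components, so four real
     exchanges are needed, and this abstraction proves them at once. *)
  set (proj := fun p : Cx -> R => (forall z, Rabs (p z) <= Cmod z) /\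
    (forall z r, p (Cmul z (RtoC r)) = p z * r) /\
    (forall f x, ccont f x -> continuous (fun t => p (f t)) x) /\
    (forall f l, cint 0 p_infty f l -> nint 0 p_infty (fun t => p (f t)) (p l))).
  assert (Pf : proj (@fst R R)).
  { split; [exact Cmod_fst|]. split; [intros; simpl; ring|]. split; intros ? ? X; apply X. }
  assert (Ps : proj (@snd R R)).
  { split; [exact Cmod_snd|]. split; [intros; simpl; ring|]. split; intros ? ? X; apply X. }
  assert (W : forall p r, proj p -> proj r -> exists l,
    nint 0 p_infty (fun v => p (g v) * r (H v)) l /\ nint 0 p_infty (fun t => r (h t) * p (G t)) l).
  { intros p r [p1 [p2 [p3 p4]]] [r1 [r2 [r3 r4]]].
    apply (laplace_fubini_R (fun x => p (g x)) (fun x => r (h x)) D1 D2 (fun x => r (H x))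
      (fun x => p (G x)) d1 d2); auto.
    - intros v t Hv Ht. eapply Rle_trans; [|now apply Hb].
      rewrite !Rabs_mult, Rabs_exp, <- Rmult_assoc. apply Rmult_le_compat_r; [left; apply exp_pos|].
      apply Rmult_le_compat; try apply Rabs_pos; auto.
    - intros v Hv. apply nint_ext with (2 := r4 _ _ (HH v Hv)). intros. apply r2.
    - intros t Ht. apply nint_ext with (2 := p4 _ _ (HG t Ht)). intros. apply p2. }
  destruct (W _ _ Pf Pf) as [l1 [L1 M1]]. destruct (W _ _ Ps Ps) as [l2 [L2 M2]].
  destruct (W _ _ Pf Ps) as [l3 [L3 M3]]. destruct (W _ _ Ps Pf) as [l4 [L4 M4]].
  exists (l1 - l2, l3 + l4). split; split; simpl.
  - now apply nint_minus.
  - now apply nint_plus.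
  - now apply nint_minus.
  - rewrite Rplus_comm. now apply nint_plus.
Qed.

(** * The Beta integral *)

(** Separates the variables of the kernel, as the exchange requires. The exponential is at most C (1
    + tv)^(-p), and 1 + v <= (1 + tv)(1 + t)/t trades this decay in tv for decay in v at the price
    of a factor depending on t. *)
Lemma laplace_kernel_bound p : 0 <= p -> exists C, 0 < C /\ forall v t, 0 < v -> 0 < t ->
  exp (- (t * v)) <= C * exp (- (p * ln (1 + v))) * exp (p * (ln (1 + t) - ln t)).
Proof.
  intros Hp. destruct (poly_exp_bound p 1) as [C [C0 HC]]; [lra|].
  exists C. split; [easy|]. intros v t Hv Ht.
  specialize (HC (t * v) ltac:(nra)). rewrite Rmult_1_l in HC.
  assert (L : ln (1 + v) <= ln (1 + t * v) + (ln (1 + t) - ln t)).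
  { rewrite <- ln_div by lra. rewrite <- ln_mult; [|nra|apply Rdiv_lt_0_compat; lra].
    apply ln_le; [lra|]. apply Rmult_le_reg_r with t; [easy|].
    replace ((1 + t * v) * ((1 + t) / t) * t) with ((1 + t * v) * (1 + t)) by (field; lra). nra. }
  rewrite Rmult_assoc, <- exp_plus.
  assert (E : exp (- (p * ln (1 + t * v))) <= exp (- (p * ln (1 + v)) + p * (ln (1 + t) - ln t))).
  { apply exp_le_exp. nra. }
  assert (E2 : exp (- (t * v)) <= C * exp (- (p * ln (1 + t * v)))).
  { rewrite (exp_Ropp (p * _)). apply -> Rle_div_r; [lra|apply exp_pos]. }
  pose proof (exp_pos (- (p * ln (1 + t * v)))). nra.
Qed.

(* Exchange of integrals in int int v^(a-1) h(t) e^(-tv): the inner v-integral is Gamma(a) t^(-a). *)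
Lemma mellin_laplace (a : Cx) (h H : R -> Cx) s C : 0 < fst a -> 0 < s -> 0 < C ->
  (forall x, 0 < x -> ccont h x) -> (forall x, 0 < x -> ccont H x) ->
  (forall t, 0 < t -> Cmod (h t) * exp ((fst a + 1) * (ln (1 + t) - ln t)) <=
     C * (exp ((s - 1) * ln t) * exp (- ((s + 1) * ln (1 + t))))) ->
  (forall v, 0 < v -> cint 0 p_infty (fun t => Cmul (h t) (RtoC (exp (- (t * v))))) (H v)) ->
  exists l, cint 0 p_infty (fun v => Cmul (Cpow v (Csub a Cone)) (H v)) l /\
    cint 0 p_infty (fun t => Cmul (h t) (Cmul (CGamma a) (Cpow t (Copp a)))) l.
Proof.
  intros Ha Hs HC0 Ch CH Hh HH.
  destruct (laplace_kernel_bound (fst a + 1)) as [C1 [C10 HC1]]; [lra|].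
  apply (laplace_fubini (fun v => Cpow v (Csub a Cone)) h H
    (fun t => Cmul (CGamma a) (Cpow t (Copp a)))
    (fun v => exp ((fst a - 1) * ln v) * exp (- ((fst a + 1) * ln (1 + v))))
    (fun t => C1 * C * (exp ((s - 1) * ln t) * exp (- ((s + 1) * ln (1 + t)))))
    (/ fst a) (C1 * C * / s)); auto.
  - intros x Hx. now apply ccont_Cpow.
  - intros x Hx. apply ccont_mul; [apply ccont_const|now apply ccont_Cpow].
  - now apply mellin_dominator.
  - now apply nint_scal, mellin_dominator.
  - intros. left. apply Rmult_lt_0_compat; apply exp_pos.
  - intros. left. repeat apply Rmult_lt_0_compat; try apply exp_pos; easy.
  - intros v t Hv Ht. rewrite Cmod_Cpow. cbn [fst Csub Cadd Copp Cone].
    replace (fst a + - (1)) with (fst a - 1) by ring.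
    specialize (HC1 v t Hv Ht). specialize (Hh t Ht). pose proof (Cmod_ge0 (h t)) as M.
    set (x1 := exp ((fst a - 1) * ln v)) in *.
    set (x2 := exp (- ((fst a + 1) * ln (1 + v)))) in *.
    assert (0 < x1) by apply exp_pos. assert (0 < x2) by apply exp_pos.
    apply Rle_trans with (x1 * Cmod (h t) * (C1 * x2 * exp ((fst a + 1) * (ln (1 + t) - ln t)))).
    { apply Rmult_le_compat_l; [|easy]. apply Rmult_le_pos; lra. }
    replace (x1 * Cmod (h t) * (C1 * x2 * exp ((fst a + 1) * (ln (1 + t) - ln t)))) with
      (x1 * x2 * C1 * (Cmod (h t) * exp ((fst a + 1) * (ln (1 + t) - ln t)))) by ring.
    match goal with |- _ <= ?r => replace r with
      (x1 * x2 * C1 * (C * (exp ((s - 1) * ln t) * exp (- ((s + 1) * ln (1 + t)))))) by ring end.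
    apply Rmult_le_compat_l; [|easy]. repeat apply Rmult_le_pos; lra.
  - intros t Ht. apply cint_ext with (2 := gamma_scaled a t Ha Ht).
    intros v _. now rewrite (Rmult_comm v t).
Qed.

Lemma RtoC_exp_ln r : 0 < r -> RtoC r = Cexp (RtoC (ln r)).
Proof. intros H. now rewrite Cexp_RtoC, exp_ln. Qed.

Lemma cint_fold_half c f L : 0 < c -> cint 0 c f L ->
  cint 0 (c / 2) (fun t => Cadd (f t) (f (c - t))) L.
Proof. intros Hc [H1 H2]. split; now apply nint_fold_half. Qed.

Lemma inI_half_PI x : inI 0 (PI / 2) x -> 0 < x < PI / 2 /\ 0 < sin x /\ 0 < cos x.
Proof.
  intros [H1 H2]. simpl in *. pose proof PI_RGT_0. split; [easy|]. split.
  - apply sin_gt_0; lra.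
  - apply cos_gt_0; lra.
Qed.

Lemma filterlim_tan_sqr :
  filterlim (fun t => (sin t / cos t) ^ 2) (endR (PI / 2)) (Rbar_locally p_infty).
Proof.
  pose proof PI_RGT_0 as HPI.
  assert (HP : Rbar_lt 0 (PI / 2)) by (simpl; lra).
  intros P [M HM].
  assert (W : locally (PI / 2) (fun t => Rabs (cos t) < / (Rabs M + 2))).
  { assert (Q : 0 < / (Rabs M + 2)) by (apply Rinv_0_lt_compat; pose proof (Rabs_pos M); lra).
    pose proof (cont_derive cos (PI / 2) ltac:(auto_derive; easy)) as K.
    pose proof (proj1 (filterlim_locally cos (cos (PI / 2))) K (mkposreal _ Q)) as K2.
    apply filter_imp with (2 := K2). intros x Hx.
    unfold_ball in Hx.
    rewrite cos_PI2 in Hx. now replace (cos x + - 0) with (cos x) in Hx by ring. }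
  pose proof (filter_le_within (F := locally (PI / 2)) (fun x => Rbar_lt x (PI / 2)) _ W) as W2.
  apply filter_imp with (2 := filter_and (F := endR (PI / 2)) _ _ W2 (endR_inI 0 (PI / 2) HP)).
  intros x [H1 H2]. apply HM. destruct (inI_half_PI x H2) as [_ [Hs Hc]].
  rewrite Rabs_right in H1 by lra.
  replace ((sin x / cos x) ^ 2) with ((/ cos x) ^ 2 - 1).
  2: { field_simplify; [|lra|lra]. f_equal. rewrite sin2_cos2_pow. ring. }
  assert (H3 : Rabs M + 2 < / cos x).
  { rewrite <- (Rinv_inv (Rabs M + 2)). apply Rinv_lt_contravar; [|easy].
    apply Rmult_lt_0_compat; [easy|]. apply Rinv_0_lt_compat. pose proof (Rabs_pos M); lra. }
  pose proof (Rle_abs M). pose proof (Rabs_pos M). nra.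
Qed.

(** Equal to the square root of pi, but kept abstract: only its square is evaluated. *)
Definition gamma_half : Cx := CGamma (RtoC (1 / 2)).

Lemma gamma_half_neq0 : gamma_half <> Czero.
Proof. apply CGamma_neq0. simpl. lra. Qed.

Lemma CGamma_half_neq0 (mu : Cx) : -1 < fst mu -> CGamma (Chalf (Cadd mu Cone)) <> Czero.
Proof. intros H. apply CGamma_neq0. unfold Chalf; cbn [fst snd Cmul Cadd RtoC Cone]. lra. Qed.

(* Exchange of integrals in int int v^(a-1) t^(a+1/2) e^(-t(1+v)), with a = (mu+1)/2 and
   v = tan^2 theta; the exponent b = 3/2 rather than 1/2 keeps the v-tail integrable
   against the available dominating function. *)
Lemma beta_identity_2 (mu : Cx) : -1 < fst mu ->
  Cmul (CGamma (Cadd (Chalf (Cadd mu Cone)) (RtoC (3 / 2)))) (trig_moment mu 2) =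
  Cmul (CGamma (Chalf (Cadd mu Cone))) (CGamma (RtoC (3 / 2))).
Proof.
  intros Hm. set (a := Chalf (Cadd mu Cone)).
  assert (Ea : fst a = (fst mu + 1) / 2) by (unfold a; simpl; field).
  assert (Ha : 0 < fst a) by lra.
  set (b := Cadd a (RtoC (3 / 2))).
  assert (Eb : fst b = fst a + 3 / 2) by easy.
  assert (Hb : 0 < fst b) by lra.
  (* After the factor ((1+t)/t)^(a+1) of the kernel bound, t^(-1/2) remains at 0, so the dominator
     has s = 1/2; e^(-t) must absorb (1+t)^(a+1) and still leave (1+t)^(-3/2). *)
  destruct (poly_exp_bound (fst a + 1 + 3 / 2) 1) as [C [C0 HC]]; [lra|].
  destruct (mellin_laplace a (fun t => Cmul (Cpow t (Csub b Cone)) (RtoC (exp (- t))))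
    (fun v => Cmul (CGamma b) (Cpow (1 + v) (Copp b))) (1 / 2) C) as [l [L1 L2]]; try lra.
  - intros x Hx. apply ccont_mul; [now apply ccont_Cpow|].
    apply ccont_RtoC, cont_derive. auto_derive. easy.
  - intros x Hx. apply ccont_mul; [apply ccont_const|].
    apply (ccont_comp (fun r => Cpow r (Copp b)) (fun v => 1 + v)).
    + apply cont_derive. auto_derive. easy.
    + apply ccont_Cpow. lra.
  - intros t Ht. rewrite Cmod_mul, Cmod_Cpow, Cmod_RtoC, Rabs_exp.
    cbn [fst Csub Cadd Copp Cone b RtoC]. specialize (HC t ltac:(lra)).
    apply (Rmult_le_compat_r (exp ((1 / 2 - 1) * ln t) * exp (- ((1 / 2 + 1) * ln (1 + t))))) in HC;
      [|left; apply Rmult_lt_0_compat; apply exp_pos].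
    eapply Rle_trans; [|exact HC]. right. rewrite <- !exp_plus. f_equal. field.
  - intros v Hv. apply cint_ext with (2 := gamma_scaled b (1 + v) Hb ltac:(lra)).
    intros t _. replace (- ((1 + v) * t)) with (- t + - (t * v)) by ring.
    rewrite exp_plus, RtoC_mul. ring.
  - assert (E2 : l = Cmul (CGamma a) (CGamma (RtoC (3 / 2)))).
    { apply cint_unique with (1 := I : Rbar_lt 0 p_infty) (2 := L2).
      assert (H32 : 0 < fst (RtoC (3 / 2))) by (simpl; lra).
      apply cint_ext with (2 := cint_scal _ _ (CGamma a) _ _ (CGamma_cint _ H32)).
      intros t Ht. cbv beta.
      replace (Csub b Cone) with (Cadd a (Csub (RtoC (3 / 2)) Cone)) by (unfold b; ring).
      rewrite (Cpow_add t a), Cpow_opp. field. apply Cpow_neq0. }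
    rewrite <- E2. clear E2 L2.
    pose proof PI_RGT_0 as HPI. assert (HP : Rbar_lt 0 (PI / 2)) by (simpl; lra).
    assert (S := cint_subst 0 (PI / 2) 0 p_infty (fun t => (sin t / cos t) ^ 2)
      (fun t => 2 * sin t / cos t ^ 3)
      (fun v => Cmul (Cpow v (Csub a Cone)) (Cmul (CGamma b) (Cpow (1 + v) (Copp b)))) l HP I).
    eapply S in L1; clear S.
    (* Folding at PI/2 restricts to an interval where tan^2 is increasing; cos^2 sin^mu is invariant
       under the reflection, so its integrand doubles. *)
    + pose proof (cint_fold_half PI _ _ HPI (trig_moment_cint mu 2 Hm)) as F.
      apply (cint_scal _ _ (CGamma b)) in F.
      apply cint_unique with (1 := HP) (2 := F). apply cint_ext with (2 := L1).
      intros t Ht. cbv beta. destruct (inI_half_PI t Ht) as [Ht0 [Hs Hc]].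
      unfold trig_int. rewrite sin_PI_x, Rtrigo_facts.cos_pi_minus.
      replace (1 + (sin t / cos t) ^ 2) with (/ cos t * / cos t).
      2: { field_simplify; [|lra|lra]. f_equal. rewrite sin2_cos2_pow. ring. }
      replace ((- cos t) ^ 2) with (cos t ^ 2) by ring.
      replace ((sin t / cos t) ^ 2) with (sin t * sin t * (/ cos t * / cos t)) by (field; lra).
      assert (0 < / cos t) by now apply Rinv_0_lt_compat.
      rewrite !Cpow_mul, !(Cpow_inv (cos t)), <- !Cpow_opp by nra.
      replace (2 * sin t / cos t ^ 3) with (2 * (sin t * / cos t * / cos t * / cos t)) by (field; lra).
      replace (cos t ^ 2) with (cos t * cos t) by ring.
      (* Every factor becomes an exponential in ln(sin t) and ln(cos t), so that comparing the two
         integrands reduces to a linear identity between exponents. *)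
      rewrite !RtoC_mul, !RtoC_inv, !(RtoC_exp_ln (sin t)), !(RtoC_exp_ln (cos t)) by lra.
      assert (Cinv_exp : forall z, Cinv (Cexp z) = Cexp (Copp z)).
      { intros z. pose proof (Cexp_neq0 z).
        replace (Cexp (Copp z)) with (Cmul (Cmul (Cexp (Copp z)) (Cexp z)) (Cinv (Cexp z))) by now field.
        rewrite <- Cexp_add. replace (Cadd (Copp z) z) with Czero by ring. rewrite Cexp_0. ring. }
      rewrite !Cinv_exp. unfold Cpow.
      transitivity (Cmul (CGamma b) (Cmul (RtoC 2) (Cexp (Cadd (Cmul mu (RtoC (ln (sin t))))
        (Cadd (RtoC (ln (cos t))) (RtoC (ln (cos t)))))))).
      2: { rewrite !Cexp_add. apply Cx_ext; simpl; ring. }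
      transitivity (Cmul (CGamma b) (Cmul (RtoC 2)
        (Cexp (Cadd (Cadd (Cadd (RtoC (ln (sin t))) (Copp (RtoC (ln (cos t)))))
           (Cadd (Copp (RtoC (ln (cos t)))) (Copp (RtoC (ln (cos t))))))
          (Cadd (Cadd (Cadd (Cmul (Csub a Cone) (RtoC (ln (sin t)))) (Cmul (Csub a Cone) (RtoC (ln (sin t)))))
             (Cadd (Cmul (Copp (Csub a Cone)) (RtoC (ln (cos t)))) (Cmul (Copp (Csub a Cone)) (RtoC (ln (cos t))))))
            (Cadd (Cmul (Copp (Copp b)) (RtoC (ln (cos t)))) (Cmul (Copp (Copp b)) (RtoC (ln (cos t)))))))))).
      { rewrite !Cexp_add. ring. }
      do 3 f_equal. unfold b, a, Chalf. apply Cx_ext; simpl; field.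
    + intros t Ht. destruct (inI_half_PI t Ht) as [Ht0 [Hs Hc]]. apply inI_pos.
      apply pow_lt, Rdiv_lt_0_compat; easy.
    + intros t Ht. destruct (inI_half_PI t Ht) as [Ht0 [Hs Hc]]. auto_derive; [lra|].
      pose proof (sin2_cos2_pow t) as Q. field_simplify; [|lra|lra].
      replace (sin t ^ 3) with (sin t * sin t ^ 2) by ring. rewrite Q. field. lra.
    + intros t Ht. destruct (inI_half_PI t Ht) as [Ht0 [Hs Hc]]. apply cont_derive. auto_derive.
      assert (0 < cos t ^ 3) by now apply pow_lt. simpl in *. lra.
    + apply (filterlim_endL 0).
      replace (Rbar_locally 0) with (locally ((sin 0 / cos 0) ^ 2)).
      2: { rewrite sin_0. unfold Rdiv. rewrite Rmult_0_l, pow_i by lia. easy. }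
      apply (cont_derive (fun t => (sin t / cos t) ^ 2) 0). auto_derive. rewrite cos_0. lra.
    + apply filterlim_tan_sqr.
Qed.

(** Descends from the second moment to the zeroth: the moment recursion and the functional equation
    of Gamma, applied at 1 + mu/2 and at 1/2, contribute factors that cancel. *)
Lemma beta_identity (mu : Cx) : -1 < fst mu ->
  Cmul (trig_moment mu 0) (CGamma (Cadd Cone (Chalf mu))) =
  Cmul gamma_half (CGamma (Chalf (Cadd mu Cone))).
Proof.
  intros Hm. pose proof (beta_identity_2 mu Hm) as H.
  pose proof (trig_moment_SS mu 0 Hm) as HM. simpl INR in HM.
  assert (H1 : 0 < fst (Cadd Cone (Chalf mu))) by (simpl; lra).
  assert (H2 : 0 < fst (RtoC (1 / 2))) by (simpl; lra).
  replace (Cadd (Chalf (Cadd mu Cone)) (RtoC (3 / 2))) with (Cadd (Cadd Cone (Chalf mu)) Cone) in H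
    by (unfold Chalf; apply Cx_ext; simpl; field).
  replace (RtoC (3 / 2)) with (Cadd (RtoC (1 / 2)) Cone) in H by (apply Cx_ext; simpl; field).
  rewrite !CGamma_S in H by easy. fold gamma_half in H.
  replace (RtoC (0 + 1)) with Cone in HM by (apply Cx_ext; simpl; ring).
  replace (Cadd mu (RtoC (0 + 2))) with (Cmul (RtoC 2) (Cadd Cone (Chalf mu))) in HM
    by (unfold Chalf; apply Cx_ext; simpl; field).
  transitivity (Cmul (CGamma (Cadd Cone (Chalf mu))) (Cmul Cone (trig_moment mu 0))); [ring|].
  rewrite <- HM.
  transitivity (Cmul (RtoC 2) (Cmul (Cmul (Cadd Cone (Chalf mu)) (CGamma (Cadd Cone (Chalf mu)))) (trig_moment mu 2)));
    [ring|].
  rewrite H.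
  transitivity (Cmul (Cmul (RtoC 2) (RtoC (1 / 2))) (Cmul gamma_half (CGamma (Chalf (Cadd mu Cone)))));
    [ring|].
  rewrite <- RtoC_mul. replace (2 * (1 / 2)) with 1 by field. change (RtoC 1) with Cone. ring.
Qed.

(** The Beta identity at mu = 0, where the moment is the length of the interval. *)
Lemma gamma_half_sqr : Cmul gamma_half gamma_half = RtoC PI.
Proof.
  assert (H0 : -1 < fst (RtoC 0)) by (simpl; lra).
  pose proof (beta_identity (RtoC 0) H0) as H.
  rewrite trig_moment_0_0 in H.
  replace (Cadd Cone (Chalf (RtoC 0))) with Cone in H by (unfold Chalf; apply Cx_ext; simpl; field).
  replace (Chalf (Cadd (RtoC 0) Cone)) with (RtoC (1 / 2)) in H by (unfold Chalf; apply Cx_ext; simpl; field).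
  fold gamma_half in H. rewrite CGamma_1 in H. rewrite <- H. ring.
Qed.

(** * The modified Bessel function of the second kind *)

Lemma is_derive_sinh x : is_derive sinh x (cosh x).
Proof. apply is_derive_Reals. apply derivable_pt_lim_sinh. Qed.
Lemma is_derive_cosh x : is_derive cosh x (sinh x).
Proof. apply is_derive_Reals. apply derivable_pt_lim_cosh. Qed.
Lemma cont_sinh x : continuous sinh x.
Proof. apply cont_derive. eexists. apply is_derive_sinh. Qed.
Lemma cont_cosh x : continuous cosh x.
Proof. apply cont_derive. eexists. apply is_derive_cosh. Qed.
Lemma cosh_ge1 x : 1 <= cosh x.
Proof.
  unfold cosh. rewrite exp_Ropp. pose proof (exp_pos x) as H.
  assert (0 <= (exp x - 1) ^ 2 / exp x) by (apply Rdiv_le_0_compat; [apply pow2_ge_0|easy]).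
  replace ((exp x - 1) ^ 2 / exp x) with (exp x + / exp x - 2) in H0 by (field; lra). lra.
Qed.
Lemma sinh_gt0 x : 0 < x -> 0 < sinh x.
Proof. intros H. unfold sinh. assert (exp (- x) < exp x) by (apply exp_increasing; lra). lra. Qed.
Lemma cosh_sqr x : cosh x ^ 2 = 1 + sinh x ^ 2.
Proof. unfold cosh, sinh. rewrite exp_Ropp. pose proof (exp_pos x). field. lra. Qed.
Lemma sinh_le x : 0 <= x -> x <= sinh x.
Proof.
  intros Hx.
  destruct (MVT_gen sinh 0 x cosh) as [c [_ E]].
  - intros. apply is_derive_sinh.
  - intros. eapply derive_continuity_pt, is_derive_sinh.
  - rewrite sinh_0 in E. pose proof (cosh_ge1 c). nra.
Qed.

(** Since t^p <= ((1+t)(1+1/t))^|p|, the factor e^(-ct) can absorb the powers of 1 + t, including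
    the extra q, and e^(-d/t) those of 1 + 1/t. *)
Lemma inv_gauss_bound p c d q : 0 < c -> 0 < d ->
  exists C, 0 < C /\ forall t, 0 < t ->
    exp (p * ln t) * exp (- (c * t) - d / t) <= C * exp (- (q * ln (1 + t))).
Proof.
  intros Hc Hd.
  destruct (poly_exp_bound (Rabs p + q) c Hc) as [C1 [P1 H1]].
  destruct (poly_exp_bound (Rabs p) d Hd) as [C2 [P2 H2]].
  exists (C1 * C2). split; [nra|]. intros t Ht.
  assert (Hi : 0 < / t) by now apply Rinv_0_lt_compat.
  specialize (H1 t ltac:(lra)). specialize (H2 (/ t) ltac:(lra)).
  assert (E : exp (p * ln t) * exp (- (c * t) - d / t) * exp (q * ln (1 + t)) <=
    (exp ((Rabs p + q) * ln (1 + t)) * exp (- (c * t))) * (exp (Rabs p * ln (1 + / t)) * exp (- (d * / t)))).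
  { rewrite <- !exp_plus. apply exp_le_exp.
    assert (p * ln t <= Rabs p * (ln (1 + t) + ln (1 + / t))); [|unfold Rdiv; lra].
    eapply Rle_trans; [apply Rle_abs|]. rewrite Rabs_mult. apply Rmult_le_compat_l; [apply Rabs_pos|].
    assert (0 <= ln (1 + t)) by (rewrite <- ln_1; apply ln_le; lra).
    assert (0 <= ln (1 + / t)) by (rewrite <- ln_1; apply ln_le; lra).
    apply Rabs_le. split.
    - assert (ln (/ t) <= ln (1 + / t)) by (apply ln_le; lra). rewrite ln_Rinv in H3 by easy. lra.
    - assert (ln t <= ln (1 + t)) by (apply ln_le; lra). lra. }
  rewrite (exp_Ropp (q * _)). apply -> Rle_div_r; [|apply exp_pos].
  eapply Rle_trans; [exact E|]. apply Rmult_le_compat; try easy;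
    apply Rmult_le_pos; left; apply exp_pos.
Qed.

(** The unnormalised generalised inverse Gaussian density of index -b. *)
Definition inv_gauss (b : Cx) (c d t : R) : Cx :=
  Cmul (Cpow t (Csub (Copp b) Cone)) (RtoC (exp (- (c * t) - d / t))).

Lemma inv_gauss_cont b c d t : 0 < t -> ccont (inv_gauss b c d) t.
Proof.
  intros Ht. apply ccont_mul; [now apply ccont_Cpow|].
  apply ccont_RtoC, cont_derive. auto_derive. lra.
Qed.

Lemma inv_gauss_ex b c d : 0 < c -> 0 < d -> exists l, cint 0 p_infty (inv_gauss b c d) l.
Proof.
  intros Hc Hd.
  destruct (inv_gauss_bound (- fst b - 1) c d 2 Hc Hd) as [C [_ HC]].
  destruct (mellin_exists Cone (inv_gauss b c d) C) as [l Hl].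
  - simpl; lra.
  - intros v Hv. now apply inv_gauss_cont.
  - intros v Hv. unfold inv_gauss.
    rewrite Cmod_mul, Cmod_Cpow, Cmod_RtoC, Rabs_exp.
    replace (fst (Csub (Copp b) Cone)) with (- fst b - 1) by (simpl; ring).
    replace (fst Cone + 1) with 2 by (simpl; ring). auto.
  - exists l. apply cint_ext with (2 := Hl). intros t _.
    replace (Csub Cone Cone) with Czero by ring. rewrite Cpow_0. ring.
Qed.

Lemma cint_fold_R f L : cint m_infty p_infty f L ->
  cint 0 p_infty (fun t => Cadd (f t) (f (- t))) L.
Proof. intros [H1 H2]. split; now apply nint_fold_R. Qed.

Lemma filterlim_scal_exp k : 0 < k ->
  filterlim (fun t => k * exp t) (endL m_infty) (Rbar_locally 0) /\
  filterlim (fun t => k * exp t) (endR p_infty) (Rbar_locally p_infty).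
Proof.
  intros Hk. split.
  - apply filterlim_locally. intros [e He]. exists (ln (e / k)). intros x Hx _.
    unfold_ball.
    pose proof (exp_pos x). rewrite Rabs_right by nra.
    assert (0 < e / k) by now apply Rdiv_lt_0_compat.
    apply exp_increasing in Hx. rewrite exp_ln in Hx by easy.
    apply Rlt_div_r in Hx; [nra|easy].
  - intros P [M HM]. exists (M / k). intros x Hx _. apply HM.
    apply Rlt_div_l in Hx; [|easy]. pose proof (exp_ineq1_le x). nra.
Qed.

(* Substituting t = (z/2u) e^s turns the inverse Gaussian integral into that of K_b over the whole line. *)
Lemma inv_gauss_cint (b : Cx) (u z : R) : 0 < u -> 0 < z ->
  cint 0 p_infty (inv_gauss b (u ^ 2) (z ^ 2 / 4))
    (Cmul (RtoC 2) (Cmul (Cpow (z / (2 * u)) (Copp b)) (BesselK b (z * u)))).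
Proof.
  intros Hu Hz. set (k := z / (2 * u)).
  assert (Hk : 0 < k) by (apply Rdiv_lt_0_compat; lra).
  destruct (inv_gauss_ex b (u ^ 2) (z ^ 2 / 4)) as [l Hl].
  { now apply pow_lt. } { assert (0 < z ^ 2) by now apply pow_lt. lra. }
  destruct (filterlim_scal_exp k Hk) as [F1 F2].
  assert (S := cint_subst m_infty p_infty 0 p_infty (fun t => k * exp t) (fun t => k * exp t)
    (inv_gauss b (u ^ 2) (z ^ 2 / 4)) l I I
    ltac:(intros; apply inI_pos; apply Rmult_lt_0_compat; [easy|apply exp_pos])
    ltac:(intros; auto_derive; [easy|ring]) ltac:(intros; apply cont_derive; auto_derive; easy)
    F1 F2 Hl).
  apply cint_fold_R in S.
  apply (cint_scal _ _ (Cinv (Cmul (RtoC 2) (Cpow k (Copp b))))) in S.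
  assert (N2 : RtoC 2 <> Czero) by (apply RtoC_neq0; lra).
  assert (NK := Cpow_neq0 k (Copp b)).
  assert (E : BesselK b (z * u) = Cmul (Cinv (Cmul (RtoC 2) (Cpow k (Copp b)))) l).
  { apply CInt_oinf_eq. apply cint_ext with (2 := S). intros t _. cbv beta.
    (* The scale k = z/(2u) balances the two exponents: u^2 k = z^2/(4k) = zu/2, so they combine
       into zu cosh. *)
    assert (W : forall t, Cmul (RtoC (k * exp t)) (inv_gauss b (u ^ 2) (z ^ 2 / 4) (k * exp t)) =
      Cmul (Cpow k (Copp b)) (Cmul (RtoC (exp (- (z * u * cosh t)))) (Cexp (Cmul (Copp b) (RtoC t))))).
    { intros s. pose proof (exp_pos s). assert (Hp : 0 < k * exp s) by nra.
      unfold inv_gauss. 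
      transitivity (Cmul (Cpow (k * exp s) (Copp b)) (RtoC (exp (- (u ^ 2 * (k * exp s)) - z ^ 2 / 4 / (k * exp s))))).
      { rewrite (Cpow_pred _ (Copp b)) by easy. ring. }
      rewrite Cpow_mul, Cpow_exp by easy.
      replace (- (u ^ 2 * (k * exp s)) - z ^ 2 / 4 / (k * exp s)) with (- (z * u * cosh s)); [ring|].
      unfold cosh, k. rewrite exp_Ropp. field. lra. }
    rewrite !W. replace (cosh (- t)) with (cosh t) by (unfold cosh; rewrite Ropp_involutive; field).
    unfold Ccosh, Chalf.
    replace (Cmul (Copp b) (RtoC (- t))) with (Cmul b (RtoC t)) by (apply Cx_ext; simpl; ring).
    replace (Cmul (Copp b) (RtoC t)) with (Copp (Cmul b (RtoC t))) by ring.
    replace (RtoC (1 / 2)) with (Cinv (RtoC 2)) by (rewrite <- RtoC_inv by lra; f_equal; field).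
    field. split; easy. }
  rewrite E. apply cint_eq with (2 := Hl). field. split; easy.
Qed.

(** The substitution z (cosh t - 1) in the integral of Gamma(1/2) works because sinh t divided by
    the square root of cosh t - 1 is a multiple of cosh(t/2), the very factor of K at index 1/2 or
    -1/2. *)
Lemma besselK_half z : 0 < z ->
  BesselK (RtoC (- (1 / 2))) z = Cmul gamma_half (RtoC (exp (- z) * exp (- (1 / 2) * ln (2 * z)))).
Proof.
  intros Hz. assert (H0 : 0 < fst (RtoC (1 / 2))) by (simpl; lra).
  assert (S := cint_subst 0 p_infty 0 p_infty (fun t => z * (cosh t - 1)) (fun t => z * sinh t)
    (fun t => Cmul (Cpow t (Csub (RtoC (1 / 2)) Cone)) (RtoC (exp (- t)))) gamma_half I I).
  assert (HC : forall t, 0 < t -> 1 < cosh t).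
  { intros t Ht. pose proof (sinh_gt0 t Ht). pose proof (cosh_sqr t). pose proof (cosh_ge1 t). nra. }
  pose proof (CGamma_cint _ H0) as Hl.
  eapply S in Hl; clear S.
  - apply (cint_scal _ _ (RtoC (exp (- z) * exp (- (1 / 2) * ln (2 * z))))) in Hl.
    apply CInt_oinf_eq. fold gamma_half in Hl. 
    apply cint_eq with (Cmul (RtoC (exp (- z) * exp (- (1 / 2) * ln (2 * z)))) gamma_half); [ring|].
    apply cint_ext with (2 := Hl). intros t Ht. apply pos_inI in Ht. cbv beta.
    pose proof (HC t Ht).
    replace (Csub (RtoC (1 / 2)) Cone) with (RtoC (- (1 / 2))) by (apply Cx_ext; simpl; field).
    rewrite Cpow_RtoC.
    unfold Ccosh, Chalf.
    replace (Copp (Cmul (RtoC (- (1 / 2))) (RtoC t))) with (RtoC (t / 2)) by (apply Cx_ext; simpl; field).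
    rewrite <- !RtoC_mul. rewrite !Cexp_RtoC, <- RtoC_add, <- !RtoC_mul. f_equal.
    (* Half-angle variables: below, [s] is sinh(t/2), with cosh t - 1 = 2 s^2, and [w] is
       (2z)^(-1/2). *)
    set (E := exp (t / 2)).
    assert (HE : 1 < E) by (unfold E; rewrite <- exp_0; apply exp_increasing; lra).
    replace (exp (- (1 / 2) * t)) with (/ E) by (unfold E; rewrite <- exp_Ropp; f_equal; field).
    assert (ET : exp t = E * E) by (unfold E; rewrite <- exp_plus; f_equal; field).
    assert (Es : 0 < (E - / E) / 2).
    { assert (/ E < 1) by (rewrite <- Rinv_1; apply Rinv_lt_contravar; lra). lra. }
    assert (Cs : cosh t - 1 = 2 * ((E - / E) / 2 * ((E - / E) / 2))).
    { unfold cosh. rewrite exp_Ropp, ET. field. lra. }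
    assert (Ss : sinh t = 2 * ((E - / E) / 2) * ((E + / E) / 2)).
    { unfold sinh. rewrite exp_Ropp, ET. field. lra. }
    rewrite Cs, Ss. set (s := (E - / E) / 2) in *.
    replace (z * (2 * (s * s))) with (2 * z * (s * s)) at 1 by ring.
    rewrite (ln_mult (2 * z)), (ln_mult s) by nra.
    replace (- (1 / 2) * (ln (2 * z) + (ln s + ln s))) with (- (1 / 2) * ln (2 * z) + - ln s) by field.
    rewrite exp_plus, (exp_Ropp (ln s)), exp_ln by easy.
    set (w := exp (- (1 / 2) * ln (2 * z))).
    assert (Ew : w * w * (2 * z) = 1).
    { unfold w. rewrite <- (exp_ln (2 * z)) at 3 by lra. rewrite <- !exp_plus.
      transitivity (exp 0); [f_equal; field|apply exp_0]. }
    replace (exp (- (z * (2 * (s * s))))) with (exp (- (z * cosh t)) * exp z).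
    2: { rewrite <- exp_plus. f_equal. rewrite <- Cs. ring. }
    rewrite (exp_Ropp z). pose proof (exp_pos z).
    match goal with |- _ = ?r => transitivity (w * w * (2 * z) * r) end;
      [field; lra|rewrite Ew; ring].
  - intros t Ht. apply pos_inI in Ht. apply inI_pos. specialize (HC t Ht). nra.
  - intros t Ht. apply (is_derive_scal (fun t => cosh t - 1) t z).
    eapply der_eq; [|apply der_minus; [apply is_derive_cosh|apply (is_derive_const (V := R_NormedModule) 1)]].
    unfold zero; simpl; ring.
  - intros t Ht. apply cont_mult; [apply continuous_const|apply cont_sinh].
  - apply (filterlim_endL 0).
    replace (Rbar_locally 0) with (locally (z * (cosh 0 - 1))) by (replace (z * (cosh 0 - 1)) with 0 by (rewrite cosh_0; ring); easy).
    apply (cont_mult (fun _ => z) (fun t => cosh t - 1)); [apply continuous_const|].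
    apply cont_minus; [apply cont_cosh|apply continuous_const].
  - intros P [M HM]. exists (Rmax 0 (2 * (M / z + 1))). intros x Hx _. apply HM.
    assert (0 < x) by (eapply Rle_lt_trans; [apply Rmax_l|exact Hx]).
    assert (2 * (M / z + 1) < x) by (eapply Rle_lt_trans; [apply Rmax_r|exact Hx]).
    assert (x / 2 < cosh x).
    { unfold cosh. pose proof (exp_ineq1_le x). pose proof (exp_pos (- x)). lra. }
    assert (H3 : M / z < cosh x - 1) by lra. apply Rlt_div_l in H3; [lra|easy].
Qed.

(** The inner integral in the exchange for Basset's formula; with index -1/2 it is elementary. *)
Lemma inv_gauss_half v z : 0 < v -> 0 < z ->
  cint 0 p_infty (inv_gauss (RtoC (- (1 / 2))) (1 + v) (z ^ 2 / 4))
    (Cmul gamma_half (RtoC (exp (- (z * sqrt (1 + v))) / sqrt (1 + v)))).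
Proof.
  intros Hv Hz. set (u := sqrt (1 + v)).
  assert (Hu : 0 < u) by (apply sqrt_lt_R0; lra).
  assert (Hu2 : u ^ 2 = 1 + v) by (unfold u; rewrite pow2_sqrt; lra).
  rewrite <- Hu2. apply cint_eq with (2 := inv_gauss_cint (RtoC (- (1 / 2))) u z Hu Hz).
  rewrite besselK_half by nra.
  replace (Copp (RtoC (- (1 / 2)))) with (RtoC (1 / 2)) by (apply Cx_ext; simpl; field).
  rewrite Cpow_RtoC.
  transitivity (Cmul gamma_half (RtoC (2 * (exp (1 / 2 * ln (z / (2 * u))) *
    (exp (- (z * u)) * exp (- (1 / 2) * ln (2 * (z * u)))))))).
  { rewrite !RtoC_mul. ring. }
  do 2 f_equal. rewrite ln_div, !ln_mult by nra.
  replace (exp (1 / 2 * (ln z - (ln 2 + ln u)))) with (exp (1 / 2 * ln z) * exp (- (1 / 2) * ln 2) * exp (- (1 / 2) * ln u))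
    by (rewrite <- !exp_plus; f_equal; field).
  replace (exp (- (1 / 2) * (ln 2 + (ln z + ln u)))) with (/ exp (1 / 2 * ln z) * exp (- (1 / 2) * ln 2) * exp (- (1 / 2) * ln u))
    by (rewrite <- exp_Ropp, <- !exp_plus; f_equal; field).
  assert (W : forall r, 0 < r -> exp (- (1 / 2) * ln r) * exp (- (1 / 2) * ln r) = / r).
  { intros r Hr. rewrite <- exp_plus. rewrite <- (exp_ln r) at 3 by easy. rewrite <- exp_Ropp. f_equal. field. }
  pose proof (W 2 ltac:(lra)) as W2. pose proof (W u Hu) as Wu.
  set (a := exp (- (1 / 2) * ln 2)) in *. set (b := exp (- (1 / 2) * ln u)) in *.
  pose proof (exp_pos (1 / 2 * ln z)).
  transitivity (2 * (a * a) * (b * b) * exp (- (z * u))); [field; lra|].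
  rewrite W2, Wu. field. lra.
Qed.

Definition hyp_int (nu : Cx) (z : R) (m : nat) (ph : R) : Cx :=
  Cmul (RtoC (exp (- (z * cosh ph)) * cosh ph ^ m)) (Cpow (sinh ph) nu).

Lemma hyp_int_cont nu z m x : 0 < x -> ccont (hyp_int nu z m) x.
Proof.
  intros Hx. apply ccont_mul.
  - apply ccont_RtoC, cont_mult.
    + apply (continuous_comp cosh (fun c => exp (- (z * c)))); [apply cont_cosh|].
      apply (cont_derive (fun c => exp (- (z * c)))). auto_derive. easy.
    + apply (continuous_comp cosh (fun c => c ^ m)); [apply cont_cosh|].
      apply (cont_derive (fun c => c ^ m)). auto_derive. easy.
  - apply (ccont_comp (fun r => Cpow r nu) sinh); [apply cont_sinh|].
    apply ccont_Cpow. now apply sinh_gt0.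
Qed.

(* Exchange of integrals in int int v^(a-1) t^(-1/2) e^(-t(1+v) - z^2/4t), with a = (nu+1)/2
   and v = sinh^2 phi. *)
Lemma basset (nu : Cx) z : -1 < fst nu -> 0 < z ->
  exists S, cint 0 p_infty (hyp_int nu z 0) S /\
    Cmul gamma_half S = Cmul (CGamma (Chalf (Cadd nu Cone))) (Ktilde (Chalf nu) z).
Proof.
  intros Hm Hz. set (a := Chalf (Cadd nu Cone)).
  assert (Ea : fst a = (fst nu + 1) / 2) by (unfold a; simpl; field).
  assert (Ha : 0 < fst a) by lra.
  assert (Hz4 : 0 < z ^ 2 / 4) by (assert (0 < z ^ 2) by (now apply pow_lt); lra).
  (* The kernel bound multiplies the weight by ((1+t)/t)^(a+1); asking for decay of order a + 1 + 2
     leaves (1+t)^(-2), the dominator with s = 1. *)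
  destruct (inv_gauss_bound (- (1 / 2) - (fst a + 1)) 1 (z ^ 2 / 4) (fst a + 1 + 2)) as [C [C0 HC]];
    [lra|easy|].
  assert (Hsq : forall x, 0 < x -> continuous (fun v => exp (- (z * sqrt (1 + v))) / sqrt (1 + v)) x).
  { intros x Hx. apply cont_derive. assert (0 < sqrt (1 + x)) by (apply sqrt_lt_R0; lra).
    auto_derive. repeat split; lra. }
  destruct (mellin_laplace a (inv_gauss (RtoC (- (1 / 2))) 1 (z ^ 2 / 4))
    (fun v => Cmul gamma_half (RtoC (exp (- (z * sqrt (1 + v))) / sqrt (1 + v)))) 1 C)
    as [l [L1 L2]]; try lra.
  - intros x Hx. now apply inv_gauss_cont.
  - intros x Hx. apply ccont_mul; [apply ccont_const|]. now apply ccont_RtoC, Hsq.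
  - intros t Ht. unfold inv_gauss. rewrite Cmod_mul, Cmod_Cpow, Cmod_RtoC, Rabs_exp.
    cbn [fst Csub Cadd Copp Cone RtoC]. specialize (HC t Ht).
    apply (Rmult_le_compat_r (exp ((fst a + 1) * ln (1 + t)))) in HC; [|left; apply exp_pos].
    replace (C * (exp ((1 - 1) * ln t) * exp (- ((1 + 1) * ln (1 + t))))) with
      (C * exp (- ((fst a + 1 + 2) * ln (1 + t))) * exp ((fst a + 1) * ln (1 + t))).
    + eapply Rle_trans; [|exact HC]. right. rewrite <- !exp_plus. f_equal. field. lra.
    + rewrite Rmult_assoc. f_equal. rewrite <- !exp_plus. f_equal. ring.
  - intros v Hv. apply cint_ext with (2 := inv_gauss_half v z Hv Hz).
    intros t _. unfold inv_gauss.
    replace (- ((1 + v) * t) - z ^ 2 / 4 / t) with ((- (1 * t) - z ^ 2 / 4 / t) + - (t * v)) by ring.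
    rewrite exp_plus, RtoC_mul. ring.
  - assert (E2 : l = Cmul (CGamma a) (Cmul (RtoC 2) (Ktilde (Chalf nu) z))).
    { apply cint_unique with (1 := I : Rbar_lt 0 p_infty) (2 := L2).
      pose proof (inv_gauss_cint (Chalf nu) 1 z ltac:(lra) Hz) as K.
      apply (cint_scal _ _ (CGamma a)) in K. unfold Ktilde.
      rewrite !Rmult_1_r in K. apply cint_ext with (2 := K). intros t Ht. cbv beta.
      unfold inv_gauss. rewrite pow1.
      replace (Csub (Copp (Chalf nu)) Cone) with
        (Cadd (Csub (Copp (RtoC (- (1 / 2)))) Cone) (Copp a)) by (unfold a, Chalf; apply Cx_ext; simpl; field).
      rewrite (Cpow_add t _ (Copp a)). ring. }
    assert (S := cint_subst 0 p_infty 0 p_infty (fun t => sinh t ^ 2) (fun t => 2 * sinh t * cosh t)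
      (fun v => Cmul (Cpow v (Csub a Cone))
         (Cmul gamma_half (RtoC (exp (- (z * sqrt (1 + v))) / sqrt (1 + v))))) l I I).
    pose proof gamma_half_neq0 as GN.
    assert (N2 : RtoC 2 <> Czero) by (apply RtoC_neq0; lra).
    eapply S in L1; clear S.
    + exists (Cmul (Cinv (Cmul (RtoC 2) gamma_half)) l). split.
      * apply cint_ext with (2 := cint_scal _ _ _ _ _ L1). intros t Ht. apply pos_inI in Ht.
        cbv beta. unfold hyp_int. pose proof (sinh_gt0 t Ht) as Hs. pose proof (cosh_ge1 t) as Hc.
        rewrite <- cosh_sqr, sqrt_pow2 by lra.
        replace (sinh t ^ 2) with (sinh t * sinh t) by ring.
        rewrite Cpow_mul by easy.
        replace (Cpow (sinh t) nu) with (Cmul (RtoC (sinh t)) (Cmul (Cpow (sinh t) (Csub a Cone)) (Cpow (sinh t) (Csub a Cone)))).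
        2: { rewrite <- Cpow_add. replace nu with (Cadd Cone (Cadd (Csub a Cone) (Csub a Cone))).
             - rewrite (Cpow_add _ Cone), Cpow_1 by easy. easy.
             - unfold a, Chalf; apply Cx_ext; simpl; field. }
        unfold Rdiv. rewrite !RtoC_mul, RtoC_inv by lra. simpl pow. change (RtoC 1) with Cone.
        field. repeat split; try easy. apply RtoC_neq0. lra.
      * rewrite E2. field. split; easy.
    + intros t Ht. apply inI_pos, pow_lt, sinh_gt0, pos_inI, Ht.
    + intros t _. eapply der_eq; [|apply (is_derive_comp (fun y => y ^ 2) sinh t (2 * sinh t) (cosh t));
        [auto_derive; [easy|ring]|apply is_derive_sinh]].
      unfold scal; simpl; unfold mult; simpl. ring.
    + intros t _. apply (cont_mult (fun t => 2 * sinh t) cosh); [|apply cont_cosh].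
      apply cont_mult; [apply continuous_const|apply cont_sinh].
    + apply (filterlim_endL 0).
      replace (Rbar_locally 0) with (locally (sinh 0 ^ 2)) by (replace (sinh 0 ^ 2) with 0 by (rewrite sinh_0; ring); easy).
      apply (continuous_comp sinh (fun y => y ^ 2)); [apply cont_sinh|].
      apply (cont_derive (fun y => y ^ 2)). auto_derive. easy.
    + intros P [M HM]. exists (Rmax 1 M). intros x Hx _. apply HM.
      assert (1 < x) by (eapply Rle_lt_trans; [apply Rmax_l|exact Hx]).
      assert (M < x) by (eapply Rle_lt_trans; [apply Rmax_r|exact Hx]).
      pose proof (sinh_le x ltac:(lra)). nra.
Qed.

(** The normalisation (z/2)^(1/2) cancels the algebraic factor of K, so a pure exponential
    remains. *)
Lemma ktilde_minus_half z : 0 < z ->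
  Ktilde (Chalf (RtoC (-1))) z = Cmul (RtoC (1 / 2)) (Cmul gamma_half (RtoC (exp (- z)))).
Proof.
  intros Hz. unfold Ktilde.
  replace (Chalf (RtoC (-1))) with (RtoC (- (1 / 2))) by (unfold Chalf; apply Cx_ext; simpl; field).
  rewrite besselK_half by easy.
  replace (Copp (RtoC (- (1 / 2)))) with (RtoC (1 / 2)) by (apply Cx_ext; simpl; field).
  rewrite Cpow_RtoC, !RtoC_mul.
  transitivity (Cmul (RtoC (exp (1 / 2 * ln (z / 2)) * exp (- (1 / 2) * ln (2 * z))))
    (Cmul gamma_half (RtoC (exp (- z))))).
  { rewrite RtoC_mul. ring. }
  do 2 f_equal. rewrite ln_div, ln_mult, <- exp_plus by lra.
  replace (1 / 2 * (ln z - ln 2) + - (1 / 2) * (ln 2 + ln z)) with (- ln 2) by field.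
  rewrite exp_Ropp, exp_ln by lra. field.
Qed.

(** * Complex series *)

Lemma fst_Csum_upto n f : fst (Csum_upto n f) = sum_f_R0 (fun k => fst (f k)) n.
Proof. induction n as [|n IH]; simpl; [easy|now rewrite IH]. Qed.
Lemma snd_Csum_upto n f : snd (Csum_upto n f) = sum_f_R0 (fun k => snd (f k)) n.
Proof. induction n as [|n IH]; simpl; [easy|now rewrite IH]. Qed.

Lemma Csum_upto_ext n f g : (forall k, (k <= n)%nat -> f k = g k) -> Csum_upto n f = Csum_upto n g.
Proof.
  intros H. induction n as [|n IH]; simpl; [apply H; lia|].
  rewrite IH by auto. now rewrite H by lia.
Qed.
Lemma Csum_upto_scal n c f : Csum_upto n (fun k => Cmul c (f k)) = Cmul c (Csum_upto n f).
Proof. induction n as [|n IH]; simpl; [easy|rewrite IH; ring]. Qed.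
Lemma Csum_upto_add n f g :
  Csum_upto n (fun k => Cadd (f k) (g k)) = Cadd (Csum_upto n f) (Csum_upto n g).
Proof. induction n as [|n IH]; simpl; [easy|rewrite IH; ring]. Qed.
Lemma Csum_upto_sub n f g :
  Csum_upto n (fun k => Csub (f k) (g k)) = Csub (Csum_upto n f) (Csum_upto n g).
Proof. induction n as [|n IH]; simpl; [easy|rewrite IH; ring]. Qed.
Lemma Csum_upto_le n f g : (forall k, (k <= n)%nat -> Cmod (f k) <= g k) ->
  Cmod (Csum_upto n f) <= sum_f_R0 g n.
Proof.
  intros H. induction n as [|n IH]; simpl; [apply H; lia|].
  eapply Rle_trans; [apply Cmod_add|]. apply Rplus_le_compat; [apply IH|apply H]; auto.
Qed.
Lemma Csum_upto_RtoC n f : Csum_upto n (fun k => RtoC (f k)) = RtoC (sum_f_R0 f n).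
Proof. induction n as [|n IH]; simpl; [easy|now rewrite IH, RtoC_add]. Qed.

Lemma C_series_of_bound a l (B : nat -> R) : (forall n, Cmod (Csub (Csum_upto n a) l) <= B n) ->
  (forall eps, 0 < eps -> exists N, forall n, (N <= n)%nat -> B n < eps) -> C_series a l.
Proof.
  intros H HB. split; intros eps He; destruct (HB eps He) as [N HN]; exists N; intros n Hn;
    unfold Rdist; specialize (H n); specialize (HN n Hn).
  - rewrite <- fst_Csum_upto. pose proof (Cmod_fst (Csub (Csum_upto n a) l)) as W. simpl in W.
    unfold Rminus. lra.
  - rewrite <- snd_Csum_upto. pose proof (Cmod_snd (Csub (Csum_upto n a) l)) as W. simpl in W.
    unfold Rminus. lra.
Qed.

Lemma C_series_eps a l : C_series a l ->
  forall eps, 0 < eps -> exists N, forall n, (N <= n)%nat -> Cmod (Csub (Csum_upto n a) l) < eps.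
Proof.
  intros [H1 H2] eps He. assert (He2 : 0 < eps / 2) by lra.
  destruct (H1 _ He2) as [N1 W1]. destruct (H2 _ He2) as [N2 W2].
  exists (max N1 N2). intros n Hn. specialize (W1 n ltac:(lia)). specialize (W2 n ltac:(lia)).
  unfold Rdist in *. rewrite <- fst_Csum_upto in W1. rewrite <- snd_Csum_upto in W2.
  eapply Rle_lt_trans; [apply Cmod_le_sum|]. simpl. unfold Rminus in *. lra.
Qed.

Lemma C_series_unique a l m : C_series a l -> C_series a m -> l = m.
Proof.
  intros [H1 H2] [H3 H4]. apply Cx_ext; eapply uniqueness_sum; eassumption.
Qed.
Lemma C_series_ext a b l : (forall n, a n = b n) -> C_series a l -> C_series b l.
Proof.
  intros E [H1 H2]. split; intros eps He; [destruct (H1 eps He) as [N HN]|destruct (H2 eps He) as [N HN]];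
    exists N; intros n Hn; specialize (HN n Hn);
    erewrite sum_eq; try exact HN; intros; simpl; now rewrite E.
Qed.
Lemma Csum_inf_eq a l : C_series a l -> Csum_inf a = l.
Proof.
  intros H. apply C_series_unique with a; [|easy].
  exact (epsilon_spec C_inhabited (C_series a) (ex_intro _ l H)).
Qed.
Lemma C_series_scal c a l : C_series a l -> C_series (fun n => Cmul c (a n)) (Cmul c l).
Proof.
  intros H. pose proof (C_series_eps a l H) as E.
  apply C_series_of_bound with (fun n => Cmod c * Cmod (Csub (Csum_upto n a) l)).
  - intros n. rewrite Csum_upto_scal, <- Cmod_mul. right. f_equal. ring.
  - intros eps He. pose proof (Cmod_ge0 c).
    assert (Hq : 0 < eps / (Cmod c + 1)) by (apply Rdiv_lt_0_compat; lra).
    destruct (E _ Hq) as [N HN]. exists N. intros n Hn. specialize (HN n Hn).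
    apply Rlt_div_r in HN; [|lra]. pose proof (Cmod_ge0 (Csub (Csum_upto n a) l)). nra.
Qed.
Lemma C_series_eq a l m : l = m -> C_series a l -> C_series a m.
Proof. now intros ->. Qed.

Lemma geometric_small C q : 0 <= q < 1 -> forall eps, 0 < eps ->
  exists N, forall n, (N <= n)%nat -> C * q ^ S n < eps.
Proof.
  intros Hq eps He.
  assert (Hq2 : 0 < eps / (Rabs C + 1)) by (apply Rdiv_lt_0_compat; [easy|pose proof (Rabs_pos C); lra]).
  destruct (pow_lt_1_zero q ltac:(rewrite Rabs_right; lra) _ Hq2) as [N HN].
  exists N. intros n Hn. specialize (HN (S n) ltac:(lia)).
  pose proof (Rabs_pos C). apply Rlt_div_r in HN; [|lra].
  assert (0 <= q ^ S n) by (apply pow_le; lra).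
  rewrite Rabs_right in HN by lra. pose proof (Rle_abs C). nra.
Qed.

(** * Termwise integration of an exponential *)

Lemma exp_partial_sum_le Q N : 0 <= Q -> sum_f_R0 (fun n => / INR (fact n) * Q ^ n) N <= exp Q.
Proof.
  intros HQ. apply sum_incr.
  - unfold exp. exact (proj2_sig (exist_exp Q)).
  - intros n. apply Rmult_le_pos; [|now apply pow_le].
    left. apply Rinv_0_lt_compat, INR_fact_lt_0.
Qed.

Lemma exp_term_le Q n : 0 <= Q -> Q ^ n <= INR (fact n) * exp Q.
Proof.
  intros HQ. pose proof (exp_partial_sum_le Q n HQ) as H.
  assert (P : forall k, 0 <= / INR (fact k) * Q ^ k).
  { intros k. apply Rmult_le_pos; [|now apply pow_le].
    left. apply Rinv_0_lt_compat, INR_fact_lt_0. }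
  assert (H2 : / INR (fact n) * Q ^ n <= exp Q).
  { eapply Rle_trans; [|exact H]. destruct n; [simpl; lra|].
    rewrite tech5. pose proof (cond_pos_sum _ n P). simpl in *. lra. }
  pose proof (INR_fact_lt_0 n). apply (Rmult_le_compat_l (INR (fact n))) in H2; [|lra].
  rewrite <- Rmult_assoc, Rinv_r, Rmult_1_l in H2 by lra. easy.
Qed.

(** Each term beyond N is at most rho^(N+1) times the matching term of the series of e^Q: a
    remainder that is geometric in N, at the cost of a larger exponential. *)
Lemma exp_remainder y Q rho N : 0 <= Q -> 0 <= rho <= 1 -> Rabs y <= rho * Q ->
  Rabs (exp y - sum_f_R0 (fun n => / INR (fact n) * y ^ n) N) <= rho ^ S N * exp Q.
Proof.
  intros HQ Hr Hy. set (f := fun n => / INR (fact n) * y ^ n).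
  set (g := fun n => / INR (fact n) * Q ^ n).
  assert (T : forall n, (S N <= n)%nat -> Rabs (f n) <= rho ^ S N * g n).
  { intros n Hn. unfold f, g. pose proof (INR_fact_lt_0 n) as Hf. apply Rinv_0_lt_compat in Hf.
    rewrite Rabs_mult, (Rabs_right (/ _)) by lra. rewrite <- RPow_abs.
    apply Rle_trans with (/ INR (fact n) * (rho * Q) ^ n).
    - apply Rmult_le_compat_l; [lra|]. apply pow_incr. split; [apply Rabs_pos|easy].
    - rewrite Rpow_mult_distr. replace (rho ^ S N * (/ INR (fact n) * Q ^ n)) with
        (/ INR (fact n) * (rho ^ S N * Q ^ n)) by ring.
      apply Rmult_le_compat_l; [lra|]. apply Rmult_le_compat_r; [now apply pow_le|].
      replace n with (S N + (n - S N))%nat by lia. rewrite pow_add.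
      rewrite <- (Rmult_1_r (rho ^ S N)) at 2. apply Rmult_le_compat_l; [apply pow_le; lra|].
      rewrite <- (pow1 (n - S N)). apply pow_incr. lra. }
  assert (K : forall k, Rabs (sum_f_R0 f (N + k) - sum_f_R0 f N) <=
     rho ^ S N * (sum_f_R0 g (N + k) - sum_f_R0 g N)).
  { induction k as [|k IH].
    - rewrite Nat.add_0_r, !Rminus_diag, Rabs_R0. lra.
    - rewrite Nat.add_succ_r. rewrite !tech5. specialize (T (S (N + k)) ltac:(lia)).
      replace (sum_f_R0 f (N + k) + f (S (N + k)) - sum_f_R0 f N) with
        ((sum_f_R0 f (N + k) - sum_f_R0 f N) + f (S (N + k))) by ring.
      eapply Rle_trans; [apply Rabs_triang|]. lra. }
  assert (P : forall k, 0 <= g k).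
  { intros k. apply Rmult_le_pos; [|now apply pow_le].
    left. apply Rinv_0_lt_compat, INR_fact_lt_0. }
  apply le_epsilon. intros e He.
  assert (HE : infinite_sum f (exp y)) by (unfold exp; exact (proj2_sig (exist_exp y))).
  destruct (HE e He) as [M HM]. specialize (HM (N + M)%nat ltac:(lia)). unfold Rdist in HM.
  specialize (K M). pose proof (exp_partial_sum_le Q (N + M) HQ) as Hs. fold g in Hs.
  pose proof (cond_pos_sum g N P).
  assert (0 <= rho ^ S N) by (apply pow_le; lra).
  replace (exp y - sum_f_R0 f N) with (- (sum_f_R0 f (N + M) - exp y) + (sum_f_R0 f (N + M) - sum_f_R0 f N)) by ring.
  eapply Rle_trans; [apply Rabs_triang|]. rewrite Rabs_Ropp. nra.
Qed.

(* Power series coefficients of [s |-> int w e^(-s k)], when [m n] is the moment [int w k^n]. *)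
Definition exp_coef (m : nat -> Cx) (n : nat) : Cx := Cmul (RtoC ((-1) ^ n / INR (fact n))) (m n).

(** As [q] exceeds |s|, the truncated exponential errs by at most rho^(N+1) e^(q|k|) with rho =
    |s|/q < 1. The weight absorbs e^(q|k|) into [D], and integration leaves a geometric error. *)
Lemma termwise (a b : Rbar) (w : R -> Cx) (k D : R -> R) d s q J m : Rbar_lt a b ->
  Rabs s < q -> nint a b D d ->
  (forall x, inI a b x -> Cmod (w x) * exp (q * Rabs (k x)) <= D x) ->
  (forall n, cint a b (fun x => Cmul (RtoC (k x ^ n)) (w x)) (m n)) ->
  cint a b (fun x => Cmul (RtoC (exp (- (s * k x)))) (w x)) J ->
  C_series (fun n => Cmul (exp_coef m n) (RtoC (s ^ n))) J.
Proof.
  intros Hab Hs HD Hw Hm HJ. pose proof (Rabs_pos s).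
  set (rho := Rabs s / q).
  assert (Hrho : 0 <= rho < 1).
  { unfold rho. split; [apply Rdiv_le_0_compat; lra|]. apply Rlt_div_l; lra. }
  apply C_series_of_bound with (fun N => 2 * d * rho ^ S N).
  - intros N.
    assert (HS : cint a b (fun x => Csum_upto N (fun n => Cmul (RtoC ((-1) ^ n / INR (fact n) * s ^ n))
        (Cmul (RtoC (k x ^ n)) (w x)))) (Csum_upto N (fun n => Cmul (exp_coef m n) (RtoC (s ^ n))))).
    { apply (cint_sum a b N (fun n x => Cmul (RtoC ((-1) ^ n / INR (fact n) * s ^ n))
        (Cmul (RtoC (k x ^ n)) (w x)))). intros n _.
      apply cint_eq with (2 := cint_scal _ _ _ _ _ (Hm n)). unfold exp_coef. rewrite RtoC_mul. ring. }
    replace (2 * d * rho ^ S N) with (2 * (rho ^ S N * d)) by ring.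
    eapply cint_bound; [exact Hab| |exact (cint_sub _ _ _ _ _ _ HS HJ)|exact (nint_scal _ _ (rho ^ S N) _ _ HD)].
    intros x Hx. cbv beta.
    assert (E : Csum_upto N (fun n => Cmul (RtoC ((-1) ^ n / INR (fact n) * s ^ n)) (Cmul (RtoC (k x ^ n)) (w x))) =
      Cmul (RtoC (sum_f_R0 (fun n => / INR (fact n) * (- (s * k x)) ^ n) N)) (w x)).
    { rewrite <- Csum_upto_RtoC. rewrite (Csum_upto_ext _ _ (fun n => Cmul (w x) (RtoC (/ INR (fact n) * (- (s * k x)) ^ n)))).
      - rewrite Csum_upto_scal. ring.
      - intros n _. replace (- (s * k x)) with ((-1) * s * k x) by ring. rewrite !Rpow_mult_distr.
        unfold Rdiv. rewrite !RtoC_mul. ring. }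
    rewrite E.
    replace (Csub (Cmul (RtoC (sum_f_R0 (fun n => / INR (fact n) * (- (s * k x)) ^ n) N)) (w x))
      (Cmul (RtoC (exp (- (s * k x)))) (w x))) with
      (Cmul (RtoC (- (exp (- (s * k x)) - sum_f_R0 (fun n => / INR (fact n) * (- (s * k x)) ^ n) N))) (w x))
      by (rewrite RtoC_opp, RtoC_sub; ring).
    rewrite Cmod_mul, Cmod_RtoC, Rabs_Ropp.
    pose proof (exp_remainder (- (s * k x)) (q * Rabs (k x)) rho N) as R.
    assert (HQ : 0 <= q * Rabs (k x)) by (apply Rmult_le_pos; [lra|apply Rabs_pos]).
    specialize (R HQ ltac:(lra)).
    rewrite Rabs_Ropp, Rabs_mult in R.
    specialize (R ltac:(right; unfold rho; field; lra)).
    specialize (Hw x Hx). pose proof (Cmod_ge0 (w x)).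
    assert (0 <= rho ^ S N) by (apply pow_le; lra).
    apply Rle_trans with (rho ^ S N * exp (q * Rabs (k x)) * Cmod (w x));
      [now apply Rmult_le_compat_r|]. nra.
  - apply geometric_small. lra.
Qed.

Lemma moment_le (w : Cx) k q n D : 0 < q -> Cmod w * exp (q * Rabs k) <= D ->
  Cmod (Cmul (RtoC (k ^ n)) w) <= INR (fact n) * / q ^ n * D.
Proof.
  intros Hq Hw. pose proof (pow_lt q n Hq) as Hqn. pose proof (INR_fact_lt_0 n) as Hf.
  rewrite Cmod_mul, Cmod_RtoC, <- RPow_abs.
  assert (HQ : 0 <= q * Rabs k) by (apply Rmult_le_pos; [lra|apply Rabs_pos]).
  pose proof (exp_term_le _ n HQ) as T. rewrite Rpow_mult_distr in T.
  assert (T2 : Rabs k ^ n <= INR (fact n) * / q ^ n * exp (q * Rabs k)).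
  { apply Rmult_le_reg_l with (q ^ n); [easy|]. eapply Rle_trans; [exact T|]. right. field. lra. }
  pose proof (Cmod_ge0 w).
  assert (0 < INR (fact n) * / q ^ n) by (apply Rmult_lt_0_compat; [easy|now apply Rinv_0_lt_compat]).
  apply Rle_trans with (INR (fact n) * / q ^ n * exp (q * Rabs k) * Cmod w);
    [now apply Rmult_le_compat_r|]. nra.
Qed.

(** A Cauchy estimate, from (q|k|)^n / n! <= e^(q|k|). *)
Lemma exp_coef_bound (a b : Rbar) (w : R -> Cx) (k D : R -> R) d q m : Rbar_lt a b ->
  0 < q -> nint a b D d ->
  (forall x, inI a b x -> Cmod (w x) * exp (q * Rabs (k x)) <= D x) ->
  (forall n, cint a b (fun x => Cmul (RtoC (k x ^ n)) (w x)) (m n)) ->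
  forall n, Cmod (exp_coef m n) <= 2 * d * (/ q) ^ n.
Proof.
  intros Hab Hq HD Hw Hm n. unfold exp_coef.
  pose proof (INR_fact_lt_0 n) as Hf. pose proof (pow_lt q n Hq) as Hqn.
  assert (B : Cmod (m n) <= 2 * (INR (fact n) * / q ^ n * d)).
  { eapply cint_bound; [exact Hab| |exact (Hm n)|exact (nint_scal _ _ (INR (fact n) * / q ^ n) _ _ HD)].
    intros x Hx. now apply moment_le, Hw. }
  rewrite Cmod_mul, Cmod_RtoC. unfold Rdiv. rewrite Rabs_mult, pow_1_abs, Rmult_1_l.
  rewrite Rabs_right by (left; now apply Rinv_0_lt_compat).
  apply Rle_trans with (/ INR (fact n) * (2 * (INR (fact n) * / q ^ n * d))).
  - apply Rmult_le_compat_l; [left; now apply Rinv_0_lt_compat|easy].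
  - right. rewrite pow_inv. field. lra.
Qed.

(** * Rearrangement of double series *)

Lemma Csum_upto_triangle f N :
  Csum_upto N (fun j => Csum_upto j (fun n => f n (j - n)%nat)) =
  Csum_upto N (fun n => Csum_upto (N - n) (f n)).
Proof.
  induction N as [|N IH]; [easy|].
  change (Csum_upto (S N) (fun j => Csum_upto j (fun n => f n (j - n)%nat))) with
    (Cadd (Csum_upto N (fun j => Csum_upto j (fun n => f n (j - n)%nat)))
      (Cadd (Csum_upto N (fun n => f n (S N - n)%nat)) (f (S N) (S N - S N)%nat))).
  change (Csum_upto (S N) (fun n => Csum_upto (S N - n) (f n))) with
    (Cadd (Csum_upto N (fun n => Csum_upto (S N - n) (f n))) (Csum_upto (S N - S N) (f (S N)))).
  rewrite IH.
  rewrite (Csum_upto_ext N (fun n => Csum_upto (S N - n) (f n))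
    (fun n => Cadd (Csum_upto (N - n) (f n)) (f n (S N - n)%nat))).
  - rewrite Csum_upto_add, Nat.sub_diag. simpl. ring.
  - intros n Hn. now rewrite Nat.sub_succ_l by easy.
Qed.

Lemma C_series_tail (a : nat -> Cx) l C q N : 0 <= q < 1 -> (forall n, Cmod (a n) <= C * q ^ n) -> C_series a l ->
  Cmod (Csub l (Csum_upto N a)) <= C * q ^ S N / (1 - q).
Proof.
  intros Hq Ha Hl.
  assert (C0 : 0 <= C) by (specialize (Ha O); pose proof (Cmod_ge0 (a O)); simpl in Ha; lra).
  assert (K : forall k, Cmod (Csub (Csum_upto (N + k) a) (Csum_upto N a)) <=
     C * q ^ S N / (1 - q) - C * q ^ S (N + k) / (1 - q)).
  { induction k as [|k IH].
    - rewrite Nat.add_0_r. replace (Csub (Csum_upto N a) (Csum_upto N a)) with (RtoC 0)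
        by (change (RtoC 0) with Czero; ring). rewrite Cmod_RtoC, Rabs_R0. lra.
    - rewrite Nat.add_succ_r. simpl Csum_upto.
      replace (Csub (Cadd (Csum_upto (N + k) a) (a (S (N + k)))) (Csum_upto N a)) with
        (Cadd (Csub (Csum_upto (N + k) a) (Csum_upto N a)) (a (S (N + k)))) by ring.
      eapply Rle_trans; [apply Cmod_add|]. specialize (Ha (S (N + k))).
      assert (E : C * q ^ S (N + k) / (1 - q) - C * q ^ S (S (N + k)) / (1 - q) = C * q ^ S (N + k)).
      { rewrite <- (tech_pow_Rmult q (S (N + k))). field. lra. }
      lra. }
  apply le_epsilon. intros e He. destruct (C_series_eps a l Hl e He) as [M HM].
  specialize (HM (N + M)%nat ltac:(lia)). specialize (K M).
  assert (0 <= C * q ^ S (N + M) / (1 - q)).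
  { apply Rdiv_le_0_compat; [|lra]. apply Rmult_le_pos; [easy|apply pow_le; lra]. }
  replace (Csub l (Csum_upto N a)) with
    (Cadd (Cmul (RtoC (-1)) (Csub (Csum_upto (N + M) a) l)) (Csub (Csum_upto (N + M) a) (Csum_upto N a))).
  2: { apply Cx_ext; simpl; ring. }
  eapply Rle_trans; [apply Cmod_add|]. rewrite Cmod_mul, Cmod_RtoC, Rabs_left by lra. lra.
Qed.

Lemma S_le_pow2 n : INR (S n) <= 2 ^ n.
Proof.
  induction n as [|n IH]; [simpl; lra|]. rewrite S_INR. simpl pow.
  assert (1 <= 2 ^ n) by (apply pow_R1_Rle; lra). lra.
Qed.

(** Regrouping along antidiagonals. Up to order N there are N + 1 rows, each with a tail at most C
    q^(N+1)/(1-q); bounding N + 1 by a power of 2 gives (2q)^(N+1), whence q < 1/2. The crude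
    condition only shrinks the range of [t]. *)
Lemma triangle_sum (f : nat -> nat -> Cx) (S : nat -> Cx) L C q : 0 <= q < 1 / 2 ->
  (forall n m, Cmod (f n m) <= C * q ^ (n + m)) -> (forall n, C_series (f n) (S n)) ->
  C_series S L -> C_series (fun j => Csum_upto j (fun n => f n (j - n)%nat)) L.
Proof.
  intros Hq Hf HS HL.
  assert (C0 : 0 <= C) by (specialize (Hf O O); pose proof (Cmod_ge0 (f O O)); simpl in Hf; lra).
  apply C_series_of_bound with
    (fun N => C / (1 - q) * (2 * q) ^ Datatypes.S N + Cmod (Csub (Csum_upto N S) L)).
  - intros N. rewrite Csum_upto_triangle.
    replace (Csub (Csum_upto N (fun n => Csum_upto (N - n) (f n))) L) with
      (Cadd (Csub (Csum_upto N (fun n => Csum_upto (N - n) (f n))) (Csum_upto N S))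
        (Csub (Csum_upto N S) L)) by ring.
    eapply Rle_trans; [apply Cmod_add|]. apply Rplus_le_compat_r.
    rewrite <- Csum_upto_sub.
    apply Rle_trans with (sum_f_R0 (fun _ => C * q ^ Datatypes.S N / (1 - q)) N).
    + apply Csum_upto_le. intros n Hn.
      pose proof (C_series_tail (f n) (S n) (C * q ^ n) q (N - n) ltac:(lra)) as T.
      specialize (T ltac:(intros m; rewrite Rmult_assoc, <- pow_add; apply Hf) (HS n)).
      replace (Csub (Csum_upto (N - n) (f n)) (S n)) with
        (Cmul (RtoC (-1)) (Csub (S n) (Csum_upto (N - n) (f n)))) by (apply Cx_ext; simpl; ring).
      rewrite Cmod_mul, Cmod_RtoC, Rabs_left by lra.
      replace (C * q ^ n * q ^ Datatypes.S (N - n) / (1 - q)) with (C * q ^ Datatypes.S N / (1 - q)) in T.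
      2: { rewrite (Rmult_assoc C), <- pow_add. do 4 f_equal. lia. }
      lra.
    + rewrite sum_cte. replace (C / (1 - q) * (2 * q) ^ Datatypes.S N) with
        (C * q ^ Datatypes.S N / (1 - q) * 2 ^ Datatypes.S N) by (rewrite Rpow_mult_distr; field; lra).
      apply Rmult_le_compat_l.
      * apply Rdiv_le_0_compat; [|lra]. apply Rmult_le_pos; [easy|apply pow_le; lra].
      * eapply Rle_trans; [apply S_le_pow2|]. simpl. pose proof (pow_lt 2 N ltac:(lra)). lra.
  - intros eps He. assert (He2 : 0 < eps / 2) by lra.
    destruct (geometric_small (C / (1 - q)) (2 * q) ltac:(lra) _ He2) as [N1 W1].
    destruct (C_series_eps _ _ HL _ He2) as [N2 W2].
    exists (max N1 N2). intros n Hn. specialize (W1 n ltac:(lia)). specialize (W2 n ltac:(lia)). lra.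
Qed.

Lemma cauchy_product (A B : nat -> Cx) P1 P2 C1 C2 r s : 0 <= r -> Rabs s * r < 1 / 2 ->
  (forall n, Cmod (A n) <= C1 * r ^ n) -> (forall n, Cmod (B n) <= C2 * r ^ n) ->
  C_series (fun n => Cmul (A n) (RtoC (s ^ n))) P1 ->
  C_series (fun n => Cmul (B n) (RtoC (s ^ n))) P2 ->
  C_series (fun j => Cmul (Csum_upto j (fun n => Cmul (A n) (B (j - n)%nat))) (RtoC (s ^ j))) (Cmul P1 P2).
Proof.
  intros Hr Hs HA HB H1 H2. pose proof (Rabs_pos s).
  apply C_series_ext with (fun j => Csum_upto j (fun n =>
    (fun n m => Cmul (Cmul (A n) (RtoC (s ^ n))) (Cmul (B m) (RtoC (s ^ m)))) n (j - n)%nat)).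
  { intros j. replace (Cmul (Csum_upto j (fun n => Cmul (A n) (B (j - n)%nat))) (RtoC (s ^ j))) with
      (Cmul (RtoC (s ^ j)) (Csum_upto j (fun n => Cmul (A n) (B (j - n)%nat)))) by ring.
    rewrite <- Csum_upto_scal. apply Csum_upto_ext. intros k Hk.
    replace (s ^ j) with (s ^ k * s ^ (j - k)) by (rewrite <- pow_add; f_equal; lia).
    rewrite RtoC_mul. ring. }
  apply (triangle_sum (fun n m => Cmul (Cmul (A n) (RtoC (s ^ n))) (Cmul (B m) (RtoC (s ^ m))))
    (fun n => Cmul P2 (Cmul (A n) (RtoC (s ^ n)))) _ (C1 * C2) (Rabs s * r)).
  - split; [now apply Rmult_le_pos|easy].
  - intros n m. rewrite !Cmod_mul, !Cmod_RtoC, <- !RPow_abs, Rpow_mult_distr, !pow_add.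
    assert (0 <= Rabs s ^ n) by now apply pow_le. assert (0 <= Rabs s ^ m) by now apply pow_le.
    apply Rle_trans with ((C1 * r ^ n * Rabs s ^ n) * (C2 * r ^ m * Rabs s ^ m)); [|right; ring].
    apply Rmult_le_compat; try (apply Rmult_le_pos; [apply Cmod_ge0|easy]); now apply Rmult_le_compat_r.
  - intros n. apply C_series_eq with (Cmul (Cmul (A n) (RtoC (s ^ n))) P2); [ring|].
    now apply C_series_scal.
  - apply C_series_eq with (Cmul P2 P1); [ring|]. now apply C_series_scal.
Qed.

(** * The binomial series *)

(** The absorption identity for binomial coefficients. It moves the upper index, which the recursion
    defining [Cbinom] keeps fixed. *)
Lemma Cbinom_S w m : Cmul (RtoC (INR (S m))) (Cbinom (Cadd w Cone) (S m)) = Cmul (Cadd w Cone) (Cbinom w m).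
Proof.
  assert (N : forall m, RtoC (INR (S m)) <> Czero).
  { intros k. apply RtoC_neq0. pose proof (lt_0_INR (S k) ltac:(lia)). lra. }
  induction m as [|m IH].
  - simpl Cbinom. simpl INR. change (RtoC 0) with Czero. change (RtoC 1) with Cone. field. apply Cone_neq0.
  - change (Cbinom (Cadd w Cone) (S (S m))) with (Cmul (Cbinom (Cadd w Cone) (S m))
      (Cdiv (Csub (Cadd w Cone) (RtoC (INR (S m)))) (RtoC (INR (S (S m)))))).
    change (Cbinom w (S m)) with (Cmul (Cbinom w m) (Cdiv (Csub w (RtoC (INR m))) (RtoC (INR (S m))))).
    transitivity (Cmul (Cbinom (Cadd w Cone) (S m)) (Csub (Cadd w Cone) (RtoC (INR (S m))))).
    { field. apply N. }
    replace (Csub (Cadd w Cone) (RtoC (INR (S m)))) with (Csub w (RtoC (INR m)))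
      by (rewrite (S_INR m), RtoC_add; change (RtoC 1) with Cone; ring).
    transitivity (Cmul (Cmul (RtoC (INR (S m))) (Cbinom (Cadd w Cone) (S m)))
      (Cdiv (Csub w (RtoC (INR m))) (RtoC (INR (S m))))); [field; apply N|].
    rewrite IH. ring.
Qed.

(** The rising factorial b (b+1) ... (b+m-1) over m!, that is, the coefficient of t^m in
    (1-t)^(-b). *)
Definition rising_coef (b : Cx) (m : nat) : Cx := Cbinom (Cadd (Csub b Cone) (RtoC (INR m))) m.

Lemma rising_coef_S b m : Cmul (RtoC (INR (S m))) (rising_coef b (S m)) =
  Cmul (Cadd b (RtoC (INR m))) (rising_coef b m).
Proof.
  unfold rising_coef.
  replace (Cadd (Csub b Cone) (RtoC (INR (S m)))) with (Cadd (Cadd (Csub b Cone) (RtoC (INR m))) Cone)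
    by (rewrite (S_INR m), RtoC_add; change (RtoC 1) with Cone; ring).
  rewrite Cbinom_S. f_equal. ring.
Qed.

Lemma CGamma_add_nat (b : Cx) n : 0 < fst b ->
  CGamma (Cadd b (RtoC (INR n))) = Cmul (CGamma b) (Cmul (RtoC (INR (fact n))) (rising_coef b n)).
Proof.
  intros Hb. induction n as [|n IH].
  - simpl. unfold rising_coef. simpl Cbinom. change (RtoC 0) with Czero. change (RtoC 1) with Cone.
    replace (Cadd b Czero) with b by ring. ring.
  - replace (Cadd b (RtoC (INR (S n)))) with (Cadd (Cadd b (RtoC (INR n))) Cone)
      by (rewrite (S_INR n), RtoC_add; change (RtoC 1) with Cone; ring).
    rewrite CGamma_S, IH by (simpl; pose proof (pos_INR n); lra).
    change (fact (S n)) with (S n * fact n)%nat. rewrite mult_INR, RtoC_mul.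
    transitivity (Cmul (Cmul (CGamma b) (RtoC (INR (fact n)))) (Cmul (RtoC (INR (S n))) (rising_coef b (S n))));
      [rewrite rising_coef_S|]; ring.
Qed.

Lemma binomial_series (b : Cx) t : 0 < fst b -> Rabs t < 1 ->
  C_series (fun m => Cmul (rising_coef b m) (RtoC (t ^ m))) (Cpow (1 - t) (Copp b)).
Proof.
  intros Hb Ht.
  assert (NG : CGamma b <> Czero) by now apply CGamma_neq0.
  assert (Ht2 : -1 < t < 1) by (apply Rabs_def2 in Ht; lra).
  (* Any radius strictly between |t| and 1: above |t| for the geometric remainder, below 1 so that
     e^((q-1)x) still makes the dominator integrable. *)
  set (q := (1 + Rabs t) / 2). assert (Hq : Rabs t < q < 1) by (unfold q; lra).
  assert (Hb' : 0 < fst (RtoC (fst b))) by easy.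
  assert (Hm : forall n, cint 0 p_infty (fun x => Cmul (RtoC (x ^ n)) (Cmul (Cpow x (Csub b Cone)) (RtoC (exp (- x)))))
    (CGamma (Cadd b (RtoC (INR n))))).
  { intros n. assert (H : 0 < fst (Cadd b (RtoC (INR n)))) by (simpl; pose proof (pos_INR n); lra).
    apply cint_ext with (2 := CGamma_cint _ H). intros x Hx. apply pos_inI in Hx.
    replace (Csub (Cadd b (RtoC (INR n))) Cone) with (Cadd (RtoC (INR n)) (Csub b Cone)) by ring.
    rewrite (Cpow_add x (RtoC (INR n))), Cpow_nat by easy. ring. }
  destruct (gamma_scaled (RtoC (fst b)) (1 - q) Hb' ltac:(lra)) as [HD _].
  pose proof (gamma_scaled b (1 - t) Hb ltac:(lra)) as HJ.
  assert (T : C_series (fun n => Cmul (exp_coef (fun n => CGamma (Cadd b (RtoC (INR n)))) n) (RtoC ((- t) ^ n)))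
    (Cmul (CGamma b) (Cpow (1 - t) (Copp b)))).
  { apply (termwise 0 p_infty (fun x => Cmul (Cpow x (Csub b Cone)) (RtoC (exp (- x)))) (fun x => x) _ _ (- t) q _ _
      I ltac:(rewrite Rabs_Ropp; lra) HD).
    - intros x Hx. apply pos_inI in Hx. rewrite Cmod_mul, Cmod_Cpow, Cmod_RtoC.
      rewrite (Rabs_right x), (Rabs_right (exp _)) by (try lra; left; apply exp_pos).
      rewrite Cpow_eq. simpl. right.
      replace (0 + - 0) with 0 by ring. rewrite Rmult_0_l, cos_0.
      replace (- ((1 - q) * x)) with (- x + q * x) by ring. rewrite exp_plus. ring.
    - exact Hm.
    - apply cint_ext with (2 := HJ). intros x _.
      replace (- (- t * x)) with (t * x) by ring.
      replace (- ((1 - t) * x)) with (t * x + - x) by ring. rewrite exp_plus, RtoC_mul. ring. }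
  apply (C_series_scal (Cinv (CGamma b))) in T.
  apply C_series_eq with (Cmul (Cinv (CGamma b)) (Cmul (CGamma b) (Cpow (1 - t) (Copp b)))); [now field|].
  (* The n-th moment of the Gamma weight is Gamma(b+n); dividing by n! Gamma(b) yields the binomial
     coefficient, and the two signs (-1)^n cancel. *)
  apply C_series_ext with (2 := T). intros n. unfold exp_coef. rewrite CGamma_add_nat by easy.
  replace (- t) with ((-1) * t) by ring. rewrite Rpow_mult_distr.
  assert (E1 : Cmul (RtoC ((-1) ^ n)) (RtoC ((-1) ^ n)) = Cone).
  { rewrite <- RtoC_mul, <- Rpow_mult_distr. replace (-1 * -1) with 1 by ring. now rewrite pow1. }
  pose proof (INR_fact_neq_0 n).
  unfold Rdiv. rewrite !RtoC_mul, RtoC_inv by easy.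
  transitivity (Cmul (Cmul (RtoC ((-1) ^ n)) (RtoC ((-1) ^ n))) (Cmul (rising_coef b n) (RtoC (t ^ n))));
    [field; split; [now apply RtoC_neq0|easy]|]. rewrite E1. ring.
Qed.

Fixpoint rising_real (K : R) (m : nat) : R :=
  match m with O => 1 | S k => rising_real K k * ((K + INR k) / INR (S k)) end.

Lemma rising_real_S K m : rising_real K (S m) = rising_real K m * ((K + INR m) / (INR m + 1)).
Proof. rewrite <- S_INR. easy. Qed.

Lemma rising_real_shift K m : K * rising_real (K + 1) m = (K + INR m) * rising_real K m.
Proof.
  induction m as [|m IH]; [simpl; ring|].
  rewrite !rising_real_S, S_INR.
  replace (K * (rising_real (K + 1) m * ((K + 1 + INR m) / (INR m + 1)))) with
    ((K * rising_real (K + 1) m) * ((K + 1 + INR m) / (INR m + 1))) by ring.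
  rewrite IH. pose proof (pos_INR m). field. lra.
Qed.

Lemma rising_real_pascal K m :
  rising_real (K + 1) (S m) = rising_real (K + 1) m + rising_real K (S m).
Proof.
  rewrite !rising_real_S. pose proof (pos_INR m).
  replace (rising_real K m * ((K + INR m) / (INR m + 1))) with
    (((K + INR m) * rising_real K m) / (INR m + 1)) by (field; lra).
  rewrite <- rising_real_shift. field. lra.
Qed.

(** Double induction along Pascal's rule; for K = 0 the sequence is 1, 0, 0, ... *)
Lemma rising_real_le K m : rising_real (INR K) m <= 2 ^ (K + m).
Proof.
  revert m. induction K as [|K IH]; intros m.
  - assert (0 < 2 ^ (0 + m)) by (apply pow_lt; lra).
    destruct m as [|m]; [simpl; lra|].
    assert (W : forall m, rising_real 0 (S m) = 0).
    { induction m0 as [|m0 IHm]; [simpl; field|].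
      change (rising_real 0 (S (S m0))) with (rising_real 0 (S m0) * ((0 + INR (S m0)) / INR (S (S m0)))).
      rewrite IHm. ring. }
    simpl INR. rewrite W. lra.
  - rewrite S_INR. induction m as [|m IHm].
    + simpl rising_real. apply pow_R1_Rle. lra.
    + rewrite rising_real_pascal. specialize (IH (S m)).
      replace (S K + S m)%nat with (S (S K + m)) by lia. replace (K + S m)%nat with (S K + m)%nat in IH by lia.
      rewrite <- (tech_pow_Rmult 2). lra.
Qed.

(** Factorwise comparison with an integer parameter. Shifting [b] by n therefore costs only a factor
    2^n, which keeps the double series geometric. *)
Lemma rising_coef_le b K m : Cmod b <= INR K -> Cmod (rising_coef b m) <= 2 ^ (K + m).
Proof.
  intros Hb. eapply Rle_trans; [|apply rising_real_le].
  induction m as [|m IH].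
  - unfold rising_coef. simpl. change Cone with (RtoC 1). rewrite Cmod_RtoC, Rabs_R1. lra.
  - simpl rising_real.
    assert (P : 0 < INR (S m)) by (apply lt_0_INR; lia).
    assert (N : RtoC (INR (S m)) <> Czero) by (apply RtoC_neq0; lra).
    replace (rising_coef b (S m)) with (Cmul (Cmul (Cadd b (RtoC (INR m))) (rising_coef b m)) (RtoC (/ INR (S m)))).
    2: { rewrite <- rising_coef_S, RtoC_inv by lra. field. easy. }
    rewrite !Cmod_mul, Cmod_RtoC, Rabs_right by (left; now apply Rinv_0_lt_compat).
    assert (B : Cmod (Cadd b (RtoC (INR m))) <= INR K + INR m).
    { eapply Rle_trans; [apply Cmod_add|]. rewrite Cmod_RtoC, Rabs_right by (apply Rle_ge, pos_INR). lra. }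
    unfold Rdiv. rewrite <- Rmult_assoc. apply Rmult_le_compat_r; [left; now apply Rinv_0_lt_compat|].
    rewrite Rmult_comm. apply Rmult_le_compat; try apply Cmod_ge0; easy.
Qed.

(** * Taylor coefficients *)

Lemma infinite_sum_bounded u l : infinite_sum u l -> exists M, forall n, Rabs (u n) <= M.
Proof.
  intros H. destruct (maj_by_pos (sum_f_R0 u) (exist _ l H)) as [M [_ HM]].
  exists (2 * M). intros [|n].
  - specialize (HM O). simpl in HM. pose proof (Rabs_pos (u O)). lra.
  - pose proof (HM n) as H1. pose proof (HM (S n)) as H2. rewrite tech5 in H2.
    replace (u (S n)) with ((sum_f_R0 u n + u (S n)) + - sum_f_R0 u n) by ring.
    eapply Rle_trans; [apply Rabs_triang|]. rewrite Rabs_Ropp. lra.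
Qed.

Lemma power_series_unique (a b : nat -> R) (f : R -> R) e : 0 < e ->
  (forall t, Rabs t < e -> infinite_sum (fun n => a n * t ^ n) (f t)) ->
  (forall t, Rabs t < e -> infinite_sum (fun n => b n * t ^ n) (f t)) ->
  forall n, a n = b n.
Proof.
  intros He Ha Hb n.
  assert (C : forall c, (forall t, Rabs t < e -> infinite_sum (fun n => c n * t ^ n) (f t)) ->
    Rbar_lt 0 (CV_radius c)).
  { intros c Hc. assert (H2 : Rabs (e / 2) < e) by (rewrite Rabs_right; lra).
    destruct (infinite_sum_bounded _ _ (Hc _ H2)) as [M HM].
    apply Rbar_lt_le_trans with (e / 2); [simpl; lra|].
    apply (proj1 (CV_radius_bounded c)). now exists M. }
  assert (P : forall c, (forall t, Rabs t < e -> infinite_sum (fun n => c n * t ^ n) (f t)) ->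
    forall t, Rabs t < e -> PSeries c t = f t).
  { intros c Hc t Ht. apply is_series_unique. apply is_series_Reals. now apply Hc. }
  apply PSeries_ext_recip; [now apply C|now apply C|].
  exists (mkposreal _ He). intros t Ht.
  unfold_ball in Ht.
  rewrite Ropp_0, Rplus_0_r in Ht. now rewrite !P.
Qed.

(** Exhibiting one expansion makes the [epsilon] choice an expansion too, though on an unknown
    interval; the two agree on the smaller interval, which determines the coefficients. *)
Lemma taylor_coefs_eq (f : R -> Cx) (c : nat -> Cx) e : 0 < e ->
  (forall t, Rabs t < e -> C_series (fun j => Cmul (c j) (RtoC (t ^ j))) (f t)) ->
  forall j, taylor_coefs f j = c j.
Proof.
  intros He Hc j.
  set (Q := fun c : nat -> Cx => exists eps, 0 < eps /\
    forall t, Rabs t < eps -> C_series (fun j => Cmul (c j) (RtoC (t ^ j))) (f t)).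
  assert (HQ : Q (taylor_coefs f)).
  { apply (epsilon_spec seq_inhabited Q). exists c, e. easy. }
  destruct HQ as [e' [He' Hc']].
  assert (0 < Rmin e e') by now apply Rmin_glb_lt.
  pose proof (Rmin_l e e'). pose proof (Rmin_r e e').
  assert (W : forall (g : nat -> Cx) t l, C_series (fun j => Cmul (g j) (RtoC (t ^ j))) l ->
    infinite_sum (fun n => fst (g n) * t ^ n) (fst l) /\ infinite_sum (fun n => snd (g n) * t ^ n) (snd l)).
  { intros g t l [H3 H4]. split; intros eps E;
      [destruct (H3 eps E) as [N HN]|destruct (H4 eps E) as [N HN]];
      exists N; intros n Hn; specialize (HN n Hn); erewrite sum_eq; try exact HN;
      intros; simpl; ring. }
  apply Cx_ext.
  - apply (power_series_unique (fun n => fst (taylor_coefs f n)) (fun n => fst (c n)) (fun t => fst (f t)) (Rmin e e'));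
      auto; intros t Ht; apply W; [apply Hc'|apply Hc]; lra.
  - apply (power_series_unique (fun n => snd (taylor_coefs f n)) (fun n => snd (c n)) (fun t => snd (f t)) (Rmin e e'));
      auto; intros t Ht; apply W; [apply Hc'|apply Hc]; lra.
Qed.

(* The integral of [L_j (x (k1 + k2))], from the sequences [exp_coef] of [k1] and [k2]. *)
Definition lag_sum (j : nat) (al : Cx) (x : R) (A B : nat -> Cx) : Cx :=
  Csum_upto j (fun n => Cmul (Cmul (RtoC (x ^ n)) (Cbinom (Cadd (RtoC (INR j)) al) (j - n)))
    (Csum_upto n (fun k => Cmul (A k) (B (n - k)%nat)))).

(* (1-t)^(-al-1) P(xt/(1-t)) = sum_n p_n x^n t^n (1-t)^(-al-1-n): expand each binomial and
   collect the powers of t. *)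
Lemma taylor_assembly (al kap : Cx) x (A B : nat -> Cx) (P1 P2 F : R -> Cx) C1 C2 q e :
  -1 < fst al -> 0 < x -> 0 < q -> 0 < e ->
  (forall n, Cmod (A n) <= C1 * (/ q) ^ n) -> (forall n, Cmod (B n) <= C2 * (/ q) ^ n) ->
  (forall s, Rabs s < q -> C_series (fun n => Cmul (A n) (RtoC (s ^ n))) (P1 s)) ->
  (forall s, Rabs s < q -> C_series (fun n => Cmul (B n) (RtoC (s ^ n))) (P2 s)) ->
  (forall t s, Rabs t < e -> Rabs t < 1 / 2 -> s = t * x / (1 - t) -> Rabs s < q ->
    F t = Cmul (Cpow (1 - t) (Copp (Cadd al Cone))) (Cmul kap (Cmul (P1 s) (P2 s)))) ->
  forall j, taylor_coefs F j = Cmul kap (lag_sum j al x A B).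
Proof.
  intros Hal Hx Hq He HA HB H1 H2 HF.
  set (r := / q). assert (Hr : 0 < r) by now apply Rinv_0_lt_compat.
  assert (C10 : 0 <= C1) by (specialize (HA O); pose proof (Cmod_ge0 (A O)); simpl in HA; lra).
  assert (C20 : 0 <= C2) by (specialize (HB O); pose proof (Cmod_ge0 (B O)); simpl in HB; lra).
  destruct (INR_unbounded (Cmod (Cadd al Cone))) as [K0 HK0].
  set (p := fun n => Csum_upto n (fun k => Cmul (A k) (B (n - k)%nat))).
  assert (Hp : forall n, Cmod (p n) <= C1 * C2 * (2 * r) ^ n).
  { intros n. apply Rle_trans with (sum_f_R0 (fun _ => C1 * C2 * r ^ n) n).
    - apply Csum_upto_le. intros k Hk. rewrite Cmod_mul.
      replace (C1 * C2 * r ^ n) with ((C1 * r ^ k) * (C2 * r ^ (n - k))).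
      + apply Rmult_le_compat; try apply Cmod_ge0; [apply HA|apply HB].
      + transitivity (C1 * C2 * (r ^ k * r ^ (n - k))); [ring|]. rewrite <- pow_add. do 2 f_equal. lia.
    - rewrite sum_cte, Rpow_mult_distr.
      replace (C1 * C2 * (2 ^ n * r ^ n)) with (C1 * C2 * r ^ n * 2 ^ n) by ring.
      apply Rmult_le_compat_l; [|apply S_le_pow2].
      apply Rmult_le_pos; [now apply Rmult_le_pos|apply pow_le; lra]. }
  (* [M] bounds both growth rates of the double series: 4 r x per unit of n (2r from [p], x from s,
     and 2 from the shifted binomial) and 2 per unit of m. *)
  set (M := 2 * (1 + 2 * r * x)). assert (HM : 2 <= M /\ 4 * r * x <= M) by (unfold M; nra).
  (* The bound 1/2 keeps 1 - t above 1/2, q/(4x) then forces |s| < q/2, and 1/(2M) gives the ratio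
     M|t| < 1/2 required by [triangle_sum]. *)
  set (e1 := Rmin (Rmin e (1 / 2)) (Rmin (q / (4 * x)) (/ (2 * M)))).
  assert (He1 : 0 < e1).
  { unfold e1. repeat apply Rmin_glb_lt; try lra.
    - apply Rdiv_lt_0_compat; lra.
    - apply Rinv_0_lt_compat; lra. }
  apply taylor_coefs_eq with (1 := He1). intros t Ht.
  assert (T1 : Rabs t < e /\ Rabs t < 1 / 2 /\ Rabs t < q / (4 * x) /\ Rabs t < / (2 * M)).
  { unfold e1 in Ht. pose proof (Rmin_l (Rmin e (1 / 2)) (Rmin (q / (4 * x)) (/ (2 * M)))).
    pose proof (Rmin_r (Rmin e (1 / 2)) (Rmin (q / (4 * x)) (/ (2 * M)))).
    pose proof (Rmin_l e (1 / 2)). pose proof (Rmin_r e (1 / 2)).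
    pose proof (Rmin_l (q / (4 * x)) (/ (2 * M))). pose proof (Rmin_r (q / (4 * x)) (/ (2 * M))).
    repeat split; lra. }
  destruct T1 as [T1 [T2 [T3 T4]]].
  assert (T5 : - (1 / 2) < t < 1 / 2) by (apply Rabs_def2 in T2; lra).
  set (s := t * x / (1 - t)).
  assert (Hs : Rabs s < q / 2).
  { unfold s, Rdiv. rewrite !Rabs_mult, (Rabs_right x), Rabs_inv, (Rabs_right (1 - t)) by lra.
    apply Rlt_div_r in T3; [|lra].
    apply Rmult_lt_reg_r with (1 - t); [lra|].
    replace (Rabs t * x * / (1 - t) * (1 - t)) with (Rabs t * x) by (field; lra). nra. }
  assert (Hs2 : Rabs s * r < 1 / 2).
  { apply Rmult_lt_reg_r with q; [easy|]. unfold r. rewrite Rmult_assoc, Rinv_l by lra. lra. }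
  rewrite (HF t s) by (try easy; lra).
  assert (HS : C_series (fun n => Cmul (p n) (RtoC (s ^ n))) (Cmul (P1 s) (P2 s))).
  { apply cauchy_product with C1 C2 r; try easy; try lra; [apply H1|apply H2]; lra. }
  apply (C_series_scal (Cmul (Cpow (1 - t) (Copp (Cadd al Cone))) kap)) in HS.
  set (f := fun n m => Cmul kap (Cmul (Cmul (p n) (RtoC (x ^ n * t ^ n)))
    (Cmul (rising_coef (Cadd (Cadd al Cone) (RtoC (INR n))) m) (RtoC (t ^ m))))).
  assert (TS : C_series (fun j => Csum_upto j (fun n => f n (j - n)%nat))
    (Cmul (Cmul (Cpow (1 - t) (Copp (Cadd al Cone))) kap) (Cmul (P1 s) (P2 s)))).
  { apply (triangle_sum f (fun n => Cmul (Cmul (Cpow (1 - t) (Copp (Cadd al Cone))) kap) (Cmul (p n) (RtoC (s ^ n))))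
      _ (Cmod kap * (C1 * C2 * 2 ^ K0)) (M * Rabs t)); [| | |exact HS].
    - split; [apply Rmult_le_pos; [lra|apply Rabs_pos]|].
      apply (Rmult_lt_compat_l M) in T4; [|lra].
      replace (M * / (2 * M)) with (1 / 2) in T4 by (field; lra). lra.
    - intros n m. unfold f. rewrite !Cmod_mul, !Cmod_RtoC, (Rmult_assoc (Cmod kap)).
      apply Rmult_le_compat_l; [apply Cmod_ge0|].
      assert (G : Cmod (rising_coef (Cadd (Cadd al Cone) (RtoC (INR n))) m) <= 2 ^ (K0 + n + m)).
      { apply rising_coef_le. rewrite plus_INR. eapply Rle_trans; [apply Cmod_add|].
        rewrite Cmod_RtoC, Rabs_right by (apply Rle_ge, pos_INR). lra. }
      specialize (Hp n). rewrite Rabs_mult, <- !RPow_abs, (Rabs_right x) by lra.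
      assert (X0 : 0 <= x ^ n) by (apply pow_le; lra).
      assert (X1 : 0 <= Rabs t ^ n) by (apply pow_le, Rabs_pos).
      assert (X2 : 0 <= Rabs t ^ m) by (apply pow_le, Rabs_pos).
      apply Rle_trans with (C1 * C2 * (2 * r) ^ n * (x ^ n * Rabs t ^ n) * (2 ^ (K0 + n + m) * Rabs t ^ m)).
      { apply Rmult_le_compat.
        - apply Rmult_le_pos; [apply Cmod_ge0|now apply Rmult_le_pos].
        - apply Rmult_le_pos; [apply Cmod_ge0|easy].
        - apply Rmult_le_compat_r; [now apply Rmult_le_pos|easy].
        - now apply Rmult_le_compat_r. }
      replace (C1 * C2 * (2 * r) ^ n * (x ^ n * Rabs t ^ n) * (2 ^ (K0 + n + m) * Rabs t ^ m)) with
        (C1 * C2 * 2 ^ K0 * ((4 * r * x * Rabs t) ^ n * (2 * Rabs t) ^ m)).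
      2: { rewrite !pow_add. replace (4 * r * x * Rabs t) with ((2 * r) * x * Rabs t * 2) by ring.
           rewrite !Rpow_mult_distr. ring. }
      apply Rmult_le_compat_l.
      { apply Rmult_le_pos; [now apply Rmult_le_pos|apply pow_le; lra]. }
      rewrite pow_add. pose proof (Rabs_pos t).
      assert (0 <= 4 * r * x * Rabs t) by (apply Rmult_le_pos; [nra|easy]).
      apply Rmult_le_compat; try (apply pow_le; lra); apply pow_incr; split; try lra;
        apply Rmult_le_compat_r; lra.
    - intros n. unfold f.
      assert (Hb : 0 < fst (Cadd (Cadd al Cone) (RtoC (INR n)))) by (simpl; pose proof (pos_INR n); lra).
      pose proof (binomial_series _ t Hb ltac:(lra)) as BS.
      apply (C_series_scal (Cmul kap (Cmul (p n) (RtoC (x ^ n * t ^ n))))) in BS.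
      apply C_series_eq with (Cmul (Cmul kap (Cmul (p n) (RtoC (x ^ n * t ^ n))))
        (Cpow (1 - t) (Copp (Cadd (Cadd al Cone) (RtoC (INR n)))))).
      + replace (Copp (Cadd (Cadd al Cone) (RtoC (INR n)))) with
          (Cadd (Copp (Cadd al Cone)) (Copp (RtoC (INR n)))) by ring.
        rewrite (Cpow_add (1 - t) _ (Copp (RtoC (INR n)))), (Cpow_opp _ (RtoC (INR n))), Cpow_nat by lra.
        assert (N : (1 - t) ^ n <> 0) by (apply pow_nonzero; lra).
        replace (s ^ n) with (x ^ n * t ^ n * / (1 - t) ^ n).
        * rewrite !RtoC_mul, RtoC_inv by easy. ring.
        * unfold s, Rdiv. rewrite !Rpow_mult_distr, pow_inv. ring.
      + apply C_series_ext with (2 := BS). intros m. ring. }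
  apply C_series_eq with (Cmul (Cmul (Cpow (1 - t) (Copp (Cadd al Cone))) kap) (Cmul (P1 s) (P2 s))); [ring|].
  apply C_series_ext with (2 := TS). intros j. unfold f, lag_sum.
  transitivity (Cmul (Cmul kap (RtoC (t ^ j))) (Csum_upto j (fun n => Cmul (Cmul (RtoC (x ^ n))
    (Cbinom (Cadd (RtoC (INR j)) al) (j - n))) (p n)))); [|fold p; unfold p; ring].
  rewrite <- Csum_upto_scal. apply Csum_upto_ext. intros n Hn.
  replace (t ^ j) with (t ^ n * t ^ (j - n)) by (rewrite <- pow_add; f_equal; lia).
  unfold rising_coef.
  (* The crux of the assembly: (al+1+n) - 1 + (j-n) = j + al does not depend on n, so the binomial
     is that of the Laguerre polynomial. *)
  replace (Cadd (Csub (Cadd (Cadd al Cone) (RtoC (INR n))) Cone) (RtoC (INR (j - n)))) with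
    (Cadd (RtoC (INR j)) al) by (rewrite minus_INR, RtoC_sub by easy; ring).
  rewrite !RtoC_mul. ring.
Qed.

(** * Laguerre polynomials of a sum *)

Lemma sum_binomial_normalized a b n :
  (a + b) ^ n / INR (fact n) =
  sum_f_R0 (fun k => a ^ k / INR (fact k) * (b ^ (n - k) / INR (fact (n - k)))) n.
Proof.
  rewrite binomial. unfold Rdiv at 1. rewrite Rmult_comm, scal_sum. apply sum_eq. intros k Hk.
  unfold Binomial.C. pose proof (INR_fact_neq_0 n). pose proof (INR_fact_neq_0 k).
  pose proof (INR_fact_neq_0 (n - k)). field. easy.
Qed.

(** With 1/n! included, the powers of a + b are convolutions of those of a and b. Hence the
    polynomial is [lag_sum] for two point masses, and integration merely replaces powers by
    moments. *)
Lemma laguerre_split j al x a b : Laguerre j al (x * (a + b)) =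
  lag_sum j al x (exp_coef (fun k => RtoC (a ^ k))) (exp_coef (fun k => RtoC (b ^ k))).
Proof.
  unfold Laguerre, lag_sum. apply Csum_upto_ext. intros n Hn.
  replace (Csum_upto n (fun k => Cmul (exp_coef (fun k => RtoC (a ^ k)) k) (exp_coef (fun k => RtoC (b ^ k)) (n - k))))
    with (RtoC ((-1) ^ n * ((a + b) ^ n / INR (fact n)))).
  - replace ((-1) ^ n / INR (fact n) * (x * (a + b)) ^ n) with
      (x ^ n * ((-1) ^ n * ((a + b) ^ n / INR (fact n)))) by (rewrite Rpow_mult_distr; unfold Rdiv; ring).
    rewrite (RtoC_mul (x ^ n)). ring.
  - rewrite sum_binomial_normalized, RtoC_mul, <- Csum_upto_RtoC, <- Csum_upto_scal.
    apply Csum_upto_ext. intros k Hk. unfold exp_coef.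
    replace ((-1) ^ n) with ((-1) ^ k * (-1) ^ (n - k)) by (rewrite <- pow_add; f_equal; lia).
    unfold Rdiv. rewrite !RtoC_mul. ring.
Qed.

Lemma lag_sum_cint_r a b j al x A (g : nat -> R -> Cx) (w : R -> Cx) B :
  (forall k, cint a b (fun t => Cmul (g k t) (w t)) (B k)) ->
  cint a b (fun t => Cmul (lag_sum j al x A (fun k => g k t)) (w t)) (lag_sum j al x A B).
Proof.
  intros H. unfold lag_sum.
  eapply cint_ext; [|apply (cint_sum a b j (fun n t => Cmul (Cmul (RtoC (x ^ n)) (Cbinom (Cadd (RtoC (INR j)) al) (j - n)))
    (Csum_upto n (fun k => Cmul (A k) (Cmul (g (n - k)%nat t) (w t))))))].
  - intros t _. cbv beta. rewrite (Csum_upto_ext _ _ (fun n => Cmul (w t) (Cmul (Cmul (RtoC (x ^ n)) (Cbinom (Cadd (RtoC (INR j)) al) (j - n)))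
    (Csum_upto n (fun k => Cmul (A k) (g (n - k)%nat t)))))).
    + rewrite Csum_upto_scal. ring.
    + intros n _. rewrite (Csum_upto_ext _ _ (fun k => Cmul (w t) (Cmul (A k) (g (n - k)%nat t)))) by (intros; ring).
      rewrite Csum_upto_scal. ring.
  - intros n _. apply cint_scal. apply (cint_sum a b n (fun k t => Cmul (A k) (Cmul (g (n - k)%nat t) (w t)))).
    intros k _. now apply cint_scal.
Qed.

Lemma lag_sum_cint_l a b j al x B (g : nat -> R -> Cx) (w : R -> Cx) A :
  (forall k, cint a b (fun t => Cmul (g k t) (w t)) (A k)) ->
  cint a b (fun t => Cmul (lag_sum j al x (fun k => g k t) B) (w t)) (lag_sum j al x A B).
Proof.
  intros H. unfold lag_sum.
  eapply cint_ext; [|apply (cint_sum a b j (fun n t => Cmul (Cmul (RtoC (x ^ n)) (Cbinom (Cadd (RtoC (INR j)) al) (j - n)))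
    (Csum_upto n (fun k => Cmul (B (n - k)%nat) (Cmul (g k t) (w t)))))
    (fun n => Cmul (Cmul (RtoC (x ^ n)) (Cbinom (Cadd (RtoC (INR j)) al) (j - n)))
    (Csum_upto n (fun k => Cmul (A k) (B (n - k)%nat)))))].
  - intros t _. cbv beta. rewrite (Csum_upto_ext _ _ (fun n => Cmul (w t) (Cmul (Cmul (RtoC (x ^ n)) (Cbinom (Cadd (RtoC (INR j)) al) (j - n)))
    (Csum_upto n (fun k => Cmul (g k t) (B (n - k)%nat)))))).
    + rewrite Csum_upto_scal. ring.
    + intros n _. rewrite (Csum_upto_ext _ _ (fun k => Cmul (w t) (Cmul (g k t) (B (n - k)%nat)))) by (intros; ring).
      rewrite Csum_upto_scal. ring.
  - intros n _. apply cint_scal.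
    rewrite (Csum_upto_ext _ (fun k => Cmul (A k) (B (n - k)%nat)) (fun k => Cmul (B (n - k)%nat) (A k))) by (intros; ring).
    apply (cint_sum a b n (fun k t => Cmul (B (n - k)%nat) (Cmul (g k t) (w t)))).
    intros k _. now apply cint_scal.
Qed.

Lemma exp_coef_cint a b (k : R -> R) (w : R -> Cx) m n :
  cint a b (fun t => Cmul (RtoC (k t ^ n)) (w t)) (m n) ->
  cint a b (fun t => Cmul (exp_coef (fun i => RtoC (k t ^ i)) n) (w t)) (exp_coef m n).
Proof.
  intros H. apply cint_ext with (2 := cint_scal _ _ (RtoC ((-1) ^ n / INR (fact n))) _ _ H).
  intros t _. unfold exp_coef. ring.
Qed.

(** * Poisson's integral *)

Lemma C_series_even a l : (forall k, a (S (2 * k)) = Czero) -> C_series a l ->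
  C_series (fun k => a (2 * k)%nat) l.
Proof.
  intros H0 H.
  assert (E : forall n, Csum_upto (2 * n) a = Csum_upto n (fun k => a (2 * k)%nat)).
  { induction n as [|n IH]; [easy|].
    change (Csum_upto (S n) (fun k => a (2 * k)%nat)) with
      (Cadd (Csum_upto n (fun k => a (2 * k)%nat)) (a (2 * S n)%nat)).
    rewrite <- IH. replace (2 * S n)%nat with (S (S (2 * n))) by lia.
    change (Csum_upto (S (S (2 * n))) a) with
      (Cadd (Cadd (Csum_upto (2 * n) a) (a (S (2 * n)))) (a (S (S (2 * n))))).
    rewrite H0. ring. }
  apply C_series_of_bound with (fun n => Cmod (Csub (Csum_upto (2 * n) a) l)).
  - intros n. rewrite E. lra.
  - intros eps He. destruct (C_series_eps a l H eps He) as [N HN]. exists N. intros n Hn.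
    apply HN. lia.
Qed.

(** Abstract in the moments [M], to cover both the weight sin^mu and the point masses at mu = -1.
    The parameter [ga] stands for Gamma((mu+1)/2), which has a pole at mu = -1 and is replaced there
    by 1; Re mu > -2 keeps the Gamma values of the Bessel series in the right half-plane. *)
Lemma itilde_eq (mu ga J : Cx) z (M : nat -> Cx) : -2 < fst mu -> ga <> Czero ->
  Cmul (M O) (CGamma (Cadd Cone (Chalf mu))) = Cmul gamma_half ga ->
  (forall n, Cmul (Cadd mu (RtoC (INR n + 2))) (M (S (S n))) = Cmul (RtoC (INR n + 1)) (M n)) ->
  (forall k, M (S (2 * k)) = Czero) ->
  C_series (fun n => Cmul (exp_coef M n) (RtoC (z ^ n))) J ->
  Itilde (Chalf mu) z = Cmul (Cinv (Cmul gamma_half ga)) J.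
Proof.
  intros Hmu Hga H0 HS Hodd HJ. unfold Itilde. apply Csum_inf_eq.
  pose proof gamma_half_neq0 as NG.
  apply C_series_even in HJ.
  2: { intros k. unfold exp_coef. rewrite Hodd. ring. }
  apply (C_series_scal (Cinv (Cmul gamma_half ga))) in HJ.
  apply C_series_ext with (2 := HJ). intros k. unfold exp_coef.
  assert (Hpos : forall k, 0 < fst (Cadd (RtoC (INR k + 1)) (Chalf mu))).
  { intros i. unfold Chalf. cbn [fst Cadd RtoC Cmul snd]. pose proof (pos_INR i). lra. }
  (* Closed form of the even moments, by the recursion of [M] against the functional equation of
     Gamma. It turns z^(2k)/(2k)! into (z/2)^(2k)/k! over Gamma(k+1+mu/2). *)
  assert (E : Cmul (RtoC (INR (fact (2 * k)))) (Cmul gamma_half ga) =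
    Cmul (RtoC (4 ^ k * INR (fact k))) (Cmul (CGamma (Cadd (RtoC (INR k + 1)) (Chalf mu))) (M (2 * k)%nat))).
  { clear HJ. induction k as [|k IH].
    - rewrite <- H0. simpl INR. simpl fact. replace (RtoC (0 + 1)) with Cone by (apply Cx_ext; simpl; ring).
      simpl. replace (RtoC (1 * 1)) with Cone by (apply Cx_ext; simpl; ring). change (RtoC 1) with Cone. ring.
    - replace (2 * S k)%nat with (S (S (2 * k))) by lia.
      replace (Cadd (RtoC (INR (S k) + 1)) (Chalf mu)) with (Cadd (Cadd (RtoC (INR k + 1)) (Chalf mu)) Cone).
      2: { rewrite S_INR. apply Cx_ext; simpl; ring. }
      rewrite CGamma_S by apply Hpos.
      replace (Cadd (RtoC (INR k + 1)) (Chalf mu)) with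
        (Cmul (RtoC (1 / 2)) (Cadd mu (RtoC (INR (2 * k) + 2)))) at 1.
      2: { rewrite mult_INR. simpl (INR 2). unfold Chalf. apply Cx_ext; simpl; field. }
      replace (INR (fact (S (S (2 * k))))) with ((INR (2 * k) + 2) * ((INR (2 * k) + 1) * INR (fact (2 * k)))).
      2: { change (fact (S (S (2 * k)))) with (S (S (2 * k)) * (S (2 * k) * fact (2 * k)))%nat.
           rewrite !mult_INR, (S_INR (S (2 * k))), (S_INR (2 * k)), mult_INR. ring. }
      replace (INR (fact (S k))) with ((INR k + 1) * INR (fact k)).
      2: { change (fact (S k)) with (S k * fact k)%nat. now rewrite mult_INR, S_INR. }
      transitivity (Cmul (RtoC (4 * 4 ^ k * ((INR k + 1) * INR (fact k)) * (1 / 2)))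
        (Cmul (CGamma (Cadd (RtoC (INR k + 1)) (Chalf mu)))
          (Cmul (Cadd mu (RtoC (INR (2 * k) + 2))) (M (S (S (2 * k))))))).
      2: { simpl pow. rewrite (RtoC_mul _ (1 / 2)). ring. }
      rewrite HS.
      transitivity (Cmul (RtoC ((INR (2 * k) + 2) * (INR (2 * k) + 1)))
        (Cmul (RtoC (INR (fact (2 * k)))) (Cmul gamma_half ga))).
      { rewrite !RtoC_mul. ring. }
      rewrite IH. 
      replace (4 * 4 ^ k * ((INR k + 1) * INR (fact k)) * (1 / 2)) with
        ((INR (2 * k) + 2) * (4 ^ k * INR (fact k))) by (rewrite mult_INR; simpl (INR 2); field).
      rewrite !RtoC_mul. ring. }
  set (Gk := CGamma (Cadd (RtoC (INR k + 1)) (Chalf mu))) in *.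
  assert (NK : Gk <> Czero) by apply CGamma_neq0, Hpos.
  pose proof (INR_fact_neq_0 (2 * k)) as Fk2. pose proof (INR_fact_neq_0 k) as Fk.
  assert (F4 : 4 ^ k <> 0) by (apply pow_nonzero; lra).
  replace ((z / 2) ^ (2 * k)) with (z ^ (2 * k) * / 4 ^ k).
  2: { unfold Rdiv. rewrite Rpow_mult_distr, (pow_mult (/ 2)).
       replace ((/ 2) ^ 2) with (/ 4) by field. now rewrite pow_inv. }
  rewrite pow_1_even. unfold Rdiv. rewrite !RtoC_mul, !RtoC_inv by easy. rewrite RtoC_mul in E.
  apply RtoC_neq0 in F4, Fk, Fk2. change (RtoC 1) with Cone.
  set (f2 := RtoC (INR (fact (2 * k)))) in *. set (f1 := RtoC (INR (fact k))) in *.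
  set (p4 := RtoC (4 ^ k)) in *.
  assert (E2 : M (2 * k)%nat = Cmul (Cmul f2 (Cmul gamma_half ga)) (Cinv (Cmul (Cmul p4 f1) Gk))).
  { rewrite E. field. repeat split; easy. }
  rewrite E2. field. repeat split; easy.
Qed.

(** * Exponential moments *)

(** Collects from a single dominator what [taylor_assembly] asks of a weight: moments, Laplace
    transform on |s| < q, its power series, and a geometric bound. *)
Lemma moment_series (a b : Rbar) (w : R -> Cx) (k D : R -> R) d q : Rbar_lt a b -> 0 < q ->
  (forall x, inI a b x -> ccont w x) -> (forall x, inI a b x -> continuous k x) -> nint a b D d ->
  (forall x, inI a b x -> Cmod (w x) * exp (q * Rabs (k x)) <= D x) ->
  exists (m : nat -> Cx) (P : R -> Cx),
    (forall n, cint a b (fun x => Cmul (RtoC (k x ^ n)) (w x)) (m n)) /\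
    (forall s, Rabs s < q -> cint a b (fun x => Cmul (RtoC (exp (- (s * k x)))) (w x)) (P s)) /\
    (forall s, Rabs s < q -> C_series (fun n => Cmul (exp_coef m n) (RtoC (s ^ n))) (P s)) /\
    (forall n, Cmod (exp_coef m n) <= 2 * d * (/ q) ^ n).
Proof.
  intros Hab Hq Cw Ck HD Hw.
  set (m := fun n => epsilon C_inhabited (cint a b (fun x => Cmul (RtoC (k x ^ n)) (w x)))).
  set (P := fun s => epsilon C_inhabited (cint a b (fun x => Cmul (RtoC (exp (- (s * k x)))) (w x)))).
  assert (Hm : forall n, cint a b (fun x => Cmul (RtoC (k x ^ n)) (w x)) (m n)).
  { intros n. apply (epsilon_spec C_inhabited (cint a b (fun x => Cmul (RtoC (k x ^ n)) (w x)))).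
    apply cint_dominated with (fun x => INR (fact n) * / q ^ n * D x) (INR (fact n) * / q ^ n * d); auto.
    - intros x Hx. apply ccont_mul; [|auto]. apply ccont_RtoC.
      apply (continuous_comp k (fun c => c ^ n)); [auto|].
      apply (cont_derive (fun c => c ^ n)). auto_derive. easy.
    - intros x Hx. now apply moment_le, Hw.
    - now apply nint_scal. }
  assert (HP : forall s, Rabs s < q -> cint a b (fun x => Cmul (RtoC (exp (- (s * k x)))) (w x)) (P s)).
  { intros s Hs. apply (epsilon_spec C_inhabited (cint a b (fun x => Cmul (RtoC (exp (- (s * k x)))) (w x)))).
    apply cint_dominated with D d; auto.
    - intros x Hx. apply ccont_mul; [|auto]. apply ccont_RtoC.
      apply (continuous_comp k (fun c => exp (- (s * c)))); [auto|].
      apply (cont_derive (fun c => exp (- (s * c)))). auto_derive. easy.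
    - intros x Hx. rewrite Cmod_mul, Cmod_RtoC, Rabs_exp.
      eapply Rle_trans; [|apply Hw, Hx]. rewrite Rmult_comm. apply Rmult_le_compat_l; [apply Cmod_ge0|].
      apply exp_le_exp. eapply Rle_trans; [apply Rle_abs|]. rewrite Rabs_Ropp, Rabs_mult.
      apply Rmult_le_compat_r; [apply Rabs_pos|lra]. }
  exists m, P. split; [exact Hm|]. split; [exact HP|]. split.
  - intros s Hs. exact (termwise a b w k D d s q (P s) m Hab Hs HD Hw Hm (HP s Hs)).
  - exact (exp_coef_bound a b w k D d q m Hab Hq HD Hw Hm).
Qed.

Lemma Rbar_lt_0_PI : Rbar_lt 0 PI.
Proof. simpl. apply PI_RGT_0. Qed.

Lemma sin_Cpow_cont mu x : inI 0 PI x -> ccont (fun t => Cpow (sin t) mu) x.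
Proof.
  intros Hx. apply (ccont_comp (fun r => Cpow r mu) sin).
  - apply cont_derive. auto_derive. easy.
  - apply ccont_Cpow. now apply sin_pos_inI.
Qed.

Lemma trig_dominator (mu : Cx) x q : -1 < fst mu -> 0 < x -> 0 <= q -> exists D d,
  nint 0 PI D d /\ forall t, inI 0 PI t ->
    Cmod (Cpow (sin t) mu) * exp (x * Rabs (cos t)) * exp (q * Rabs (cos t)) <= D t.
Proof.
  intros Hm Hx Hq. destruct (sin_rpow_ex _ Hm) as [m Hm'].
  exists (fun t => exp (x + q) * exp (fst mu * ln (sin t))), (exp (x + q) * m).
  split; [now apply nint_scal|]. intros t _. rewrite Cmod_Cpow, Rmult_assoc, <- exp_plus, Rmult_comm.
  apply Rmult_le_compat_r; [left; apply exp_pos|]. apply exp_le_exp.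
  pose proof (cos_le1 t). pose proof (Rabs_pos (cos t)). nra.
Qed.

Lemma trig_moment_series (mu : Cx) q : -1 < fst mu -> 0 < q ->
  exists (m : nat -> Cx) (P : R -> Cx) C,
    (forall n, cint 0 PI (fun t => Cmul (RtoC (cos t ^ n)) (Cpow (sin t) mu)) (m n)) /\
    (forall s, Rabs s < q -> cint 0 PI (fun t => Cmul (RtoC (exp (- (s * cos t)))) (Cpow (sin t) mu)) (P s)) /\
    (forall s, Rabs s < q -> C_series (fun n => Cmul (exp_coef m n) (RtoC (s ^ n))) (P s)) /\
    (forall n, Cmod (exp_coef m n) <= C * (/ q) ^ n).
Proof.
  intros Hm Hq. destruct (trig_dominator mu 1 q Hm ltac:(lra) ltac:(lra)) as [D [d [HD Hd]]].
  destruct (moment_series 0 PI (fun t => Cpow (sin t) mu) cos D d q Rbar_lt_0_PI Hq) as [m [P H]]; auto.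
  - intros. now apply sin_Cpow_cont.
  - intros. apply cont_derive. auto_derive. easy.
  - intros t Ht. eapply Rle_trans; [|apply Hd, Ht]. apply Rmult_le_compat_r; [left; apply exp_pos|].
    rewrite <- (Rmult_1_r (Cmod _)) at 1. apply Rmult_le_compat_l; [apply Cmod_ge0|].
    rewrite <- exp_0. apply exp_le_exp. pose proof (Rabs_pos (cos t)). rewrite exp_0. lra.
  - exists m, P, (2 * d). exact H.
Qed.

(** All real z are covered, because s = tx/(1-t) changes sign with t. Since cos is bounded, the
    radius may be taken as |z| + 1. *)
Lemma itilde_poisson (mu : Cx) z J : -1 < fst mu ->
  cint 0 PI (fun t => Cmul (RtoC (exp (- (z * cos t)))) (Cpow (sin t) mu)) J ->
  Itilde (Chalf mu) z = Cmul (Cinv (Cmul gamma_half (CGamma (Chalf (Cadd mu Cone))))) J.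
Proof.
  intros Hm HJ.
  assert (Hq : 0 < Rabs z + 1) by (pose proof (Rabs_pos z); lra).
  destruct (trig_moment_series mu _ Hm Hq) as [m [P [C [Hm1 [HP [HC _]]]]]].
  assert (Em : forall n, m n = trig_moment mu n).
  { intros n. eapply cint_unique; [exact Rbar_lt_0_PI|apply Hm1|]. now apply trig_moment_cint. }
  apply itilde_eq with m.
  - lra.
  - now apply CGamma_half_neq0.
  - rewrite Em. now apply beta_identity.
  - intros n. rewrite !Em. now apply trig_moment_SS.
  - intros k. rewrite Em. now apply trig_moment_odd.
  - replace J with (P z); [apply HC; lra|].
    eapply cint_unique; [exact Rbar_lt_0_PI|apply HP; lra|exact HJ].
Qed.

(** * Point masses and the index -1/2 *)

Lemma C_series_add a b l m : C_series a l -> C_series b m ->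
  C_series (fun n => Cadd (a n) (b n)) (Cadd l m).
Proof.
  intros [H1 H2] [H3 H4].
  assert (W : forall u v p q, infinite_sum u p -> infinite_sum v q -> infinite_sum (fun n => u n + v n) (p + q)).
  { intros u v p q Hu Hv. apply is_series_Reals in Hu, Hv. apply is_series_Reals.
    now apply (is_series_plus u v). }
  split; simpl; now apply W.
Qed.

Lemma exp_point_series b s :
  C_series (fun n => Cmul (exp_coef (fun k => RtoC (b ^ k)) n) (RtoC (s ^ n))) (RtoC (exp (- (s * b)))).
Proof.
  apply C_series_ext with (fun n => RtoC (/ INR (fact n) * (- (s * b)) ^ n)).
  { intros n. unfold exp_coef. replace (- (s * b)) with ((-1) * b * s) by ring.
    rewrite !Rpow_mult_distr. unfold Rdiv. rewrite !RtoC_mul. ring. }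
  split; simpl; [unfold exp; exact (proj2_sig (exist_exp (- (s * b))))|].
  intros e He. exists O. intros n _.
  rewrite sum_eq_R0 by easy. unfold Rdist. rewrite Rminus_diag, Rabs_R0. easy.
Qed.

Lemma exp_point_coef_le b n : Rabs b <= 1 -> Cmod (exp_coef (fun k => RtoC (b ^ k)) n) <= 1.
Proof.
  intros Hb. unfold exp_coef. rewrite Cmod_mul, !Cmod_RtoC. unfold Rdiv.
  rewrite Rabs_mult, pow_1_abs, Rmult_1_l, <- RPow_abs.
  pose proof (INR_fact_lt_0 n) as Hf.
  rewrite Rabs_right by (left; now apply Rinv_0_lt_compat).
  assert (1 <= INR (fact n)) by (apply (le_INR 1), lt_O_fact).
  assert (/ INR (fact n) <= 1) by (rewrite <- Rinv_1; apply Rinv_le_contravar; lra).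
  assert (0 < / INR (fact n)) by now apply Rinv_0_lt_compat.
  assert (Rabs b ^ n <= 1) by (rewrite <- (pow1 n); apply pow_incr; split; [apply Rabs_pos|easy]).
  assert (0 <= Rabs b ^ n) by (apply pow_le, Rabs_pos). nra.
Qed.

Lemma exp_coef_add a b n : exp_coef (fun k => Cadd (a k) (b k)) n = Cadd (exp_coef a n) (exp_coef b n).
Proof. unfold exp_coef. ring. Qed.
Lemma exp_coef_scal c a n : exp_coef (fun k => Cmul c (a k)) n = Cmul c (exp_coef a n).
Proof. unfold exp_coef. ring. Qed.

(* Moments of two point masses at 1 and -1: the limit of the [phi]-integral at [nu = -1]. *)
Definition two_points (p1 p2 : Cx) (n : nat) : Cx :=
  Cadd (Cmul p1 (RtoC (1 ^ n))) (Cmul p2 (RtoC ((-1) ^ n))).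

Lemma two_points_series p1 p2 s :
  C_series (fun n => Cmul (exp_coef (two_points p1 p2) n) (RtoC (s ^ n)))
    (Cadd (Cmul p1 (RtoC (exp (- s)))) (Cmul p2 (RtoC (exp s)))).
Proof.
  pose proof (exp_point_series 1 s) as H1. pose proof (exp_point_series (-1) s) as H2.
  replace (- (s * 1)) with (- s) in H1 by ring. replace (- (s * -1)) with s in H2 by ring.
  pose proof (C_series_add _ _ _ _ (C_series_scal p1 _ _ H1) (C_series_scal p2 _ _ H2)) as H.
  apply C_series_ext with (2 := H). intros n. unfold two_points.
  rewrite (exp_coef_add (fun k => Cmul p1 (RtoC (1 ^ k))) (fun k => Cmul p2 (RtoC ((-1) ^ k)))), !exp_coef_scal.
  ring.
Qed.

Lemma two_points_coef_le p1 p2 n : Cmod (exp_coef (two_points p1 p2) n) <= (Cmod p1 + Cmod p2) * (/ 1) ^ n.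
Proof.
  unfold two_points.
  rewrite (exp_coef_add (fun k => Cmul p1 (RtoC (1 ^ k))) (fun k => Cmul p2 (RtoC ((-1) ^ k)))), !exp_coef_scal.
  eapply Rle_trans; [apply Cmod_add|]. rewrite !Cmod_mul, Rinv_1, pow1, Rmult_1_r.
  pose proof (exp_point_coef_le 1 n ltac:(rewrite Rabs_R1; lra)).
  pose proof (exp_point_coef_le (-1) n ltac:(rewrite Rabs_left; lra)).
  pose proof (Cmod_ge0 p1). pose proof (Cmod_ge0 p2).
  assert (Cmod p1 * Cmod (exp_coef (fun k => RtoC (1 ^ k)) n) <= Cmod p1 * 1) by (apply Rmult_le_compat_l; easy).
  assert (Cmod p2 * Cmod (exp_coef (fun k => RtoC ((-1) ^ k)) n) <= Cmod p2 * 1) by (apply Rmult_le_compat_l; easy).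
  lra.
Qed.

(** Half masses at 1 and -1 have moments 1, 0, 1, 0, ...; at mu = -1 the recursion reads (n+1)
    M(n+2) = (n+1) M(n), so they qualify for [itilde_eq], with [ga] = 1. *)
Lemma itilde_minus_half z :
  Itilde (Chalf (RtoC (-1))) z =
  Cmul (Cinv gamma_half) (Cadd (Cmul (RtoC (1 / 2)) (RtoC (exp (- z)))) (Cmul (RtoC (1 / 2)) (RtoC (exp z)))).
Proof.
  pose proof gamma_half_neq0 as NG.
  rewrite (itilde_eq (RtoC (-1)) Cone _ z (two_points (RtoC (1 / 2)) (RtoC (1 / 2)))
    ltac:(simpl; lra) Cone_neq0) with (4 := two_points_series (RtoC (1 / 2)) (RtoC (1 / 2)) z).
  - replace (Cmul gamma_half Cone) with gamma_half by ring. easy.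
  - replace (Cadd Cone (Chalf (RtoC (-1)))) with (RtoC (1 / 2)) by (unfold Chalf; apply Cx_ext; simpl; field).
    fold gamma_half. unfold two_points. rewrite !pow_O. apply Cx_ext; simpl; field.
  - intros n. unfold two_points. rewrite !pow1. simpl pow.
    replace (-1 * (-1 * (-1) ^ n)) with ((-1) ^ n) by ring.
    apply Cx_ext; simpl; ring.
  - intros k. unfold two_points. rewrite pow_1_odd, pow1. apply Cx_ext; simpl; field.
Qed.

(** * Evaluation of the right-hand sides and assembly *)

Lemma cpow_prefactor mu nu t :
  Cpow (1 - t) (Copp (Chalf (Cadd (Cadd mu nu) (RtoC 2)))) =
  Cpow (1 - t) (Copp (Cadd (Chalf (Cadd mu nu)) Cone)).
Proof. do 2 f_equal. unfold Chalf. apply Cx_ext; simpl; field. Qed.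

Lemma div_split x t : Rabs t < 1 / 2 -> x / (1 - t) = x + t * x / (1 - t).
Proof. intros H. apply Rabs_def2 in H. field. lra. Qed.

Lemma fst_Chalf_add (mu nu : Cx) : -1 < fst mu -> -1 <= fst nu -> -1 < fst (Chalf (Cadd mu nu)).
Proof. intros. unfold Chalf; cbn [fst snd Cmul Cadd RtoC]. lra. Qed.

(** The integral is evaluated from the inside out: for each fixed [th] the inner one is a finite
    combination of the [m2 n]. *)
Lemma lag_iterated j al x (a b : Rbar) (k2 : R -> R) (w1 w2 : R -> Cx) m1 m2 :
  (forall n, cint 0 PI (fun t => Cmul (RtoC (cos t ^ n)) (w1 t)) (m1 n)) ->
  (forall n, cint a b (fun t => Cmul (RtoC (k2 t ^ n)) (w2 t)) (m2 n)) ->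
  (forall th, cint a b (fun ph => Cmul (Laguerre j al (x * (cos th + k2 ph))) (Cmul (w1 th) (w2 ph)))
     (Cmul (lag_sum j al x (exp_coef (fun k => RtoC (cos th ^ k))) (exp_coef m2)) (w1 th))) /\
  cint 0 PI (fun th => Cmul (lag_sum j al x (exp_coef (fun k => RtoC (cos th ^ k))) (exp_coef m2)) (w1 th))
    (lag_sum j al x (exp_coef m1) (exp_coef m2)).
Proof.
  intros H1 H2. split.
  - intros th.
    pose proof (lag_sum_cint_r a b j al x (exp_coef (fun k => RtoC (cos th ^ k)))
      (fun k t => exp_coef (fun i => RtoC (k2 t ^ i)) k) w2 (exp_coef m2)
      (fun n => exp_coef_cint a b k2 w2 m2 n (H2 n))) as H.
    apply (cint_scal _ _ (w1 th)) in H.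
    eapply cint_eq; [|apply cint_ext with (2 := H)]; [ring|].
    intros t _. rewrite laguerre_split. cbv beta.
    change (fun k => exp_coef (fun i => RtoC (k2 t ^ i)) k) with (exp_coef (fun i => RtoC (k2 t ^ i))). ring.
  - apply (lag_sum_cint_l 0 PI j al x (exp_coef m2) (fun k t => exp_coef (fun i => RtoC (cos t ^ i)) k) w1).
    intros n. now apply exp_coef_cint.
Qed.

Lemma lag_two_points j al x A p1 p2 :
  lag_sum j al x A (exp_coef (two_points p1 p2)) =
  Cadd (Cmul p1 (lag_sum j al x A (exp_coef (fun k => RtoC (1 ^ k)))))
    (Cmul p2 (lag_sum j al x A (exp_coef (fun k => RtoC ((-1) ^ k))))).
Proof.
  unfold lag_sum. rewrite <- !Csum_upto_scal, <- Csum_upto_add. apply Csum_upto_ext. intros n _.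
  transitivity (Cmul (Cmul (RtoC (x ^ n)) (Cbinom (Cadd (RtoC (INR j)) al) (j - n)))
    (Cadd (Cmul p1 (Csum_upto n (fun k => Cmul (A k) (exp_coef (fun k => RtoC (1 ^ k)) (n - k)))))
      (Cmul p2 (Csum_upto n (fun k => Cmul (A k) (exp_coef (fun k => RtoC ((-1) ^ k)) (n - k))))))); [|ring].
  f_equal. rewrite <- !Csum_upto_scal, <- Csum_upto_add. apply Csum_upto_ext. intros k _.
  unfold exp_coef, two_points. ring.
Qed.

Lemma lag_single j al x b (c : Cx) (mu : Cx) m1 :
  (forall n, cint 0 PI (fun t => Cmul (RtoC (cos t ^ n)) (Cpow (sin t) mu)) (m1 n)) ->
  CInt_oo (fun th => Cmul c (Cmul (Laguerre j al (x * (cos th + b))) (Cpow (sin th) mu))) 0 PI =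
  Cmul c (lag_sum j al x (exp_coef m1) (exp_coef (fun k => RtoC (b ^ k)))).
Proof.
  intros H. apply CInt_oo_eq; [apply PI_RGT_0|]. apply cint_scal.
  pose proof (lag_sum_cint_l 0 PI j al x (exp_coef (fun k => RtoC (b ^ k)))
    (fun k t => exp_coef (fun i => RtoC (cos t ^ i)) k) (fun t => Cpow (sin t) mu) (exp_coef m1)
    (fun n => exp_coef_cint 0 PI cos _ m1 n (H n))) as L.
  apply cint_ext with (2 := L). intros t _. now rewrite laguerre_split.
Qed.

Lemma Chalf_sub_one (mu : Cx) : Chalf (Cadd mu (RtoC (-1))) = Chalf (Csub mu Cone).
Proof. unfold Chalf. apply Cx_ext; simpl; field. Qed.

Theorem theorem5p1 :
  (forall (j : nat) (mu nu : Cx) (x : R),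
     -1 < Cre mu -> -1 < Cre nu -> 0 < x ->
     Lambda1 mu nu j x =
     Cmul (Cinv (Cmul (RtoC PI) (Cmul (CGamma (Chalf (Cadd mu Cone))) (CGamma (Chalf (Cadd nu Cone))))))
       (CInt_oo (fun th => CInt_oo (fun ph =>
           Cmul (RtoC (exp (- (x * cos ph))))
           (Cmul (Laguerre j (Chalf (Cadd mu nu)) (x * (cos th + cos ph)))
           (Cmul (Cpow (sin th) mu) (Cpow (sin ph) nu)))) 0 PI) 0 PI)) /\
  (forall (j : nat) (mu nu : Cx) (x : R),
     -1 < Cre mu -> -1 < Cre nu -> 0 < x ->
     Lambda2 mu nu j x =
     Cmul (Cinv (Cmul (CGamma (Chalf (Cadd mu Cone))) (CGamma (Chalf (Cadd nu Cone)))))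
       (CInt_oo (fun th => CInt_oinf (fun ph =>
           Cmul (RtoC (exp (- (x * cosh ph))))
           (Cmul (Laguerre j (Chalf (Cadd mu nu)) (x * (cos th + cosh ph)))
           (Cmul (Cpow (sin th) mu) (Cpow (sinh ph) nu)))) 0) 0 PI)) /\
  (forall (j : nat) (mu : Cx) (x : R),
     -1 < Cre mu -> 0 < x ->
     Lambda1 mu (RtoC (-1)) j x =
     Cmul (Cinv (Cmul (RtoC (2 * PI)) (CGamma (Chalf (Cadd mu Cone)))))
       (Csum_upto 1 (fun i =>
          CInt_oo (fun th =>
            Cmul (RtoC (exp (- ((-1) ^ i * x))))
            (Cmul (Laguerre j (Chalf (Csub mu Cone)) (x * (cos th + (-1) ^ i)))
                  (Cpow (sin th) mu))) 0 PI))) /\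
  (forall (j : nat) (mu : Cx) (x : R),
     -1 < Cre mu -> 0 < x ->
     Lambda2 mu (RtoC (-1)) j x =
     Cmul (Cinv (Cmul (RtoC 2) (CGamma (Chalf (Cadd mu Cone)))))
       (CInt_oo (fun th =>
            Cmul (RtoC (exp (- x)))
            (Cmul (Laguerre j (Chalf (Csub mu Cone)) (x * (cos th + 1)))
                  (Cpow (sin th) mu))) 0 PI)).
Proof.
  unfold Cre. split; [|split; [|split]].
  - intros j mu nu x Hmu Hnu Hx.
    assert (Hq : 0 < 1) by lra.
    destruct (trig_moment_series mu 1 Hmu Hq) as [m1 [P1 [C1 [M1 [I1 [S1 B1]]]]]].
    (* The factor at the fixed x goes into the weight, so the transform at s is the Poisson integral
       at x + s. *)
    set (w2 := fun t => Cmul (RtoC (exp (- (x * cos t)))) (Cpow (sin t) nu)).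
    destruct (trig_dominator nu x 1 Hnu Hx ltac:(lra)) as [D [d [HD Hd]]].
    destruct (moment_series 0 PI w2 cos D d 1 Rbar_lt_0_PI Hq) as [m2 [P2 [M2 [I2 [S2 B2]]]]]; auto.
    { intros t Ht. apply ccont_mul; [|now apply sin_Cpow_cont]. apply ccont_RtoC, cont_derive. auto_derive. easy. }
    { intros. apply cont_derive. auto_derive. easy. }
    { intros t Ht. eapply Rle_trans; [|apply Hd, Ht]. apply Rmult_le_compat_r; [left; apply exp_pos|].
      unfold w2. rewrite Cmod_mul, Rmult_comm, Cmod_RtoC, Rabs_exp.
      apply Rmult_le_compat_l; [apply Cmod_ge0|]. apply exp_le_exp.
      pose proof (Rabs_maj2 (cos t)). nra. }
    set (ga := CGamma (Chalf (Cadd mu Cone))). set (gb := CGamma (Chalf (Cadd nu Cone))).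
    assert (Na : ga <> Czero) by now apply CGamma_half_neq0.
    assert (Nb : gb <> Czero) by now apply CGamma_half_neq0.
    pose proof gamma_half_neq0 as NG.
    unfold Lambda1.
    rewrite (taylor_assembly (Chalf (Cadd mu nu)) (Cinv (Cmul (RtoC PI) (Cmul ga gb))) x (exp_coef m1) (exp_coef m2)
      P1 P2 (fun t => G1 mu nu t x) C1 (2 * d) 1 1); auto; try lra.
    + destruct (lag_iterated j (Chalf (Cadd mu nu)) x 0 PI cos (fun t => Cpow (sin t) mu) w2 m1 m2 M1 M2) as [L1 L2].
      f_equal. symmetry. apply CInt_oo_eq; [apply PI_RGT_0|].
      apply cint_ext with (2 := L2). intros th _. symmetry. apply CInt_oo_eq; [apply PI_RGT_0|].
      apply cint_ext with (2 := L1 th). intros ph _. unfold w2. ring.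
    + apply fst_Chalf_add; lra.
    + intros t s _ Ht Es Hs. unfold G1. rewrite cpow_prefactor, <- Es, (div_split x t Ht), <- Es.
      rewrite (itilde_poisson mu s (P1 s) Hmu (I1 s Hs)).
      rewrite (itilde_poisson nu (x + s) (P2 s) Hnu).
      (* Each Poisson integral contributes a factor 1/Gamma(1/2); their product is 1/pi. *)
      * fold ga gb. rewrite <- gamma_half_sqr. field. repeat split; easy.
      * apply cint_ext with (2 := I2 s Hs). intros ph _. unfold w2.
        replace (- ((x + s) * cos ph)) with (- (s * cos ph) + - (x * cos ph)) by ring.
        rewrite exp_plus, RtoC_mul. ring.
  - intros j mu nu x Hmu Hnu Hx.
    (* As cosh is unbounded, e^(q cosh) must be paid for by e^(-x cosh): with q = x/2 half of the
       decay remains for the dominator, and |s| < x/2 keeps x + s positive. *)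
    assert (Hq : 0 < x / 2) by lra.
    destruct (trig_moment_series mu (x / 2) Hmu Hq) as [m1 [P1 [C1 [M1 [I1 [S1 B1]]]]]].
    assert (Hnr : -1 < fst (RtoC (fst nu))) by easy.
    (* Used only for existence: Basset's integrand with real index Re nu, at x/2, is the
       dominator. *)
    destruct (basset _ _ Hnr Hq) as [d [[HD _] _]].
    destruct (moment_series 0 p_infty (hyp_int nu x 0) cosh
      (fun t => fst (hyp_int (RtoC (fst nu)) (x / 2) 0 t)) (fst d) (x / 2) I Hq) as [m2 [P2 [M2 [I2 [S2 B2]]]]]; auto.
    { intros t Ht. now apply hyp_int_cont, pos_inI. }
    { intros. apply cont_cosh. }
    { intros t Ht. apply pos_inI in Ht. unfold hyp_int. rewrite Cmod_mul, Cmod_Cpow, Cmod_RtoC, Cpow_RtoC.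
      pose proof (cosh_ge1 t). rewrite !pow_O, !Rmult_1_r, (Rabs_right (cosh t)) by lra.
      rewrite Rabs_exp. simpl. right.
      replace (- (x / 2 * cosh t)) with (- (x * cosh t) + x / 2 * cosh t) by field.
      rewrite exp_plus. ring. }
    set (ga := CGamma (Chalf (Cadd mu Cone))). set (gb := CGamma (Chalf (Cadd nu Cone))).
    assert (Na : ga <> Czero) by now apply CGamma_half_neq0.
    assert (Nb : gb <> Czero) by now apply CGamma_half_neq0.
    pose proof gamma_half_neq0 as NG.
    unfold Lambda2.
    rewrite (taylor_assembly (Chalf (Cadd mu nu)) (Cinv (Cmul ga gb)) x (exp_coef m1) (exp_coef m2)
      P1 P2 (fun t => G2 mu nu t x) C1 (2 * fst d) (x / 2) 1); auto; try lra.
    + destruct (lag_iterated j (Chalf (Cadd mu nu)) x 0 p_infty cosh (fun t => Cpow (sin t) mu) (hyp_int nu x 0) m1 m2 M1 M2)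
        as [L1 L2].
      f_equal. symmetry. apply CInt_oo_eq; [apply PI_RGT_0|].
      apply cint_ext with (2 := L2). intros th _. symmetry. apply CInt_oinf_eq.
      apply cint_ext with (2 := L1 th). intros ph _. unfold hyp_int. rewrite pow_O, Rmult_1_r. ring.
    + apply fst_Chalf_add; lra.
    + intros t s _ Ht Es Hs. unfold G2. rewrite cpow_prefactor, <- Es, (div_split x t Ht), <- Es.
      rewrite (itilde_poisson mu s (P1 s) Hmu (I1 s Hs)).
      assert (Hz : 0 < x + s) by (apply Rabs_def2 in Hs; lra).
      destruct (basset nu (x + s) Hnu Hz) as [S [HS ES]]. fold gb in ES.
      assert (E : S = P2 s).
      { apply cint_unique with (1 := I : Rbar_lt 0 p_infty) (2 := HS).
        apply cint_ext with (2 := I2 s Hs). intros ph _. unfold hyp_int. rewrite !pow_O, !Rmult_1_r.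
        replace (- ((x + s) * cosh ph)) with (- (s * cosh ph) + - (x * cosh ph)) by ring.
        rewrite exp_plus, RtoC_mul. ring. }
      fold ga. replace (Ktilde (Chalf nu) (x + s)) with (Cmul (Cinv gb) (Cmul gb (Ktilde (Chalf nu) (x + s))))
        by now field.
      rewrite <- ES, E. field. repeat split; easy.
  - intros j mu x Hmu Hx. assert (Hq : 0 < 1) by lra.
    destruct (trig_moment_series mu 1 Hmu Hq) as [m1 [P1 [C1 [M1 [I1 [S1 B1]]]]]].
    set (ga := CGamma (Chalf (Cadd mu Cone))).
    assert (Na : ga <> Czero) by now apply CGamma_half_neq0.
    pose proof gamma_half_neq0 as NG.
    assert (N2 : RtoC 2 <> Czero) by (apply RtoC_neq0; lra).
    (* Here the second Bessel factor is a multiple of e^(-(x+s)) + e^(x+s), the transform at s of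
       masses e^(-x) at 1 and e^x at -1. *)
    set (p1 := RtoC (exp (- x))). set (p2 := RtoC (exp x)).
    unfold Lambda1.
    rewrite (taylor_assembly (Chalf (Cadd mu (RtoC (-1)))) (Cinv (Cmul (RtoC (2 * PI)) ga)) x (exp_coef m1)
      (exp_coef (two_points p1 p2)) P1 (fun s => Cadd (Cmul p1 (RtoC (exp (- s)))) (Cmul p2 (RtoC (exp s))))
      (fun t => G1 mu (RtoC (-1)) t x) C1 (Cmod p1 + Cmod p2) 1 1); auto; try lra.
    + f_equal. simpl Csum_upto. rewrite !(lag_single _ _ _ _ _ _ m1 M1), lag_two_points, Chalf_sub_one.
      replace (-1 * 1) with (-1) by ring.
      replace (- (1 * x)) with (- x) by ring. replace (- (-1 * x)) with x by ring. easy.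
    + apply fst_Chalf_add; simpl; lra.
    + intros n. apply two_points_coef_le.
    + intros s _. apply two_points_series.
    + intros t s _ Ht Es Hs. unfold G1. rewrite cpow_prefactor, <- Es, (div_split x t Ht), <- Es.
      rewrite (itilde_poisson mu s (P1 s) Hmu (I1 s Hs)), itilde_minus_half. fold ga.
      replace (- (x + s)) with (- x + - s) by ring. rewrite !exp_plus, !RtoC_mul. fold p1 p2.
      rewrite <- gamma_half_sqr.
      replace (RtoC (1 / 2)) with (Cinv (RtoC 2)) by (rewrite <- RtoC_inv by lra; f_equal; field).
      field. repeat split; easy.
  - intros j mu x Hmu Hx. assert (Hq : 0 < Rmin 1 x) by (apply Rmin_glb_lt; lra).
    pose proof (Rmin_l 1 x). pose proof (Rmin_r 1 x).
    assert (Hq1 : 0 < 1) by lra.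
    destruct (trig_moment_series mu 1 Hmu Hq1) as [m1 [P1 [C1 [M1 [I1 [S1 B1]]]]]].
    set (ga := CGamma (Chalf (Cadd mu Cone))).
    assert (Na : ga <> Czero) by now apply CGamma_half_neq0.
    pose proof gamma_half_neq0 as NG.
    assert (N2 : RtoC 2 <> Czero) by (apply RtoC_neq0; lra).
    (* K of index -1/2 has a single exponential: only the point 1 carries mass, and the second mass
       is set to zero. *)
    set (p1 := RtoC (exp (- x))).
    unfold Lambda2.
    rewrite (taylor_assembly (Chalf (Cadd mu (RtoC (-1)))) (Cinv (Cmul (RtoC 2) ga)) x (exp_coef m1)
      (exp_coef (two_points p1 Czero)) P1 (fun s => Cadd (Cmul p1 (RtoC (exp (- s)))) (Cmul Czero (RtoC (exp s))))
      (fun t => G2 mu (RtoC (-1)) t x) C1 (Cmod p1 + Cmod Czero) 1 (Rmin (1 / 4) (/ 2))); auto; try lra.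
    + f_equal. rewrite !(lag_single _ _ _ _ _ _ m1 M1), lag_two_points, Chalf_sub_one. fold p1. ring.
    + apply fst_Chalf_add; simpl; lra.
    + apply Rmin_glb_lt; lra.
    + intros n. apply two_points_coef_le.
    + intros s _. apply two_points_series.
    + intros t s _ Ht Es Hs. unfold G2. rewrite cpow_prefactor, <- Es.
      assert (Hz : 0 < x / (1 - t)) by (apply Rabs_def2 in Ht; apply Rdiv_lt_0_compat; lra).
      rewrite (itilde_poisson mu s (P1 s) Hmu (I1 s Hs)), ktilde_minus_half by easy. fold ga.
      rewrite (div_split x t Ht), <- Es.
      replace (- (x + s)) with (- x + - s) by ring. rewrite !exp_plus, !RtoC_mul. fold p1.
      replace (RtoC (1 / 2)) with (Cinv (RtoC 2)) by (rewrite <- RtoC_inv by lra; f_equal; field).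
      field. repeat split; easy.
Qed.
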